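(* The proof system $\mathrm{R}^0(\mathrm{quad})$ is weakly automatizable if and only if the proof system $\mathrm{R}^0(\mathrm{lin})$ is weakly automatizable.
   Context: $\mathrm{R}^0(\mathrm{lin})$: refutation system whose lines are disjunctions of linear equations $a_1x_1+\dots+a_nx_n+a_{n+1}=a_0$ with integer coefficients in unary (size = $\sum|a_i|$), with Boolean axioms $x_i\in\{0,1\}$ (where $L\in S$ abbreviates $\bigvee_{s\in S}L=s$) and rules: Resolution (from $A\vee(L_1=a)$ and $B\vee(L_2=b)$ derive $A\vee B\vee(L_1-L_2=a-b)$), Weakening (from $A$ derive $A\vee L$), Simplification (from $A\vee(0=k)$, $k\neq0$, derive $A$); a refutation derives the empty disjunction, its size is the total size of its lines. $\mathrm{R}^0(\mathrm{quad})$ is the same but with quadratic equations $\sum_{i,j}c_{ij}x_ix_j+\sum_ic_ix_i+c=a$ and Boolean axioms $x_i\in\{0,1\}$, $x_i+x_j-x_ix_j\in\{0,1\}$, $x_i-x_ix_j\in\{0,1\}$. A refutation system $\mathcal P$ is automatizable if there is an algorithm that, given an unsatisfiable $\tau$, finds a $\mathcal P$-refutation of $\tau$ in time polynomial in the size of the smallest $\mathcal P$-refutation of $\tau$. $\mathcal P$ polynomially simulates $\mathcal Q$ if a polynomial-time function maps $\mathcal Q$-refutations to $\mathcal P$-refutations of the same formulas. $\mathcal P$ is weakly automatizable if some automatizable refutation system polynomially simulates $\mathcal P$. *)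

(* Defs.v *)
From HB Require Import structures.
From mathcomp Require Import all_boot all_order all_algebra.
From mathcomp Require Import mpoly.

Set Implicit Arguments.
Unset Strict Implicit.
Unset Printing Implicit Defensive.

Import Order.TTheory GRing.Theory Num.Theory.

Definition word := seq bool.

(* tape symbols: Some b = bit b, None = blank *)
Definition sym := option bool.

(* A deterministic single-tape Turing machine with states 'I_(tm_q.+1)
   (state 0 is the initial state).  The transition table is a finite
   function; [None] means "halt"; the bool in the result is the head move
   (true = right, false = left). *)
Record TM := mkTM {
  tm_q : nat;
  tm_delta : {ffun 'I_tm_q.+1 * sym -> option ('I_tm_q.+1 * sym * bool)} }.

(* tape = (reversed part left of the head, scanned symbol, part right of head) *)
Definition tape := (seq sym * sym * seq sym)%type.
Definition config (M : TM) := ('I_(tm_q M).+1 * tape)%type.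

Definition tm_step (M : TM) (c : config M) : option (config M) :=
  let: (q, (l, h, r)) := c in
  match tm_delta M (q, h) with
  | None => None
  | Some (q', w, d) =>
      Some (q', if d then (w :: l, head None r, behead r)
                     else (behead l, head None l, w :: r))
  end.

Fixpoint tm_run (M : TM) (t : nat) (c : config M) : option tape :=
  match tm_step c with
  | None => Some c.2
  | Some c' => if t is t'.+1 then tm_run t' c' else None
  end.

Definition tm_init (M : TM) (x : word) : config M :=
  (ord0, ([::], head None (map Some x), behead (map Some x))).

Fixpoint somes (s : seq sym) : word :=
  match s with Some b :: s' => b :: somes s' | _ => [::] end.

Definition tm_out (tp : tape) : word := let: (_, h, r) := tp in somes (h :: r).

Definition tm_computes_within (M : TM) (x : word) (t : nat) (y : word) : Prop :=
  omap tm_out (tm_run t (tm_init M x)) = Some y.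

Definition polytime_fun (f : word -> word) : Prop :=
  exists (M : TM) (c k : nat), forall x, exists t,
    t <= c * (size x).+1 ^ k /\ tm_computes_within M x t (f x).

Definition polytime_pred (P : word -> Prop) : Prop :=
  exists f, polytime_fun f /\ forall x, P x <-> f x = [:: true].

Definition pairw (x y : word) : word :=
  flatten [seq [:: true; b] | b <- x] ++ [:: false; false] ++ y.

Fixpoint bin_fuel (fuel n : nat) : seq bool :=
  match fuel with
  | 0 => [::]
  | f.+1 => if n is 0 then [::] else odd n :: bin_fuel f n./2
  end.
Definition bin (n : nat) : seq bool := bin_fuel n n.

(* self-delimiting binary code of a natural number *)
Definition enc_nat (n : nat) : word :=
  flatten [seq [:: true; b] | b <- bin n] ++ [:: false].

Definition enc_int (z : int) : word :=
  [:: (z < 0)%R] ++ nseq `|z|%N true ++ [:: false].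

Definition enc_list (T : Type) (e : T -> word) (s : seq T) : word :=
  flatten [seq true :: e x | x <- s] ++ [:: false].

(* a literal (i, true) is x_i, (i, false) is ~ x_i; a clause is a list of
   literals; a CNF is a list of clauses. *)
Definition literal := (nat * bool)%type.
Definition clause := seq literal.
Definition cnf := seq clause.

Definition cnf_sat (tau : cnf) : Prop :=
  exists a : nat -> bool, all (fun cl => has (fun l : literal => a l.1 == l.2) cl) tau.

Definition cnf_unsat (tau : cnf) : Prop := ~ cnf_sat tau.

Definition enc_cnf (tau : cnf) : word :=
  enc_list (enc_list (fun l : literal => enc_nat l.1 ++ [:: l.2])) tau.

(* number of variables: the variables of tau are x_0, ..., x_(nvars tau - 1) *)
Definition nvars (tau : cnf) : nat := foldr maxn 0 [seq l.1.+1 | l <- flatten tau].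

Local Open Scope ring_scope.

(* an equation  p = a  where p is a polynomial (including its constant term
   a_{n+1}) with integer coefficients and a (= a_0) an integer *)
Definition eqn (n : nat) := ({mpoly int[n]} * int)%type.
(* a line: a disjunction of equations (read as a set of disjuncts) *)
Definition line (n : nat) := seq (eqn n).

Definition var (n i : nat) : {mpoly int[n]} :=
  match @insub nat (fun k => k < n)%N 'I_n i with Some j => 'X_j | None => 0 end.

Definition in01 (n : nat) (L : {mpoly int[n]}) : line n := [:: (L, 0%R); (L, 1%R)].

Definition lin_bool_axioms (n : nat) : seq (line n) :=
  [seq in01 'X_i | i <- enum 'I_n].

Definition quad_bool_axioms (n : nat) : seq (line n) :=
  lin_bool_axioms n
  ++ [seq in01 ('X_i + 'X_j - 'X_i * 'X_j) | i <- enum 'I_n, j <- enum 'I_n]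
  ++ [seq in01 ('X_i - 'X_i * 'X_j) | i <- enum 'I_n, j <- enum 'I_n].

Definition clause_line (n : nat) (cl : clause) : line n :=
  [seq (var n l.1, (nat_of_bool l.2)%:Z) | l : literal <- cl].

Definition clause_lines (tau : cnf) : seq (line (nvars tau)) :=
  [seq clause_line (nvars tau) cl | cl <- tau].

Definition resolution_rule (n : nat) (C1 C2 D : line n) : Prop :=
  exists (e1 e2 : eqn n) (A B : line n),
    C1 =i e1 :: A /\ C2 =i e2 :: B /\
    D =i (e1.1 - e2.1, e1.2 - e2.2) :: A ++ B.

Definition weakening_rule (n : nat) (C D : line n) : Prop :=
  exists e : eqn n, D =i e :: C.

Definition simplification_rule (n : nat) (C D : line n) : Prop :=
  exists (k : int) (A : line n), k != 0 /\ C =i (0, k) :: A /\ D =i A.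

Definition valid_line (n : nat) (ax prev : seq (line n)) (D : line n) : Prop :=
  (exists C, C \in ax /\ D =i C)
  \/ (exists C1 C2, C1 \in prev /\ C2 \in prev /\ resolution_rule C1 C2 D)
  \/ (exists C, C \in prev /\ weakening_rule C D)
  \/ (exists C, C \in prev /\ simplification_rule C D).

Definition is_refutation (d n : nat) (ax : seq (line n)) (pi : seq (line n)) : Prop :=
  (forall C, C \in pi -> forall e, e \in C -> (msize e.1 <= d.+1)%N) /\
  (exists pi', pi = rcons pi' [::]) /\
  (forall k, (k < size pi)%N -> valid_line ax (take k pi) (nth [::] pi k)).

Definition enc_monom (n : nat) (m : 'X_{1..n}) : word :=
  enc_list (fun i : 'I_n => enc_nat (nat_of_ord i) ++ enc_nat (m i))
           [seq i <- enum 'I_n | (m i != 0)%N].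

Definition enc_poly (n : nat) (p : {mpoly int[n]}) : word :=
  enc_list (fun m => enc_monom m ++ enc_int p@_m) (msupp p).

Definition enc_eqn (n : nat) (e : eqn n) : word := enc_poly e.1 ++ enc_int e.2.

Definition enc_refutation (n : nat) (pi : seq (line n)) : word :=
  enc_list (enc_list (@enc_eqn n)) pi.

Definition R0_ref (d : nat) (bax : forall n, seq (line n)) (x y : word) : Prop :=
  exists (tau : cnf) (pi : seq (line (nvars tau))),
    x = enc_cnf tau /\ y = enc_refutation pi /\
    is_refutation d (bax (nvars tau) ++ clause_lines tau) pi.

Definition R0lin : word -> word -> Prop := R0_ref 1 lin_bool_axioms.
Definition R0quad : word -> word -> Prop := R0_ref 2 quad_bool_axioms.

Record refsys := {
  rs_ref : word -> word -> Prop;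
  rs_check : polytime_pred (fun w => exists x y, w = pairw x y /\ rs_ref x y);
  rs_sound : forall x y, rs_ref x y -> exists tau, x = enc_cnf tau /\ cnf_unsat tau;
  rs_complete : forall tau, cnf_unsat tau -> exists y, rs_ref (enc_cnf tau) y }.

Definition min_ref_size (R : word -> word -> Prop) (x : word) (s : nat) : Prop :=
  (exists y, R x y /\ size y = s) /\ (forall y, R x y -> (s <= size y)%N).

Definition automatizable (Q : refsys) : Prop :=
  exists (M : TM) (c k : nat), forall tau, cnf_unsat tau ->
    forall s, min_ref_size (rs_ref Q) (enc_cnf tau) s ->
    exists t y, (t <= c * (size (enc_cnf tau) + s).+1 ^ k)%N /\
      tm_computes_within M (enc_cnf tau) t y /\ rs_ref Q (enc_cnf tau) y.

Definition psimulates (P Q : word -> word -> Prop) : Prop :=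
  exists f, polytime_fun f /\ forall x y, Q x y -> P x (f (pairw x y)).

Definition weakly_automatizable (P : word -> word -> Prop) : Prop :=
  exists Q : refsys, automatizable Q /\ psimulates (rs_ref Q) P.

(* Main.v *)
(** A formula [tau] is turned into a formula [tau2 tau] that has a variable for
    each product of two variables of [tau], together with the clauses defining
    it.  Mapping the products [x_i x_j] to these variables is additive, so it
    turns a quadratic refutation of [tau] into a linear refutation of
    [tau2 tau] of polynomially larger size, where the quadratic Boolean axioms
    have constant-size derivations from the defining clauses.  Hence, if an
    automatizable [Q] simulates R^0(lin), then the [Q]-refutations of
    [tau2 tau], regarded as refutations of [tau], form an automatizable system
    simulating R^0(quad).  The simulation does not translate the given
    refutation: the short linear refutation, and so a short [Q]-refutation of
    [tau2 tau], exists, and the automatizing machine, stopped by a polynomial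
    clock, finds one.

    The required Turing machines are compiled from structured programs over a
    fixed number of stacks, which are kept consecutively on the tape. *)

From mathcomp Require Import all_boot all_order all_algebra.
From mathcomp Require Import mpoly ssrcomplements zify.
From Stdlib Require Import FunctionalExtensionality Classical.
Require Import Defs.

Set Implicit Arguments.
Unset Strict Implicit.
Unset Printing Implicit Defensive.

Import Order.TTheory GRing.Theory Num.Theory.

(** * Turing machines simulating several stacks *)

(** No rule multiplies: Resolution only subtracts equations. This is why an additive map on
    polynomials of degree two suffices, and why only the Boolean axioms need derivations of their
    own. The passage from R^0(quad) to R^0(lin) costs nothing: a linear refutation is already a
    quadratic one, so the same automatizable system serves. Variable indices are coded in binary, so
    [nvars tau] can be exponential in the length of the code of [tau]. Therefore [tau2] introduces
    products only of variables that occur in [tau]; the other variables, which still have Boolean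
    axioms, are sent to 0. Polynomial time means a single-tape machine with a bound on all words.
    The checker and the simulation must therefore also stop on malformed words. These two and the
    automatizing algorithm are each built around a given machine of which only the transition table
    is known, so the programs contain an interpreter for such tables. *)

Definition eqs (a b : seq sym) := forall i, nth None a i = nth None b i.
(** Runs create explicit blanks where the initial tape has an empty list, so tapes are compared up
    to trailing blanks: [None] is both the blank and the default of [nth]. The scanned cell counts
    as part of the right half. *)
Definition teq (t1 t2 : tape) :=
  eqs t1.1.1 t2.1.1 /\ eqs (t1.1.2 :: t1.2) (t2.1.2 :: t2.2).

Lemma eqs_trans a b c : eqs a b -> eqs b c -> eqs a c.
Proof. by move=> h1 h2 i; rewrite h1 h2. Qed.
Lemma eqs_behead a b : eqs a b -> eqs (behead a) (behead b).
Proof. by move=> h i; rewrite !nth_behead h. Qed.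
Lemma eqs_head a b : eqs a b -> head None a = head None b.
Proof. by move=> h; rewrite -!nth0 h. Qed.
Lemma eqs_cons x a b : eqs a b -> eqs (x :: a) (x :: b).
Proof. by move=> h [|i] //=. Qed.
Lemma eqs_cat_nseq a n : eqs (a ++ nseq n None) a.
Proof.
move=> i; rewrite nth_cat; case: ltnP => // h.
by rewrite nth_nseq if_same nth_default.
Qed.

Lemma teq_trans a b c : teq a b -> teq b c -> teq a c.
Proof. by move=> [h1 h2] [h3 h4]; split; apply: eqs_trans; eauto. Qed.

Definition tp (l r : seq sym) : tape := (l, head None r, behead r).
(** The head stands on the nearest cell of the left part, as after a left move across the boundary
    between [l] and [r]. *)
Definition tpl (l r : seq sym) : tape := tp (behead l) (head None l :: r).

Lemma teq_tp l l' r r' : eqs l l' -> eqs r r' -> teq (tp l r) (tp l' r').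
Proof.
move=> hl hr; split=> //=.
by rewrite (eqs_head hr); apply: eqs_cons; apply: eqs_behead.
Qed.

Lemma somes_eqs a b : eqs a b -> somes a = somes b.
Proof.
elim: a b => [|x a IH] b h.
  have := h 0; case: b h => [|y b] h //= <-. done.
case: b h => [|y b] h.
  by have := h 0 => /= ->.
have := h 0 => /= ->; case: y h => // y h.
by rewrite /= (IH b) // => i; have := h i.+1.
Qed.

Lemma tm_out_teq t t' : teq t t' -> tm_out t = tm_out t'.
Proof. by case: t t' => [[l h] r] [[l' h'] r'] [_ /somes_eqs]. Qed.

Section Machine.
Variables (T : eqType) (s0 : T) (delta : T -> sym -> option (T * sym * bool)).

Definition mstep (c : T * tape) : option (T * tape) :=
  let: (q, (l, h, r)) := c in
  match delta q h with
  | None => None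
  | Some (q', w, d) =>
      Some (q', if d then (w :: l, head None r, behead r)
                     else (behead l, head None l, w :: r))
  end.

Arguments mstep : simpl never.

Fixpoint miter n c := if n is n'.+1 then obind (miter n') (mstep c) else Some c.

Definition mreach (c : T * tape) n (c' : T * tape) :=
  exists m t, [/\ m <= n, miter m c = Some (c'.1, t) & teq t c'.2].

Lemma miterD m n c : miter (m + n) c = obind (miter n) (miter m c).
Proof. by elim: m c => //= m IH c; case: (mstep c) => //=. Qed.

Lemma mstep_teq q q' t1 t1' t2 : mstep (q, t1) = Some (q', t1') -> teq t1 t2 ->
  exists2 t2', mstep (q, t2) = Some (q', t2') & teq t1' t2'.
Proof.
case: t1 t2 => [[l h] r] [[l2 h2] r2]; rewrite /mstep => + [/= hl hr].
have := eqs_head hr => /= <-; have {}hr := eqs_behead hr; rewrite /= in hr.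
case: (delta q h) => [[[p w] d]|] // [<- <-]; eexists; first by [].
case: d; split=> /=.
- exact: eqs_cons.
- by rewrite (eqs_head hr); apply/eqs_cons/eqs_behead.
- exact: eqs_behead.
- by rewrite (eqs_head hl); apply/eqs_cons/eqs_cons.
Qed.

Lemma miter_teq n q q' t1 t1' t2 : miter n (q, t1) = Some (q', t1') -> teq t1 t2 ->
  exists2 t2', miter n (q, t2) = Some (q', t2') & teq t1' t2'.
Proof.
elim: n q t1 t2 => [|n IH] q t1 t2 /=; first by case=> <- <-; exists t2.
case E: (mstep (q, t1)) => [[p t]|] //= h /(mstep_teq E) [t' -> h'] /=.
exact: IH h h'.
Qed.

Lemma mreach_refl c n : mreach c n c.
Proof. by exists 0, c.2; split=> //; case: c. Qed.

Lemma mreach_teq q t t' n : teq t t' -> mreach (q, t) n (q, t').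
Proof. by move=> h; exists 0, t. Qed.

Lemma mreach_trans c1 c2 c3 m n :
  mreach c1 m c2 -> mreach c2 n c3 -> mreach c1 (m + n) c3.
Proof.
case: c2 => q2 t2 [m1 [u1 [le1 h1 /= e1]]] [m2 [u2 [le2 h2 e2]]].
have e1' : teq t2 u1 by case: e1 => ? ?; split=> i.
have [u3 h3 e3] := miter_teq h2 e1'.
exists (m1 + m2), u3; split; first exact: leq_add.
  by rewrite miterD h1 /= h3.
by apply: teq_trans e2; case: e3 => ? ?; split=> i.
Qed.

Lemma mreach_le c c' m n : m <= n -> mreach c m c' -> mreach c n c'.
Proof. by move=> le [m' [t [h ? ?]]]; exists m', t; split=> //; apply: leq_trans le. Qed.

Lemma mreach_step c c1 n c' : mstep c = Some c1 -> mreach c1 n c' -> mreach c n.+1 c'.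
Proof. by move=> h [m [t [? h' ?]]]; exists m.+1, t; split=> //=; rewrite h. Qed.

(** Lets one routine perform the first step of the next. The two states agree only on the scanned
    symbol, so the run from [q2] must take a step; this is forced by its ending in another state. *)
Lemma mreach_eq_step q1 q2 t n c' : delta q1 t.1.2 = delta q2 t.1.2 ->
  q2 != c'.1 -> mreach (q2, t) n c' -> mreach (q1, t) n c'.
Proof.
move=> e ne [m [t' [le h ht]]]; exists m, t'; split=> //.
case: m le h => [_ [h]|m _ /= <-]; first by rewrite h eqxx in ne.
by rewrite /mstep; case: (t) e => [[l x] r] /= ->.
Qed.

Lemma mreach_right q l x r q' w n c :
  delta q x = Some (q', w, true) -> mreach (q', tp (w :: l) r) n c ->
  mreach (q, tp l (x :: r)) n.+1 c.
Proof. by move=> h; apply: mreach_step; rewrite /mstep /= h. Qed.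

Lemma mreach_left q l x r q' w n c :
  delta q x = Some (q', w, false) -> mreach (q', tpl l (w :: r)) n c ->
  mreach (q, tp l (x :: r)) n.+1 c.
Proof. by move=> h; apply: mreach_step; rewrite /mstep /= h. Qed.

Lemma mreach_leftl q l x r q' w n c :
  delta q x = Some (q', w, false) -> mreach (q', tpl l (w :: r)) n c ->
  mreach (q, tpl (x :: l) r) n.+1 c.
Proof. exact: mreach_left. Qed.

Variable (rest : seq T).
Let sts := s0 :: rest.
Hypothesis closed : forall s h s' w d,
  s \in sts -> delta s h = Some (s', w, d) -> s' \in sts.

Definition tm_of : TM :=
  @mkTM (size rest) [ffun p : 'I_(size rest).+1 * sym =>
    match delta (nth s0 sts p.1) p.2 with
    | Some (s, w, d) => Some (inord (index s sts), w, d)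
    | None => None
    end].

Definition conf_of (c : T * tape) : config tm_of := (inord (index c.1 sts), c.2).

Lemma conf_ofK s : s \in sts ->
  nth s0 sts (inord (index s sts) : 'I_(size rest).+1) = s.
Proof. by move=> h; rewrite inordK ?nth_index // -[X in _ < X]/(size sts) index_mem. Qed.

Lemma tm_step_of s t : s \in sts ->
  tm_step (conf_of (s, t)) = omap conf_of (mstep (s, t)).
Proof.
case: t => [[l h] r] hs; rewrite /mstep /= ffunE /= conf_ofK //.
by case: (delta s h) => [[[p w] d]|].
Qed.

Lemma tm_runE (M : TM) t (c : config M) : tm_run t c =
  match tm_step c with
  | None => Some c.2
  | Some c' => if t is t'.+1 then tm_run t' c' else None
  end.
Proof. by case: t. Qed.

Lemma tm_run_of n t s tp0 s' tp' : s \in sts ->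
  miter n (s, tp0) = Some (s', tp') -> n <= t -> (forall h, delta s' h = None) ->
  tm_run t (conf_of (s, tp0)) = Some tp'.
Proof.
elim: n t s tp0 => [|n IH] t s tp0 hs.
  move=> [e1 e2] _ hd; subst.
  suff h : tm_step (conf_of (s', tp')) = None by rewrite tm_runE h.
  by rewrite tm_step_of // /mstep; case: (tp') => [[l h] r]; rewrite hd.
case: t => // t h le hd; rewrite tm_runE tm_step_of //.
rewrite /= in h; case E: (mstep (s, tp0)) h => [[s1 t1]|] // h.
apply: IH h le hd; move: E; case: (tp0) => [[l x] r]; rewrite /mstep.
by case E: (delta s x) => [[[p w] d]|] // [<- _]; apply: closed E.
Qed.

Lemma tm_of_computes x n s' t' : mreach (s0, tp [::] (map Some x)) n (s', t') ->
  (forall h, delta s' h = None) -> tm_computes_within tm_of x n (tm_out t').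
Proof.
move=> [m [t [le h e]]] hd; rewrite /tm_computes_within.
have s0in : s0 \in sts by rewrite mem_head.
have := tm_run_of s0in h le hd; rewrite /conf_of /= eqxx.
have -> : inord 0 = ord0 :> 'I_(size rest).+1 by apply: val_inj; rewrite /= inordK.
rewrite /tm_init /tp => -> /=; congr Some; exact: tm_out_teq.
Qed.

End Machine.

(** * Jumping programs on stacks laid out on one tape *)

(** [IPush i b n] pushes [b] on stack [i] and jumps to [n]; [IPop i nE n0 n1] jumps to [nE] if stack
    [i] is empty, and otherwise pops a bit and jumps to [n0] or [n1] accordingly. *)
Inductive instr := IPush of nat & bool & nat | IPop of nat & nat & nat & nat.

Section StackMachine.
Variable code : seq instr.

Definition istack a := match a with IPush i _ _ => i | IPop i _ _ _ => i end.
Definition itarget a := match a with IPush _ _ n => n | IPop _ a b c => maxn a (maxn b c) end.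
Definition nstk := (foldr maxn 0 (map istack code)).+1.
Definition npc := foldr maxn (size code) (map itarget code).
Definition ins pc := nth (IPush 0 true 0) code pc.

(** Address, mode, counter of blanks, carried symbol. Mode 0 counts the blanks already crossed, the
    other modes those still to be crossed. *)
Definition mst := (nat * nat * nat * sym)%type.

(** The action on a blank during the return. The last blank counted is the one to the left of the
    first stack, so the next instruction starts on the first cell. *)
Definition act_ret pc j : mst * sym * bool :=
  if j <= 1 then ((pc, 0, 0, None), None, true)
  else ((pc, 2, j.-1, None), None, false).

Definition act_shr pc c j (x : sym) : mst * sym * bool :=
  if j is 0 then ((pc, 2, nstk, None), c, false)
  else ((pc, 1, j - (x == None), x), c, true).

Definition act_skip pc j (x : sym) : mst * sym * bool :=
  ((pc, 0, j + (x == None), None), x, true).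

(* Modes: 0 skips blanks rightwards up to the stack of the instruction,
   1 shifts right (push), 2 returns home, 3 runs to the right end,
   4 shifts left (pop). *)
Definition idelta (s : mst) (x : sym) : option (mst * sym * bool) :=
  let: (pc, m, j, c) := s in
  match m with
  | 0 => if size code <= pc then None else
         match ins pc with
         | IPush i b n => Some (if j < i then act_skip pc j x
                                else act_shr n (Some b) (nstk - i) x)
         | IPop i nE _ _ => Some (if j < i then act_skip pc j x
                                  else if x is Some _ then ((pc, 3, nstk - i, None), x, true)
                                  else ((nE, 2, i.+1, None), None, false))
         end
  | 1 => Some (act_shr pc c j x)
  | 2 => Some (if x is Some _ then ((pc, 2, j, None), x, false) else act_ret pc j)
  | 3 => Some (if x is Some _ then ((pc, 3, j, None), x, true)
               else if j <= 1 then ((pc, 4, nstk - istack (ins pc), None), None, false)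
               else ((pc, 3, j.-1, None), None, true))
  | _ => if ins pc is IPop i _ n0 n1 then
           Some (if x is Some _ then ((pc, 4, j, x), c, false)
                 else if j <= 1 then act_ret (if c == Some true then n1 else n0) i.+1
                 else ((pc, 4, j.-1, None), c, false))
         else None
  end.

Definition mst0 : mst := (0, 0, 0, None).
Definition mrest : seq mst :=
  [seq (p, c) | p <- [seq (q, j) | q <- [seq (a, m) | a <- iota 0 npc.+1, m <- iota 0 5],
                                   j <- iota 0 nstk.+2],
                c <- [:: None; Some true; Some false]].

Lemma mem_pairs (A B : eqType) (s : seq A) (t : seq B) a b :
  ((a, b) \in [seq (x, y) | x <- s, y <- t]) = (a \in s) && (b \in t).
Proof.
apply/allpairsP/andP => [[[x y] [h1 h2 [-> ->]]] | [h1 h2]] //.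
by exists (a, b).
Qed.

Lemma mem_mrest pc m j c :
  ((pc, m, j, c) \in mrest) = [&& pc <= npc, m < 5 & j <= nstk.+1].
Proof.
rewrite /mrest !mem_pairs !mem_iota andbC; case: c => [[]|] /=; lia.
Qed.

Lemma foldr_maxn_ge (x a : nat) s : a \in s -> a <= foldr maxn x s.
Proof.
elim: s => //= b s IH; rewrite inE => /orP [/eqP ->|/IH]; lia.
Qed.

Lemma foldr_maxn_init x s : x <= foldr maxn x s.
Proof. by elim: s => //= b s IH; lia. Qed.

Lemma ins_bounds pc : pc < size code \/ ins pc = IPush 0 true 0.
Proof. by case: (ltnP pc (size code)); [left | right; rewrite /ins nth_default]. Qed.

Lemma istack_lt pc : istack (ins pc) < nstk.
Proof.
case: (ins_bounds pc) => [h|->] //.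
rewrite ltnS foldr_maxn_ge // /ins -(nth_map _ 0) //.
by rewrite mem_nth // size_map.
Qed.

Lemma itarget_le pc : itarget (ins pc) <= npc.
Proof.
case: (ins_bounds pc) => [h|->] //.
rewrite foldr_maxn_ge // /ins -(nth_map _ 0) //.
by rewrite mem_nth // size_map.
Qed.

Lemma idelta_closed s h s' w d : s \in mst0 :: mrest ->
  idelta s h = Some (s', w, d) -> s' \in mst0 :: mrest.
Proof.
case: s s' => [[[pc m] j] c] [[[pc' m'] j'] c'].
have E : forall q, (q \in mst0 :: mrest) = (q \in mrest).
  by move=> q; rewrite inE; case: eqP => // ->; rewrite mem_mrest.
rewrite !E !mem_mrest => hb.
have hs := istack_lt pc; have ht := itarget_le pc.
have hd : size code <= npc by exact: foldr_maxn_init.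
rewrite /idelta /act_ret /act_shr /act_skip.
move: (nat_of_bool (h == None)) (leq_b1 (h == None)) => hn hn1.
move: nstk npc hs ht hd hb => K P hs ht hd hb.
case: m hb => [|[|[|[|m]]]] hb.
- case: (leqP (size code) pc) => // hpc; case: (ins pc) hs ht => [i b n|i nE n0 n1] /= hs ht;
  case: (ltnP j i) => hj.
  + by case=> <- <- <- _ _ _; lia.
  + by case: (K - i) (leq_subr i K) => [|k] hk [<- <- <- _ _ _]; lia.
  + by case=> <- <- <- _ _ _; lia.
  + by case: h => [b|] [<- <- <- _ _ _]; lia.
- by case: j hb => [|j] hb [<- <- <- _ _ _]; lia.
- by case: h => [b|]; [|case: (leqP j 1) => hj]; case=> <- <- <- _ _ _; lia.
- by case: h => [b|]; [|case: (leqP j 1) => hj]; case=> <- <- <- _ _ _; lia.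
- case: (ins pc) hs ht => [i b n|i nE n0 n1] //= hs ht.
  case: h => [b|]; [|case: (leqP j 1) => hj]; [| case: (ltnP i 1) => hi |];
    case=> <- <- <- _ _ _; try case: (c == Some true); lia.
Qed.

Definition stm : TM := tm_of mst0 idelta mrest.

(** A stack is its bits, top first, closed by one blank, so counting blanks locates a stack. Empty
    stacks are lone blanks, hence a bare input word is already the layout with the input on stack 0,
    up to trailing blanks. *)
Definition seg (x : word) : seq sym := rcons (map Some x) None.
Definition lay (ss : seq word) : seq sym := flatten (map seg ss).

Lemma lay_rcons ss x : lay (rcons ss x) = lay ss ++ seg x.
Proof. by rewrite /lay map_rcons flatten_rcons. Qed.

Lemma rev_seg x : rev (seg x) = None :: rev (map Some x).
Proof. by rewrite /seg rev_rcons. Qed.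

Notation reach := (mreach idelta).

Lemma reach_ret_seg pc j z L r n c :
  reach (pc, 2, j, None, tpl L (map Some z ++ r)) n c ->
  reach (pc, 2, j, None, tpl (rev (map Some z) ++ L) r) (size z + n) c.
Proof.
elim/last_ind: z r n => [|z b IH] r n //=.
rewrite map_rcons rev_rcons size_rcons cat_rcons => h.
rewrite addSn; apply: mreach_leftl; first by rewrite /=.
exact: IH.
Qed.

Lemma reach_ret pc (s1 : seq word) z r :
  reach (pc, 2, (size s1).+1, None, tpl (rev (map Some z) ++ rev (lay s1)) r)
        (size z + size (lay s1)).+1
        (pc, 0, 0, None, tp [::] (lay s1 ++ map Some z ++ r)).
Proof.
elim/last_ind: s1 z r => [|s1 y IH] z r.
  rewrite /= addn0 -[(size z).+1]addn1; apply: reach_ret_seg.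
  apply: mreach_right; first by [].
  by apply/mreach_teq/teq_tp => // -[|[|i]].
rewrite lay_rcons rev_cat rev_seg -addnS; apply: reach_ret_seg.
rewrite size_cat size_rcons size_rcons size_map; apply: mreach_leftl.
  by rewrite /= /act_ret.
rewrite -catA cat_rcons.
by apply: mreach_le (IH y (None :: map Some z ++ r)); lia.
Qed.

Lemma reach_skip_seg pc j x L r n c : pc < size code -> j < istack (ins pc) ->
  reach (pc, 0, j.+1, None, tp (rev (seg x) ++ L) r) n c ->
  reach (pc, 0, j, None, tp L (seg x ++ r)) (size (seg x) + n) c.
Proof.
move=> hpc hj.
have hd y : idelta (pc, 0, j, None) y = Some (act_skip pc j y).
  by rewrite /= leqNgt hpc /=; case: (ins pc) hj => [i b k|i ? ? ?] /= ->.
elim: x L => [|b x IH] L h.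
  apply: mreach_right; first by rewrite hd.
  by rewrite /= addn1.
apply: mreach_right; first by rewrite hd.
by rewrite addn0; apply: IH; rewrite /= rev_cons cat_rcons in h.
Qed.

Lemma reach_skip pc (s1 : seq word) j L r n c :
  pc < size code -> j + size s1 <= istack (ins pc) ->
  reach (pc, 0, j + size s1, None, tp (rev (lay s1) ++ L) r) n c ->
  reach (pc, 0, j, None, tp L (lay s1 ++ r)) (size (lay s1) + n) c.
Proof.
move=> hpc; elim: s1 j L => [|x s1 IH] j L; first by rewrite addn0.
rewrite /= addnS => hj h.
rewrite [lay _]/(seg x ++ lay s1) -catA size_cat -addnA.
apply: reach_skip_seg => //; first by lia.
apply: IH => //; rewrite addSn.
by rewrite [lay _]/(seg x ++ lay s1) rev_cat -catA in h.
Qed.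

Lemma reach_shr_seg pc j c x L r n d :
  reach (pc, 1, j, None, tp (rev (c :: map Some x) ++ L) r) n d ->
  reach (pc, 1, j.+1, c, tp L (seg x ++ r)) (size (seg x) + n) d.
Proof.
elim: x c L => [|b x IH] c L h.
  by apply: mreach_right; [rewrite /= subn1|].
apply: mreach_right; first by rewrite /= subn0.
by apply: IH; rewrite /= rev_cons cat_rcons in h.
Qed.

Lemma reach_shr pc (s2 S : seq word) z : size S + (size s2).+1 = nstk ->
  reach (pc, 1, size s2, None, tp (rev (map Some z) ++ rev (lay S)) (lay s2))
        (size (lay s2) + (size (lay (rcons S z ++ s2))).+2)
        (pc, 0, 0, None, tp [::] (lay (rcons S z ++ s2))).
Proof.
elim: s2 S z => [|y s2 IH] S z hs.
  apply: (@mreach_left _ _ _ _ None [::]); first by [].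
  rewrite cats0 lay_rcons -hs addn1.
  rewrite /seg -cats1; apply: mreach_le (reach_ret _ _ _ _).
  by rewrite !size_cat size_map /=; lia.
rewrite [lay (y :: s2)]/(seg y ++ lay s2) size_cat -addnA.
apply: reach_shr_seg; rewrite -cat_rcons.
have := IH (rcons S z) y; rewrite size_rcons => {}IH.
rewrite lay_rcons rev_cat rev_seg in IH.
rewrite rev_cons cat_rcons; apply: IH; rewrite /= in hs; lia.
Qed.

Lemma reach_push pc i b n (s1 s2 : seq word) x : pc < size code ->
  ins pc = IPush i b n -> size s1 = i -> size (s1 ++ x :: s2) = nstk ->
  reach (pc, 0, 0, None, tp [::] (lay (s1 ++ x :: s2)))
        (3 * size (lay (s1 ++ x :: s2)) + 3)
        (n, 0, 0, None, tp [::] (lay (s1 ++ (b :: x) :: s2))).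
Proof.
move=> hpc hi h1 hs; rewrite [in tp _ (lay (s1 ++ x :: _))]/lay map_cat flatten_cat.
rewrite -/(lay s1) -/(lay (x :: s2)).
have hcat a : size (lay (s1 ++ a :: s2)) = size (lay s1) + (size a).+1 + size (lay s2).
  by rewrite /lay map_cat flatten_cat /= !size_cat size_rcons size_map addnA.
apply: (@mreach_le _ _ _ _ (size (lay s1) + (size (seg x) +
  (size (lay s2) + (size (lay (rcons s1 (b :: x) ++ s2))).+2)))).
  by rewrite cat_rcons !hcat size_rcons size_map /=; lia.
apply: reach_skip => //; first by rewrite hi h1.
(* On reaching stack [i], mode 0 already makes the first shifting step, with the pushed bit as the
   carried symbol. *)
rewrite add0n h1; apply: (@mreach_eq_step _ _ _ (n, 1, nstk - i, Some b)).
- by rewrite /= leqNgt hpc hi /= ltnn.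
- by rewrite /= !xpair_eqE andbF.
have -> : nstk - i = (size s2).+1 by rewrite -hs size_cat /= h1; lia.
rewrite [lay (x :: s2)]/(seg x ++ lay s2); apply: reach_shr_seg.
rewrite cats0 -cat_rcons; apply: (@reach_shr n s2 s1 (b :: x)).
by rewrite -hs size_cat.
Qed.

Lemma reach_pop_empty pc i nE n0 n1 (s1 s2 : seq word) : pc < size code ->
  ins pc = IPop i nE n0 n1 -> size s1 = i ->
  reach (pc, 0, 0, None, tp [::] (lay (s1 ++ [::] :: s2)))
        (3 * size (lay (s1 ++ [::] :: s2)) + 3)
        (nE, 0, 0, None, tp [::] (lay (s1 ++ [::] :: s2))).
Proof.
move=> hpc hi h1; rewrite /lay map_cat flatten_cat.
rewrite -/(lay s1) -/(lay ([::] :: s2)) size_cat.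
have -> : lay ([::] :: s2) = None :: lay s2 by [].
apply: (@mreach_le _ _ _ _ (size (lay s1) + (0 + size (lay s1)).+2)).
  by rewrite /=; lia.
apply: reach_skip => //; first by rewrite hi h1.
rewrite add0n h1; apply: mreach_left; first by rewrite /= leqNgt hpc hi /= ltnn.
rewrite cats0 -h1; exact: (@reach_ret nE s1 [::]).
Qed.

Lemma reach_run pc (s2 S S' : seq word) z z' x n c :
  rcons S' z' = rcons S (z ++ x) ++ s2 ->
  reach (pc, 4, nstk - istack (ins pc), None,
         tpl (rev (map Some z') ++ rev (lay S')) [:: None]) n c ->
  reach (pc, 3, (size s2).+1, None,
         tp (rev (map Some z) ++ rev (lay S)) (map Some x ++ None :: lay s2))
        (size (lay (x :: s2)) + n) c.
Proof.
elim: s2 S z x => [|y s2 IH] S z x.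
  rewrite cats0 => /rcons_inj [-> ->].
  elim: x z => [|b x IHx] z h.
    by apply: mreach_left; [|rewrite cats0 in h].
  apply: mreach_right; first by [].
  by have := IHx (rcons z b); rewrite map_rcons rev_rcons cat_rcons; apply.
move=> hz h; elim: x z hz => [|b x IHx] z hz.
  apply: mreach_right; first by [].
  rewrite cats0 cat_rcons in hz.
  have e : lay (y :: s2) = map Some y ++ None :: lay s2.
    by rewrite /lay /= /seg cat_rcons.
  have := IH (rcons S z) [::] y; rewrite cat0s cat_rcons cat_rcons.
  by rewrite lay_rcons rev_cat rev_seg -e => /(_ hz h).
apply: mreach_right; first by [].
by have := IHx (rcons z b); rewrite map_rcons rev_rcons (cat_rcons b); apply.
Qed.

Section Shl.
Variables (pc i nE n0 n1 : nat).
Hypothesis hi : ins pc = IPop i nE n0 n1.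

Lemma reach_shl_seg j x c L r n d (W := rcons (map Some x) c) :
  reach (pc, 4, j, head None W, tpl L (behead W ++ r)) n d ->
  reach (pc, 4, j, c, tpl (rev (map Some x) ++ L) r) (size x + n) d.
Proof.
rewrite {}/W; elim/last_ind: x c r => [|x a IH] c r //=.
rewrite map_rcons rev_rcons size_rcons => h.
rewrite addSn; apply: mreach_leftl; first by rewrite /= hi.
apply: IH; move: h; case: (map _ x) => [|u s] //=.
by rewrite cat_rcons.
Qed.

(** The bit to be popped is not remembered during the run to the right end. The shift goes leftwards
    and carries the symbol of the cell just left, so on reaching the blank in front of stack [i] the
    carried symbol is the popped bit, which then selects the jump. *)
Lemma reach_shl (s1 s2 : seq word) b x S z r : size s1 = i ->
  rcons S z = s1 ++ (b :: x) :: s2 ->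
  reach (pc, 4, (size s2).+1, None, tpl (rev (map Some z) ++ rev (lay S)) r)
        (2 * size (lay (rcons S z)) + 2)
        (if b then n1 else n0, 0, 0, None, tp [::] (lay (s1 ++ x :: s2) ++ r)).
Proof.
move=> h1; elim/last_ind: s2 S z r => [|s2 y IH] S z r.
  rewrite cats1 => /rcons_inj [-> ->].
  rewrite [lay (s1 ++ [:: x])]/lay map_cat flatten_cat -/(lay s1) /= cats0.
  apply: (@mreach_le _ _ _ _ (size (b :: x) + (0 + size (lay s1)).+1)).
    by rewrite lay_rcons size_cat size_rcons size_map /=; lia.
  apply: reach_shl_seg.
  apply: (@mreach_eq_step _ _ _ (if b then n1 else n0, 2, i.+1, None)).
  - rewrite /= hi.
    have : head None (rev (lay s1)) = None.
      elim/last_ind: (s1) => // s y _.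
      by rewrite lay_rcons rev_cat rev_seg.
    by move=> ->; case: (b).
  - by rewrite /= !xpair_eqE andbF.
  rewrite -h1 -catA -/(seg x); exact: (@reach_ret _ s1 [::]).
rewrite -rcons_cons -rcons_cat => /rcons_inj [hS ->].
rewrite size_rcons; case/lastP: S hS => [|S w] hS.
  by case: (s1) hS.
rewrite (lay_rcons _ y).
apply: (@mreach_le _ _ _ _ (size y + (2 * size (lay (rcons S w)) + 2).+1)).
  by rewrite size_cat size_rcons size_map; lia.
apply: reach_shl_seg; rewrite {1}lay_rcons rev_cat rev_seg.
apply: mreach_leftl; first by rewrite /= hi.
rewrite -/(seg y); rewrite -cat_cons [head None _ :: _](_ : _ = seg y); last by rewrite /seg; case: (y).
by rewrite -rcons_cons -rcons_cat (lay_rcons _ y) -catA; exact: IH.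
Qed.

End Shl.

Lemma reach_pop pc i nE n0 n1 (s1 s2 : seq word) b x : pc < size code ->
  ins pc = IPop i nE n0 n1 -> size s1 = i -> size (s1 ++ (b :: x) :: s2) = nstk ->
  reach (pc, 0, 0, None, tp [::] (lay (s1 ++ (b :: x) :: s2)))
        (3 * size (lay (s1 ++ (b :: x) :: s2)) + 3)
        (if b then n1 else n0, 0, 0, None, tp [::] (lay (s1 ++ x :: s2))).
Proof.
move=> hpc hi h1 hs.
have hc : lay (s1 ++ (b :: x) :: s2) = lay s1 ++ lay ((b :: x) :: s2).
  by rewrite /lay map_cat flatten_cat.
have hk : nstk - i = (size s2).+1 by rewrite -hs size_cat /= h1; lia.
have [S [z hz]] : exists S z, rcons S z = s1 ++ (b :: x) :: s2.
  by case/lastP: (s1 ++ _ :: _) hs => // S z _; exists S, z.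
apply: (@mreach_le _ _ _ _ (size (lay s1) +
    (size (lay (x :: s2)) + (2 * size (lay (rcons S z)) + 2 + 0)).+1)).
  by rewrite hz hc size_cat /lay /= !size_cat /seg !size_rcons /= !size_map; lia.
have -> : lay (s1 ++ (b :: x) :: s2) = lay s1 ++ Some b :: map Some x ++ None :: lay s2.
  by rewrite hc {2}/lay /= /seg cat_rcons.
apply: reach_skip => //; first by rewrite hi h1.
rewrite add0n h1; apply: mreach_right; first by rewrite /= leqNgt hpc hi /= ltnn.
rewrite hk cats0.
apply: (@reach_run pc s2 s1 S [:: b] z x); first by rewrite hz cat_rcons.
rewrite hi hk; apply: mreach_trans (reach_shl hi _ h1 hz) _.
(* The left shift leaves one spare blank at the right end. *)
by apply/mreach_teq/teq_tp => //; exact: (@eqs_cat_nseq _ 1).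
Qed.

End StackMachine.

(** * A structured language of stack programs *)

Definition store := nat -> word.
Definition upd (s : store) i w : store := fun j => if j == i then w else s j.

Lemma upd_id s i : upd s i (s i) = s.
Proof. by apply: functional_extensionality => j; rewrite /upd; case: eqP => // ->. Qed.

Inductive cmd :=
  | Skip
  | Push of nat & bool
  | Seq of cmd & cmd
  | Case of nat & cmd & cmd & cmd
  | Loop of nat & cmd & cmd.

(* [Case i cE c0 c1] and [Loop i c0 c1] pop stack [i]; on an empty stack the
   former runs [cE] and the latter exits. *)
Inductive exec : cmd -> store -> nat -> store -> Prop :=
  | E_skip s : exec Skip s 0 s
  | E_push i b s : exec (Push i b) s 1 (upd s i (b :: s i))
  | E_seq c1 c2 s t1 s1 t2 s2 :
      exec c1 s t1 s1 -> exec c2 s1 t2 s2 -> exec (Seq c1 c2) s (t1 + t2) s2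
  | E_caseE i cE c0 c1 s t s' : s i = [::] -> exec cE s t s' ->
      exec (Case i cE c0 c1) s t.+1 s'
  | E_case i cE c0 c1 s t s' b w : s i = b :: w ->
      exec (if b then c1 else c0) (upd s i w) t s' -> exec (Case i cE c0 c1) s t.+1 s'
  | E_loopE i c0 c1 s : s i = [::] -> exec (Loop i c0 c1) s 1 s
  | E_loop i c0 c1 s b w t1 s1 t2 s2 : s i = b :: w ->
      exec (if b then c1 else c0) (upd s i w) t1 s1 ->
      exec (Loop i c0 c1) s1 t2 s2 -> exec (Loop i c0 c1) s (t1 + t2).+1 s2.

Fixpoint csize c :=
  match c with
  | Skip => 0
  | Push _ _ => 1
  | Seq c1 c2 => csize c1 + csize c2
  | Case _ cE c0 c1 => (csize cE + (csize c0 + csize c1)).+1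
  | Loop _ c0 c1 => (csize c0 + csize c1).+1
  end.

(* [comp c o e] is the entry point and the code of [c] when placed at address
   [o] and continuing at address [e]. *)
Fixpoint comp c o e : nat * seq instr :=
  match c with
  | Skip => (e, [::])
  | Push i b => (o, [:: IPush i b e])
  | Seq c1 c2 =>
      let: (e2, k2) := comp c2 (o + csize c1) e in
      let: (e1, k1) := comp c1 o e2 in (e1, k1 ++ k2)
  | Case i cE c0 c1 =>
      let: (eE, kE) := comp cE o.+1 e in
      let: (e0, k0) := comp c0 (o.+1 + csize cE) e in
      let: (e1, k1) := comp c1 (o.+1 + csize cE + csize c0) e in
      (o, IPop i eE e0 e1 :: kE ++ k0 ++ k1)
  | Loop i c0 c1 =>
      let: (e0, k0) := comp c0 o.+1 o in
      let: (e1, k1) := comp c1 (o.+1 + csize c0) o in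
      (o, IPop i e e0 e1 :: k0 ++ k1)
  end.

Lemma size_comp c o e : size (comp c o e).2 = csize c.
Proof.
elim: c o e => //=.
- move=> c1 + c2 + o e => IH1 IH2.
  case: (comp c2) (IH2 (o + csize c1) e) => e2 k2 /= <-.
  by case: (comp c1) (IH1 o e2) => e1 k1 /= <-; rewrite size_cat.
- move=> i cE + c0 + c1 + o e => IHE IH0 IH1.
  case: (comp cE) (IHE o.+1 e) => eE kE /= <-.
  case: (comp c0) (IH0 (o.+1 + size kE) e) => e0 k0 /= <-.
  by case: (comp c1) (IH1 (o.+1 + size kE + size k0) e) => e1 k1 /= <-; rewrite !size_cat.
- move=> i c0 + c1 + o e => IH0 IH1.
  case: (comp c0) (IH0 o.+1 o) => e0 k0 /= <-.
  by case: (comp c1) (IH1 (o.+1 + size k0) o) => e1 k1 /= <-; rewrite size_cat.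
Qed.

Definition code_at (code : seq instr) o k :=
  exists pre post, code = pre ++ k ++ post /\ size pre = o.

Lemma code_at_catl code o k1 k2 : code_at code o (k1 ++ k2) -> code_at code o k1.
Proof. by case=> [a [b [-> <-]]]; exists a, (k2 ++ b); rewrite -catA. Qed.

Lemma code_at_catr code o k1 k2 : code_at code o (k1 ++ k2) -> code_at code (o + size k1) k2.
Proof. by case=> [a [b [-> <-]]]; exists (a ++ k1), b; rewrite -!catA size_cat. Qed.

Lemma code_at_cons code o a k : code_at code o (a :: k) ->
  [/\ o < size code, ins code o = a & code_at code o.+1 k].
Proof.
move=> h; split; last by have := @code_at_catr code o [:: a] k h; rewrite addn1.
  by case: h => [p [q [-> <-]]]; rewrite size_cat /=; lia.
by case: h => [p [q [-> <-]]]; rewrite /ins nth_cat ltnn subnn.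
Qed.

Section Correct.
Variable code : seq instr.
Notation K := (nstk code).

Definition slay (s : store) := lay (mkseq s K).
Definition home pc s : mst * tape := (pc, 0, 0, None, tp [::] (slay s)).

Lemma mkseq_upd (s : store) i : i < K -> exists s1 s2, size s1 = i /\
  forall w, mkseq (upd s i w) K = s1 ++ w :: s2.
Proof.
move=> hi; exists (mkseq s i), [seq s j | j <- iota i.+1 (K - i.+1)]; split.
  by rewrite size_mkseq.
move=> w; rewrite /mkseq.
have {1}-> : K = i + (K - i.+1).+1 by lia.
rewrite iotaD map_cat /= add0n {2}/upd eqxx; congr (_ ++ _ :: _).
  by apply/eq_in_map => j; rewrite mem_iota /upd => ?; case: eqP => // ?; lia.
by apply/eq_in_map => j; rewrite mem_iota /upd => ?; case: eqP => // ?; lia.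
Qed.

Lemma size_lay_mid s1 x s2 : size (lay (s1 ++ x :: s2)) = size (lay (s1 ++ [::] :: s2)) + size x.
Proof. rewrite /lay !map_cat !flatten_cat /= !size_cat !size_rcons size_map /=; lia. Qed.

Lemma home_push pc i b n s : pc < size code -> ins code pc = IPush i b n ->
  mreach (idelta code) (home pc s) (3 * size (slay s) + 3) (home n (upd s i (b :: s i)))
  /\ size (slay (upd s i (b :: s i))) = (size (slay s)).+1.
Proof.
move=> hpc hi.
have hK : i < K by have := istack_lt code pc; rewrite hi.
have [s1 [s2 [h1 h2]]] := mkseq_upd s hK.
have e : mkseq s K = s1 ++ s i :: s2 by rewrite -h2 upd_id.
rewrite /home /slay e h2; split; last by rewrite size_lay_mid (size_lay_mid _ (s i)) addnS.
by apply: reach_push hpc hi h1 _; rewrite -e size_mkseq.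
Qed.

Lemma home_popE pc i nE n0 n1 s : pc < size code -> ins code pc = IPop i nE n0 n1 ->
  s i = [::] -> mreach (idelta code) (home pc s) (3 * size (slay s) + 3) (home nE s).
Proof.
move=> hpc hi h0.
have hK : i < K by have := istack_lt code pc; rewrite hi.
have [s1 [s2 [h1 h2]]] := mkseq_upd s hK.
have e : mkseq s K = s1 ++ [::] :: s2 by rewrite -h0 -h2 upd_id.
by rewrite /home /slay e; exact: reach_pop_empty hpc hi h1.
Qed.

Lemma home_pop pc i nE n0 n1 s b w : pc < size code -> ins code pc = IPop i nE n0 n1 ->
  s i = b :: w ->
  mreach (idelta code) (home pc s) (3 * size (slay s) + 3)
         (home (if b then n1 else n0) (upd s i w))
  /\ (size (slay (upd s i w))).+1 = size (slay s).
Proof.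
move=> hpc hi h0.
have hK : i < K by have := istack_lt code pc; rewrite hi.
have [s1 [s2 [h1 h2]]] := mkseq_upd s hK.
have e : mkseq s K = s1 ++ (b :: w) :: s2 by rewrite -h0 -h2 upd_id.
rewrite /home /slay e h2; split; last by rewrite size_lay_mid (size_lay_mid _ (b :: w)) addnS.
by apply: reach_pop hpc hi h1 _; rewrite -e size_mkseq.
Qed.

(** A unit of time pays for at most one instruction, which costs at most three times the length of
    the layout plus 3 and lengthens the layout by at most one cell; hence a quadratic bound. *)
Lemma comp_correct c s t s' : exec c s t s' -> forall o e,
  code_at code o (comp c o e).2 ->
  (size (slay s') <= size (slay s) + t) /\
  mreach (idelta code) (home (comp c o e).1 s)
         (t * (3 * (size (slay s) + t) + 3)) (home e s').
Proof.
elim=> {c s t s'}.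
- by move=> s o e _; rewrite addn0; split=> //; apply: mreach_refl.
- move=> i b s o e /code_at_cons [ho hi _]; have [h ->] := home_push s ho hi.
  by split; [rewrite addn1 | apply: mreach_le h; rewrite /=; lia].
- move=> c1 c2 s t1 s1 t2 s2 h1 IH1 h2 IH2 o e /=.
  case E2: (comp c2 (o + csize c1) e) => [e2 k2].
  case E1: (comp c1 o e2) => [e1 k1] /= hc.
  have := IH1 o e2; rewrite E1 => /(_ (code_at_catl hc)) /= [l1 r1].
  have := IH2 (o + csize c1) e; rewrite E2 => /(_ _) [].
    by have := code_at_catr hc; rewrite -(size_comp c1 o e2) E1.
  move=> /= l2 r2; split; first by lia.
  by apply: mreach_le (mreach_trans r1 r2); nia.
- move=> i cE c0 c1 s t s' hs h IH o e /=.
  case EE: (comp cE _ e) => [eE kE]; case E0: (comp c0 _ e) => [e0 k0].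
  case E1: (comp c1 _ e) => [e1 k1] /= /code_at_cons [ho hi hc].
  have := IH o.+1 e; rewrite EE => /(_ (code_at_catl hc)) /= [l1 r1].
  split; first by lia.
  by apply: mreach_le (mreach_trans (home_popE ho hi hs) r1); nia.
- move=> i cE c0 c1 s t s' b w hs h IH o e /=.
  case EE: (comp cE _ e) => [eE kE]; case E0: (comp c0 _ e) => [e0 k0].
  case E1: (comp c1 _ e) => [e1 k1] /= /code_at_cons [ho hi hc].
  have hc0 := code_at_catr hc; have hc1 := code_at_catr hc0.
  have [hp hl] := home_pop ho hi hs.
  have sE : size kE = csize cE by rewrite -(size_comp cE o.+1 e) EE.
  have sz0 : size k0 = csize c0 by rewrite -(size_comp c0 (o.+1 + csize cE) e) E0.
  rewrite ?sE ?sz0 in hc0 hc1.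
  have [l1 r1] : (size (slay s') <= size (slay (upd s i w)) + t) /\
     mreach (idelta code) (home (if b then e1 else e0) (upd s i w))
         (t * (3 * (size (slay (upd s i w)) + t) + 3)) (home e s').
    case: (b) IH => IH.
      by have := IH (o.+1 + csize cE + csize c0) e; rewrite E1; apply.
    by have := IH (o.+1 + csize cE) e; rewrite E0 => /(_ (code_at_catl hc0)).
  split; first by lia.
  by apply: mreach_le (mreach_trans hp r1); nia.
- move=> i c0 c1 s hs o e /=.
  case E0: (comp c0 _ o) => [e0 k0].
  case E1: (comp c1 _ o) => [e1 k1] /= /code_at_cons [ho hi hc].
  split; first by lia.
  by apply: mreach_le (home_popE ho hi hs); nia.
- move=> i c0 c1 s b w t1 s1 t2 s2 hs h1 IH1 h2 IH2 o e hL.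
  have [l2 r2] := IH2 o e hL; move: hL l2 r2 => /=.
  case E0: (comp c0 _ o) => [e0 k0].
  case E1: (comp c1 _ o) => [e1 k1] /= /code_at_cons [ho hi hc].
  have hc1 := code_at_catr hc.
  have [hp hl] := home_pop ho hi hs.
  have sz0 : size k0 = csize c0 by rewrite -(size_comp c0 o.+1 o) E0.
  rewrite ?sz0 in hc1 => l2 r2.
  have [l1 r1] : (size (slay s1) <= size (slay (upd s i w)) + t1) /\
     mreach (idelta code) (home (if b then e1 else e0) (upd s i w))
         (t1 * (3 * (size (slay (upd s i w)) + t1) + 3)) (home o s1).
    case: (b) IH1 => IH.
      by have := IH (o.+1 + csize c0) o; rewrite E1; apply.
    by have := IH o.+1 o; rewrite E0 => /(_ (code_at_catl hc)).
  split; first by lia.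
  by apply: mreach_le (mreach_trans hp (mreach_trans r1 r2)); nia.
Qed.

End Correct.

(* The initial jump guarantees that address [0] is the entry point. *)
Definition pcode (c : cmd) : seq instr :=
  IPop 1 (comp c 1 (csize c).+1).1 0 0 :: (comp c 1 (csize c).+1).2.

Definition init (x : word) : store := fun i => if i == 0 then x else [::].

Lemma somes_seg x r : somes (seg x ++ r) = x.
Proof. by elim: x => //= b x ->. Qed.

Lemma tm_out_seg x r : tm_out (tp [::] (seg x ++ r)) = x.
Proof. by rewrite -{2}(somes_seg x r) /tm_out /tp /seg; case: x. Qed.

Lemma lay_nil n (f : nat -> word) m : (forall i, m <= i -> f i = [::]) ->
  lay [seq f i | i <- iota m n] = nseq n None.
Proof. by elim: n m => //= n IH m h; rewrite /lay /= h //= -/(lay _) IH // => i /ltnW /h. Qed.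

(** The extra unit of time pays for the initial jump, a pop of the empty stack 1. Stack 0 comes
    first on the tape, and [tm_out] stops at the blank that closes it. *)
Lemma exec_tm c x t s : exec c (init x) t s ->
  tm_computes_within (stm (pcode c)) x
    (t.+1 * (3 * (size x + nstk (pcode c) + t) + 3)) (s 0).
Proof.
move=> h; set code := pcode c.
have hc : code_at code 0 code by exists [::], [::]; rewrite cats0.
have [h0 hi hc1] := code_at_cons hc.
have [_ r1] := comp_correct h hc1.
have e0 : slay code (init x) = map Some x ++ nseq (nstk code) None.
  by rewrite /slay /mkseq /lay /= cat_rcons -/(lay _) lay_nil // => -[|i].
have hs : size (slay code (init x)) = size x + nstk code.
  by rewrite e0 size_cat size_map size_nseq.
have r0 := mreach_trans (home_popE h0 hi (erefl : init x 1 = [::])) r1.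
have -> : s 0 = tm_out (tp [::] (slay code s)).
  by rewrite /slay /mkseq [lay _]/(seg (s 0) ++ lay _) tm_out_seg.
apply: tm_of_computes.
- by move=> ? ? ? ? ? h1 h2; exact: idelta_closed h1 h2.
- rewrite hs in r0.
  have rt : mreach (idelta code) (mst0, tp [::] (map Some x)) 0 (home code 0 (init x)).
    by apply/mreach_teq/teq_tp => // i; rewrite e0 eqs_cat_nseq.
  by apply: mreach_le (mreach_trans rt r0); nia.
- by move=> y; rewrite /= size_comp leqnn.
Qed.

(** * Program combinators *)

Definition runs c s t s' := exists2 u, u <= t & exec c s u s'.

Lemma runs_le c s t t' s' : runs c s t s' -> t <= t' -> runs c s t' s'.
Proof. by move=> [u h1 h2] h; exists u => //; apply: leq_trans h. Qed.

Lemma runs_skip s t : runs Skip s t s.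
Proof. by exists 0 => //; constructor. Qed.

Lemma runs_push i b s : runs (Push i b) s 1 (upd s i (b :: s i)).
Proof. by exists 1 => //; constructor. Qed.

Lemma runs_seq c1 c2 s t1 s1 t2 s2 :
  runs c1 s t1 s1 -> runs c2 s1 t2 s2 -> runs (Seq c1 c2) s (t1 + t2) s2.
Proof.
move=> [u1 l1 h1] [u2 l2 h2]; exists (u1 + u2); first exact: leq_add.
exact: E_seq h1 h2.
Qed.

Lemma runs_caseE i cE c0 c1 s t s' : s i = [::] -> runs cE s t s' ->
  runs (Case i cE c0 c1) s t.+1 s'.
Proof. by move=> hs [u l h]; exists u.+1 => //; exact: E_caseE. Qed.

Lemma runs_case i cE c0 c1 s t s' b w : s i = b :: w ->
  runs (if b then c1 else c0) (upd s i w) t s' -> runs (Case i cE c0 c1) s t.+1 s'.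
Proof. by move=> hs [u l h]; exists u.+1 => //; exact: E_case hs h. Qed.

Lemma runs_loopE i c0 c1 s : s i = [::] -> runs (Loop i c0 c1) s 1 s.
Proof. by move=> hs; exists 1 => //; exact: E_loopE. Qed.

Lemma runs_loop i c0 c1 s b w t1 s1 t2 s2 : s i = b :: w ->
  runs (if b then c1 else c0) (upd s i w) t1 s1 ->
  runs (Loop i c0 c1) s1 t2 s2 -> runs (Loop i c0 c1) s (t1 + t2).+1 s2.
Proof.
move=> hs [u1 l1 h1] [u2 l2 h2]; exists (u1 + u2).+1; first by rewrite ltnS leq_add.
exact: E_loop hs h1 h2.
Qed.

Lemma exec_size c s t s' : exec c s t s' -> forall i, size (s' i) <= size (s i) + t.
Proof.
elim=> {c s t s'} //.
- by move=> s i; rewrite addn0.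
- by move=> i b s j; rewrite /upd; case: eqP => [->|_] /=; lia.
- by move=> c1 c2 s t1 s1 t2 s2 _ h1 _ h2 i; have := h1 i; have := h2 i; lia.
- by move=> i cE c0 c1 s t s' _ _ h j; have := h j; lia.
- move=> i cE c0 c1 s t s' b w e _ h j; have := h j; rewrite /upd.
  by case: eqP => [->|_]; rewrite ?e /=; lia.
- by move=> i c0 c1 s _ j; lia.
- move=> i c0 c1 s b w t1 s1 t2 s2 e _ h1 _ h2 j; have := h2 j; have := h1 j; rewrite /upd.
  by case: eqP => [->|_]; rewrite ?e /=; lia.
Qed.

Lemma runs_size c s t s' i : runs c s t s' -> size (s' i) <= size (s i) + t.
Proof. by move=> [u l /exec_size /(_ i)]; lia. Qed.

(** With stores given by lists, the effect of a program on numbered stacks is found by computation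
    with [set_nth]. *)
Definition st (l : seq word) : store := fun i => nth [::] l i.

Lemma st_upd l i w : upd (st l) i w = st (set_nth [::] l i w).
Proof. by apply: functional_extensionality => j; rewrite /upd /st nth_set_nth. Qed.

Ltac upd_ext := apply: functional_extensionality => ?; rewrite /upd;
  repeat case: eqP => ? //; subst; try congruence.

Lemma upd_eq s i w : upd s i w i = w.
Proof. by rewrite /upd eqxx. Qed.

Lemma upd_neq s i j w : j != i -> upd s i w j = s j.
Proof. by rewrite /upd => /negbTE ->. Qed.

Lemma upd_upd s i v w : upd (upd s i v) i w = upd s i w.
Proof. by upd_ext. Qed.

Definition seqs (cs : seq cmd) := foldr Seq Skip cs.
Arguments seqs : simpl never.

Lemma runs_cons c cs s t1 s1 t2 s2 :
  runs c s t1 s1 -> runs (seqs cs) s1 t2 s2 -> runs (seqs (c :: cs)) s (t1 + t2) s2.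
Proof. exact: runs_seq. Qed.

Lemma runs_nil s t : runs (seqs [::]) s t s.
Proof. exact: runs_skip. Qed.

Definition pushes (ps : seq (nat * bool)) := seqs [seq Push p.1 p.2 | p <- ps].
Definition spush (s : store) (p : nat * bool) := upd s p.1 (p.2 :: s p.1).

Lemma runs_pushes ps s : runs (pushes ps) s (size ps) (foldl spush s ps).
Proof.
elim: ps s => [|p ps IH] s; first exact: runs_nil.
exact: (runs_cons (runs_push _ _ _) (IH _)).
Qed.

Lemma foldl_spush i (w : word) s :
  foldl spush s [seq (i, b) | b <- w] = upd s i (rev w ++ s i).
Proof.
elim: w s => [|b w IH] s /=; first by rewrite upd_id.
by rewrite IH /spush /= upd_eq upd_upd rev_cons cat_rcons.
Qed.

Definition pushw i (w : word) := pushes [seq (i, b) | b <- w].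

Lemma runs_pushw i w s : runs (pushw i w) s (size w) (upd s i (rev w ++ s i)).
Proof. by rewrite -foldl_spush -(size_map (pair i)); exact: runs_pushes. Qed.

Definition move i j := Loop i (Push j false) (Push j true).

Lemma runs_move i j s : i != j ->
  runs (move i j) s (2 * size (s i) + 1) (upd (upd s j (rev (s i) ++ s j)) i [::]).
Proof.
move=> hij; move e: (s i) => w; elim: w s e => [|b w IH] s hs.
  have -> : upd (upd s j (rev [::] ++ s j)) i [::] = s by upd_ext.
  exact: runs_loopE.
have hp : runs (if b then Push j true else Push j false) (upd s i w) 1
  (upd (upd s i w) j (b :: s j)).
  have := runs_push j b (upd s i w); rewrite upd_neq 1?eq_sym //.
  by case: (b).
have := runs_loop hs hp (IH (upd (upd s i w) j (b :: s j)) _).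
rewrite (upd_neq _ _ hij) upd_eq => /(_ erefl) h.
have -> : upd (upd s j (rev (b :: w) ++ s j)) i [::] =
  upd (upd (upd (upd s i w) j (b :: s j)) j (rev w ++ upd (upd s i w) j (b :: s j) j)) i [::].
  by rewrite rev_cons cat_rcons upd_eq; upd_ext.
by apply: runs_le h _; rewrite /=; lia.
Qed.

Definition clear i := Loop i Skip Skip.

Lemma runs_clear i s : runs (clear i) s (size (s i)).+1 (upd s i [::]).
Proof.
move e: (s i) => w; elim: w s e => [|b w IH] s hs.
  by rewrite -[X in upd s i X]hs upd_id; exact: runs_loopE.
rewrite -(upd_upd s i w); apply: (runs_loop (t1 := 0) hs).
  by case: (b); apply: runs_skip.
by apply: IH; rewrite /upd eqxx.
Qed.

(** Each [true] popped from [z] skips one branch, so the selector is in unary and is consumed by the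
    selection. *)
Fixpoint switch z (cs : seq cmd) :=
  if cs is c :: cs' then Case z c Skip (switch z cs') else Skip.

Lemma runs_switch z cs q s t s' : s z = nseq q true -> q < size cs ->
  runs (nth Skip cs q) (upd s z [::]) t s' -> runs (switch z cs) s (t + q.+1) s'.
Proof.
elim: cs q s => // c cs IH [|q] s hs.
  by move=> _; rewrite -{1}[[::]]/(nseq 0 true) -hs upd_id addn1; exact: runs_caseE.
move=> hq h; rewrite addnS; apply: (@runs_case _ _ _ _ _ _ _ true (nseq q true) hs).
by apply: IH => //; rewrite ?upd_upd // /upd eqxx.
Qed.

(** * Finite-state transducers with two output words *)

Section Transducer.
Variables (n : nat) (delta : nat -> bool -> nat * word * word).
Variables (inp z i1 i2 : nat).
Hypothesis uniq_stacks : uniq [:: inp; z; i1; i2].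
Hypothesis delta_lt : forall q b, q < n -> (delta q b).1.1 < n.
Variable D : nat.
Hypothesis delta_small : forall q b, q < n ->
  size (delta q b).1.2 + size (delta q b).2 <= D.

Fixpoint tr q (w : word) : nat * word * word :=
  if w is b :: w' then
    let: (q1, a, o) := delta q b in
    let: (q2, a', o') := tr q1 w' in (q2, a ++ a', o ++ o')
  else (q, [::], [::]).

Definition tbody b := switch z
  [seq let: (q', a, o) := delta q b in
       seqs [:: pushw i1 a; pushw i2 o; pushw z (nseq q' true)] | q <- iota 0 n].
Definition transduce := Loop inp (tbody false) (tbody true).

(** Per input bit there are at most [D] pushes of output, fewer than [n] to write the new state in
    unary, at most [n] pops to select the branch, and one for the loop. *)
Lemma runs_transduce q s : q < n -> s z = nseq q true ->
  let: (q', a, o) := tr q (s inp) in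
  runs transduce s ((D + 2 * n + 2) * (size (s inp)).+1)
    (upd (upd (upd (upd s inp [::]) z (nseq q' true)) i1 (rev a ++ s i1)) i2 (rev o ++ s i2)).
Proof.
move=> hq hz; move e: (s inp) => w; elim: w s e q hq hz => [|b w IH] s hs q hq hz /=.
  have -> : upd (upd (upd (upd s inp [::]) z (nseq q true)) i1 (s i1)) i2 (s i2) = s.
    by upd_ext.
  by apply: runs_le (runs_loopE _ _ hs) _; lia.
have hl := delta_lt b hq; have hsm := delta_small b hq.
case Ed: (delta q b) hl hsm => [[q1 a] o] /= hl hsm.
have : uniq [:: inp; z; i1; i2] by [].
rewrite /= !inE !negb_or => /and4P [/and3P [u1 u2 u3] /andP [u4 u5] u6 _].
have [[v1 v2 v3] [v4 v5 v6]] : [/\ inp <> z, inp <> i1 & inp <> i2] /\ [/\ z <> i1, z <> i2 & i1 <> i2].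
  by split; split; apply/eqP.
have [s1 es1] : exists s1, s1 = upd (upd (upd (upd s inp w) z (nseq q1 true)) i1 (rev a ++ s i1)) i2 (rev o ++ s i2).
  by eexists.
have e1 : s1 inp = w.
  by rewrite es1 /upd (negbTE u3) (negbTE u2) (negbTE u1) eqxx.
have e2 : s1 z = nseq q1 true.
  by rewrite es1 /upd (negbTE u5) (negbTE u4) eqxx.
have := IH s1 e1 q1 hl e2.
case: (tr q1 w) => [[q2 a'] o'] h.
have hb : runs (if b then tbody true else tbody false) (upd s inp w)
    (size a + (size o + (q1 + 0)) + q.+1) s1.
  have -> : (if b then tbody true else tbody false) = tbody b by case: (b).
  apply: (runs_switch (q := q)).
  - by rewrite /upd eq_sym (negbTE u1).
  - by rewrite size_map size_iota.
  rewrite (nth_map 0) ?size_iota // nth_iota // add0n Ed.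
  apply: runs_cons (runs_pushw _ _ _) _.
  apply: runs_cons (runs_pushw _ _ _) _.
  have -> : s1 = upd (upd (upd (upd (upd s inp w) z [::]) i1 (rev a ++ (upd (upd s inp w) z [::]) i1)) i2
       (rev o ++ (upd (upd (upd s inp w) z [::]) i1 (rev a ++ (upd (upd s inp w) z [::]) i1)) i2)) z
       (rev (nseq q1 true) ++ [::]).
    rewrite cats0 rev_nseq es1.
    by clear IH es1; upd_ext.
  have := runs_pushw z (nseq q1 true)  (upd (upd (upd (upd s inp w) z [::]) i1 (rev a ++ (upd (upd s inp w) z [::]) i1)) i2
       (rev o ++ (upd (upd (upd s inp w) z [::]) i1 (rev a ++ (upd (upd s inp w) z [::]) i1)) i2)).
  rewrite (upd_neq _ _ u5) (upd_neq _ _ u4) upd_eq => hp.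
  by apply: runs_le (runs_cons hp (runs_nil _ 0)) _; rewrite size_nseq.
apply: runs_le (runs_loop hs hb _) _.
  move: h; have -> : upd (upd (upd (upd s1 inp [::]) z (nseq q2 true)) i1 (rev a' ++ s1 i1)) i2 (rev o' ++ s1 i2) =
    upd (upd (upd (upd s inp [::]) z (nseq q2 true)) i1 (rev (a ++ a') ++ s i1)) i2 (rev (o ++ o') ++ s i2).
    rewrite !rev_cat -!catA es1.
    by clear e1 e2 hb IH es1; upd_ext.
  exact.
by rewrite /=; nia.
Qed.

Lemma tr_cat q w1 w2 : tr q (w1 ++ w2) =
  let: (q1, a1, o1) := tr q w1 in
  let: (q2, a2, o2) := tr q1 w2 in (q2, a1 ++ a2, o1 ++ o2).
Proof.
elim: w1 q => [|b w1 IH] q /=; first by case: tr => [[]].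
case: (delta q b) => [[q1 a] o]; rewrite IH; case: (tr q1 w1) => [[q2 a2] o2].
by case: (tr q2 w2) => [[q3 a3] o3]; rewrite !catA.
Qed.

Lemma tr_lt q w : q < n -> (tr q w).1.1 < n.
Proof.
clear uniq_stacks; elim: w q => //= b w IH q hq; have := delta_lt b hq.
by case: (delta q b) => [[q1 a] o] /= /IH; case: (tr q1 w) => [[]].
Qed.

Lemma tr_size q w : q < n -> size (tr q w).1.2 + size (tr q w).2 <= D * size w.
Proof.
clear uniq_stacks; elim: w q => [|b w IH] q hq; first by rewrite muln0.
rewrite /=; have := delta_lt b hq; have := delta_small b hq.
case: (delta q b) => [[q1 a] o] /= h1 /IH.
by case: (tr q1 w) => [[q2 a2] o2] /=; rewrite !size_cat mulnS; lia.
Qed.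

End Transducer.

(** * Encodings and the formula [tau2] *)

Definition dbl (w : word) : word := flatten [seq [:: true; b] | b <- w].
Definition unbin (w : word) : nat := foldr (fun (b : bool) n => b + n.*2) 0 w.

Lemma enc_natE n : enc_nat n = dbl (bin n) ++ [:: false]. Proof. by []. Qed.

Lemma bin_fuelE f g n : n <= f -> n <= g -> bin_fuel f n = bin_fuel g n.
Proof.
elim: f g n => [|f IH] [|g] [|n] //= hf hg; congr (_ :: _).
by apply: IH; lia.
Qed.

Lemma binS n : 0 < n -> bin n = odd n :: bin n./2.
Proof.
by case: n => // n _; rewrite {1}/bin /=; congr (_ :: _); apply: bin_fuelE; lia.
Qed.

Lemma binK : cancel bin unbin.
Proof.
elim/ltn_ind=> -[|n] IH //.
by rewrite binS //= IH ?odd_double_half //; lia.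
Qed.

Lemma unbin_rcons_gt0 s : 0 < unbin (rcons s true).
Proof. by elim: s => //= b s; lia. Qed.

(** [bin] writes the least significant digit first, so its values are the empty word and the words
    ending in [true]; the default of [last] admits the empty word. *)
Lemma unbinK s : last true s -> bin (unbin s) = s.
Proof.
case/lastP: s => // s b; rewrite last_rcons => -> {b}.
elim: s => // b s IH.
rewrite binS; last exact: (unbin_rcons_gt0 (b :: s)).
rewrite /= -/(unbin (rcons s true)) half_bit_double IH.
by rewrite oddD odd_double addbF oddb.
Qed.

Lemma last_bin n : last true (bin n).
Proof.
elim/ltn_ind: n => -[|n] IH //; rewrite binS //=.
case E: (bin n.+1./2) => [|b s].
  have : n.+1./2 = 0 by rewrite -(binK n.+1./2) E.
  by case: n {IH E} => [|[|n]].
by have := IH n.+1./2; rewrite E /=; apply; lia.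
Qed.

Definition enc_lit (l : literal) : word := enc_nat l.1 ++ [:: l.2].
Definition enc_clause : clause -> word := enc_list enc_lit.
Definition body (cs : cnf) : word := flatten [seq true :: enc_clause c | c <- cs].

Lemma enc_cnfE tau : enc_cnf tau = body tau ++ [:: false]. Proof. by []. Qed.

Lemma body_cons cl tau : body (cl :: tau) = true :: enc_clause cl ++ body tau.
Proof. by []. Qed.

Lemma body_cat c1 c2 : body (c1 ++ c2) = body c1 ++ body c2.
Proof. by rewrite /body map_cat flatten_cat. Qed.

(** Unique readability in front of any continuation. Unlike plain injectivity, it passes to
    concatenations and to lists. *)
Definition prefix_inj (T : Type) (e : T -> word) :=
  forall x y w w', e x ++ w = e y ++ w' -> x = y /\ w = w'.

Lemma enc_nat_inj : prefix_inj enc_nat.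
Proof.
have h : forall s s' w w', dbl s ++ false :: w = dbl s' ++ false :: w' -> s = s' /\ w = w'.
  by elim=> [|b s IH] [|b' s'] w w' //= => [[->]|[-> /IH [-> ->]]].
move=> x y w w'; rewrite !enc_natE -!catA => /h [e ->]; split=> //.
by rewrite -(binK x) e binK.
Qed.

Lemma enc_lit_inj : prefix_inj enc_lit.
Proof. by move=> [u b] [v c] w w'; rewrite /enc_lit -[LHS]catA -[RHS]catA => /enc_nat_inj /= [-> [-> ->]]. Qed.

Lemma enc_list_inj T (e : T -> word) : prefix_inj e -> prefix_inj (enc_list e).
Proof.
move=> he; rewrite /enc_list => x y w w'; rewrite -!catA.
elim: x y => [|a x IH] [|b y] //=; first by case.
by rewrite -!catA => -[/he [-> /IH [-> ->]]].
Qed.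

Lemma enc_cnf_inj : injective enc_cnf.
Proof.
move=> x y e; apply: (proj1 (enc_list_inj (enc_list_inj enc_lit_inj) (w := [::]) (w' := [::]) _)).
by rewrite !cats0.
Qed.

(* The names are chosen so that renaming a formula is a finite-state transduction
   of its code and that the code of a product is a concatenation. *)
Definition xname u := unbin (enc_nat u ++ [:: true]).
Definition zname u v := unbin (enc_nat u ++ enc_nat v ++ [:: true]).

Lemma bin_xname u : bin (xname u) = enc_nat u ++ [:: true].
Proof. by rewrite unbinK // last_cat. Qed.

Lemma bin_zname u v : bin (zname u v) = enc_nat u ++ enc_nat v ++ [:: true].
Proof. by rewrite unbinK // !last_cat. Qed.

Lemma xname_inj : injective xname.
Proof. by move=> u v /(congr1 bin); rewrite !bin_xname => /enc_nat_inj []. Qed.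

Lemma zname_inj u v u' v' : zname u v = zname u' v' -> u = u' /\ v = v'.
Proof.
by move/(congr1 bin); rewrite !bin_zname => /enc_nat_inj [-> /enc_nat_inj [->]].
Qed.

Lemma xname_zname u v w : xname u <> zname v w.
Proof.
move/(congr1 bin); rewrite bin_xname bin_zname => /enc_nat_inj [_].
by rewrite enc_natE; case: (bin w) => [|b s].
Qed.

Definition ren (tau : cnf) : cnf := [seq [seq (xname l.1, l.2) | l : literal <- cl] | cl <- tau].
Definition zdefs u v : cnf :=
  [:: [:: (zname u v, false); (xname u, true)];
      [:: (zname u v, false); (xname v, true)];
      [:: (zname u v, true); (xname u, false); (xname v, false)]].
Definition tvars (tau : cnf) : seq nat := [seq l.1 | l : literal <- flatten tau].
(** All ordered pairs are taken, repetitions in [tvars] included: a finite-state pass cannot detect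
    repetitions, and they cost only a polynomial factor. The products of [u, v] and of [v, u] are
    different variables. *)
Definition pairdefs (us vs : seq nat) : cnf := flatten [seq flatten (map (zdefs u) vs) | u <- us].
Definition tau2 tau := ren tau ++ pairdefs (tvars tau) (tvars tau).

(* The transducer emits the codes of the variables and the renamed formula.
   Before each state: 0 a clause or the end; 1 a literal or the end of the
   clause; 2, 3 a digit flag, where in 3 the last digit was 0 so that the number
   may not end; 4 a digit; 5 a sign; 6 nothing; 7 is the error state. *)
Definition pdelta (q : nat) (b : bool) : nat * word * word :=
  match q with
  | 0 => if b then (1, [::], [:: true]) else (6, [::], [::])
  | 1 => if b then (2, [::], [:: true]) else (0, [::], [:: false])
  | 2 => if b then (4, [:: true], [:: true; true])
         else (5, [:: false], [:: true; false; true; true; false])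
  | 3 => if b then (4, [:: true], [:: true; true]) else (7, [::], [::])
  | 4 => (if b then 2 else 3, [:: b], [:: true; b])
  | 5 => (1, [::], [:: b])
  | _ => (7, [::], [::])
  end.

Lemma pdelta_lt q b : q < 8 -> (pdelta q b).1.1 < 8.
Proof. by do 8?[case: q => [|q]] => //; case: b. Qed.

Lemma pdelta_small q b : q < 8 -> size (pdelta q b).1.2 + size (pdelta q b).2 <= 6.
Proof. by do 8?[case: q => [|q]] => //; case: b. Qed.

Notation ptr := (tr pdelta).

Lemma dbl_cat w w' : dbl (w ++ w') = dbl w ++ dbl w'.
Proof. by rewrite /dbl map_cat flatten_cat. Qed.

Lemma ptr_dbl (q : bool) w :
  ptr (if q then 2 else 3) (dbl w) = (if last q w then 2 else 3, dbl w, dbl (dbl w)).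
Proof. by elim: w q => [|b w IH] q //=; case: q => /=; rewrite -/(dbl w) IH. Qed.

(** The code of [xname u] is the doubled word [enc_nat u ++ [:: true]] followed by [false]: every
    bit read is doubled, and the tail is a constant emitted at the end of the number. *)
Lemma ptr_lit l : ptr 2 (enc_lit l) = (1, enc_nat l.1, enc_lit (xname l.1, l.2)).
Proof.
rewrite /enc_lit enc_natE -catA tr_cat (ptr_dbl true) last_bin /=.
by rewrite enc_natE bin_xname enc_natE !dbl_cat -!catA.
Qed.

Definition codes us := flatten (map enc_nat us).

Lemma codes_cons u us : codes (u :: us) = dbl (bin u) ++ false :: codes us.
Proof.
by rewrite /codes /= enc_natE -catA.
Qed.

Lemma codes_cat us vs : codes (us ++ vs) = codes us ++ codes vs.
Proof. by rewrite /codes map_cat flatten_cat. Qed.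

Lemma ptr_clause (cl : clause) : ptr 1 (enc_clause cl) =
  (0, codes [seq l.1 | l <- cl], enc_clause [seq (xname l.1, l.2) | l <- cl]).
Proof.
elim: cl => //= l cl; rewrite /enc_clause /enc_list /= => IH.
rewrite -catA tr_cat ptr_lit IH /=.
by rewrite -catA.
Qed.

Lemma ptr_cnf tau : ptr 0 (enc_cnf tau) = (6, codes (tvars tau), body (ren tau)).
Proof.
elim: tau => // cl tau IH.
rewrite enc_cnfE body_cons /= -catA -enc_cnfE.
by rewrite tr_cat ptr_clause IH /tvars /= map_cat codes_cat.
Qed.

(** What the unread input must be if the run from state [q] ends in state 6. It makes the
    translating transducer at the same time a recognizer of codes of formulas. *)
Definition pinv q (x : word) : Prop :=
  match q with
  | 0 => exists tau, x = enc_cnf tau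
  | 1 => exists cl tau, x = enc_clause cl ++ enc_cnf tau
  | 2 => exists w b cl tau, x = dbl w ++ false :: b :: enc_clause cl ++ enc_cnf tau /\ last true w
  | 3 => exists w b cl tau, x = dbl w ++ false :: b :: enc_clause cl ++ enc_cnf tau /\ last false w
  | 4 => exists w b cl tau c, x = c :: dbl w ++ false :: b :: enc_clause cl ++ enc_cnf tau /\ last c w
  | 5 => exists b cl tau, x = b :: enc_clause cl ++ enc_cnf tau
  | 6 => x = [::]
  | _ => False
  end.

Lemma ptr_inv q x : (ptr q x).1.1 = 6 -> pinv q x.
Proof.
elim: x q => [|b x IH] q /=.
  by do 7?[case: q => [|q]].
have {}IH q' : (ptr q' x).1.1 = 6 -> pinv q' x by exact: IH.
case Ed: (pdelta q b) => [[q1 a] o]; case Et: (ptr q1 x) => [[q2 a'] o'] /= e.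
have := IH q1; rewrite Et => /(_ e) {IH Et e}.
move: Ed; do 7?[case: q => [|q]] => /=.
- case: b => [] [<- _ _] /=.
    by move=> [cl [tau ->]]; exists (cl :: tau); rewrite (enc_cnfE (cl :: tau)) /= -catA.
  by move=> ->; exists [::].
- case: b => [] [<- _ _] /=.
    move=> [w [b [cl [tau [-> h]]]]]; exists ((unbin w, b) :: cl), tau.
    by rewrite /enc_clause /enc_list /= /enc_lit enc_natE unbinK //= -!catA.
  by move=> [tau ->]; exists [::], tau.
- case: b => [] [<- _ _] /=.
    by move=> [w [b [cl [tau [c [-> h]]]]]]; exists (c :: w), b, cl, tau.
  by move=> [b [cl [tau ->]]]; exists [::], b, cl, tau.
- case: b => [] [<- _ _] //=.
  by move=> [w [b [cl [tau [c [-> h]]]]]]; exists (c :: w), b, cl, tau.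
- case: b => [] [<- _ _] /=.
    by move=> [w [b [cl [tau [-> h]]]]]; exists w, b, cl, tau, true.
  by move=> [w [b [cl [tau [-> h]]]]]; exists w, b, cl, tau, false.
- by case=> [<- _ _] [cl [tau ->]]; exists b, cl, tau.
- by case=> [<- _ _].
- by case=> [<- _ _].
Qed.

Lemma ptr_valid x : (ptr 0 x).1.1 = 6 -> exists tau, x = enc_cnf tau.
Proof. exact: ptr_inv. Qed.

(* Splits [pairw x y]: 3 reads [y], 4 is the error state. *)
Definition udelta (q : nat) (b : bool) : nat * word * word :=
  match q with
  | 0 => (if b then 1 else 2, [::], [::])
  | 1 => (0, [:: b], [::])
  | 2 => (if b then 4 else 3, [::], [::])
  | 3 => (3, [::], [:: b])
  | _ => (4, [::], [::])
  end.

Lemma udelta_lt q b : q < 5 -> (udelta q b).1.1 < 5.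
Proof. by do 5?[case: q => [|q]] => //; case: b. Qed.

Lemma udelta_small q b : q < 5 -> size (udelta q b).1.2 + size (udelta q b).2 <= 1.
Proof. by do 5?[case: q => [|q]] => //; case: b. Qed.

Notation utr := (tr udelta).

Lemma utr_pairw x y : utr 0 (pairw x y) = (3, x, y).
Proof.
rewrite /pairw; elim: x => [|b x IH] /=; last by rewrite IH.
by elim: y => //= b y; case: (utr 3 y) => [[q a] o] [-> -> ->].
Qed.

Definition uinv q (w x y : word) : Prop :=
  match q with
  | 0 => w = pairw x y
  | 1 => exists b x', x = b :: x' /\ w = b :: pairw x' y
  | 2 => x = [::] /\ w = false :: y
  | 3 => x = [::] /\ w = y
  | _ => False
  end.

Lemma utr_inv q w x y : utr q w = (3, x, y) -> uinv q w x y.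
Proof.
elim: w q x y => [|b w IH] q x y /=.
  by case=> -> <- <-.
case Ed: (udelta q b) => [[q1 a] o]; case Et: (utr q1 w) => [[q2 a'] o'] [e <- <-].
have := IH q1; rewrite Et e => /(_ _ _ erefl) {IH Et e}.
move: Ed; do 4?[case: q => [|q]] => /=.
- case: b => [] [<- <- <-] /=.
    by move=> [b [x' [-> ->]]].
  by move=> [-> ->].
- by case=> <- <- <- /= ->; exists b, a'.
- by case: b => [] [<- <- <-] //= [-> ->].
- by case=> <- <- <- /= [-> ->].
- by case=> <-.
Qed.

Lemma utr_valid w x y : utr 0 w = (3, x, y) -> w = pairw x y.
Proof. exact: utr_inv. Qed.

(** * A stack program for [tau2] *)

(* Stacks: 0 input and result, 1 codes of the variables, 2 reversed output,
   3 and 4 reversed codes of the current pair of variables, 5 scratch, 6 codes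
   for the inner loop, 7 those already processed, 8 a state in unary, 9 second
   component of the input, 10 codes for the outer loop and, later, the clock. *)
Definition emit i := seqs [:: move i 5;
  Loop 5 (seqs [:: Push i false; pushw 2 [:: true; false]])
         (seqs [:: Push i true; pushw 2 [:: true; true]])].

(** Names double the codes of their components. Stack [i] is rebuilt during the copy because each
    code enters several literals. *)
Lemma runs_emit i s : i != 5 -> i != 2 -> s 5 = [::] ->
  runs (emit i) s (6 * size (s i) + 2) (upd s 2 (rev (dbl (rev (s i))) ++ s 2)).
Proof.
move=> h5 h2 hs; rewrite /emit.
set c := Loop _ _ _.
have hl w s1 : s1 5 = w -> runs c s1 (4 * size w + 1)
    (upd (upd (upd s1 5 [::]) i (rev w ++ s1 i)) 2 (rev (dbl w) ++ s1 2)).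
  elim: w s1 => [|b w IH] s1 hw.
    have -> : upd (upd (upd s1 5 [::]) i (rev [::] ++ s1 i)) 2 (rev (dbl [::]) ++ s1 2) = s1.
      by move/eqP: h5 => h5; move/eqP: h2 => h2; upd_ext.
    exact: runs_loopE.
  have hb : runs (if b then seqs [:: Push i true; pushw 2 [:: true; true]]
                  else seqs [:: Push i false; pushw 2 [:: true; false]]) (upd s1 5 w) 3
      (upd (upd (upd s1 5 w) i (b :: s1 i)) 2 (rev [:: true; b] ++ s1 2)).
    have -> : (if b then seqs [:: Push i true; pushw 2 [:: true; true]]
         else seqs [:: Push i false; pushw 2 [:: true; false]]) =
         seqs [:: Push i b; pushw 2 [:: true; b]] by case: (b).
    have h := runs_cons (runs_push i b (upd s1 5 w))
      (runs_cons (runs_pushw 2 [:: true; b] _) (runs_nil _ 0)).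
    by move: h; rewrite (upd_neq _ _ h5) upd_neq 1?eq_sym // upd_neq.
  have := runs_loop hw hb (IH _ _); rewrite upd_neq // upd_neq 1?eq_sym // upd_eq => /(_ erefl) h.
  have -> : upd (upd (upd s1 5 [::]) i (rev (b :: w) ++ s1 i)) 2 (rev (dbl (b :: w)) ++ s1 2) =
    upd (upd (upd (upd (upd (upd s1 5 w) i (b :: s1 i)) 2 (rev [:: true; b] ++ s1 2)) 5 [::]) i
      (rev w ++ (upd (upd (upd s1 5 w) i (b :: s1 i)) 2 (rev [:: true; b] ++ s1 2)) i)) 2
      (rev (dbl w) ++ (upd (upd (upd s1 5 w) i (b :: s1 i)) 2 (rev [:: true; b] ++ s1 2)) 2).
    rewrite upd_eq upd_neq // upd_eq -[dbl (b :: w)]/([:: true; b] ++ dbl w) rev_cat -catA.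
    rewrite rev_cons cat_rcons.
    by clear hb IH h; move/eqP: h5 => h5; move/eqP: h2 => h2; upd_ext.
  by apply: runs_le h _; rewrite /=; lia.
have hm := runs_move s h5; rewrite hs cats0 in hm.
have e5 : upd (upd s 5 (rev (s i))) i [::] 5 = rev (s i).
  by rewrite upd_neq 1?eq_sym // upd_eq.
have e2 : upd (upd s 5 (rev (s i))) i [::] 2 = s 2.
  by rewrite upd_neq 1?eq_sym // upd_neq.
have := runs_cons hm (runs_cons (hl _ _ e5) (runs_nil _ 0)).
rewrite e2 upd_eq revK cats0 size_rev => h.
have -> : upd s 2 (rev (dbl (rev (s i))) ++ s 2) =
  upd (upd (upd (upd (upd s 5 (rev (s i))) i [::]) 5 [::]) i (s i)) 2 (rev (dbl (rev (s i))) ++ s 2).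
  by clear h hl hm e5 e2; move/eqP: h5 => h5; move/eqP: h2 => h2; upd_ext.
by apply: runs_le h _; lia.
Qed.

Section Emit.
Variables (u v : nat).
Notation eu := (enc_nat u).
Notation ev := (enc_nat v).

Definition uvstore (s : store) := [/\ s 3 = rev eu, s 4 = rev ev & s 5 = [::]].
Definition emits c t w :=
  forall s, uvstore s -> runs c s t (upd s 2 (rev w ++ s 2)).

Lemma emits_seq c1 c2 t1 t2 w1 w2 : emits c1 t1 w1 -> emits c2 t2 w2 ->
  emits (Seq c1 c2) (t1 + t2) (w1 ++ w2).
Proof.
move=> h1 h2 s hs; apply: runs_seq (h1 s hs) _.
have := h2 (upd s 2 (rev w1 ++ s 2)); rewrite upd_upd upd_eq rev_cat -catA.
by apply; case: hs.
Qed.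

Lemma emits_cons c cs t1 t2 w1 w2 : emits c t1 w1 -> emits (seqs cs) t2 w2 ->
  emits (seqs (c :: cs)) (t1 + t2) (w1 ++ w2).
Proof. exact: emits_seq. Qed.

Lemma emits_nil : emits (seqs [::]) 0 [::].
Proof. by move=> s _; rewrite /= upd_id; exact: runs_skip. Qed.

Lemma emits_pushw w : emits (pushw 2 w) (size w) w.
Proof. by move=> s _; exact: runs_pushw. Qed.

Lemma emits_emit3 : emits (emit 3) (6 * size eu + 2) (dbl eu).
Proof.
by move=> s [h3 h4 h5]; have := @runs_emit 3 s isT isT h5; rewrite h3 revK size_rev.
Qed.

Lemma emits_emit4 : emits (emit 4) (6 * size ev + 2) (dbl ev).
Proof.
by move=> s [h3 h4 h5]; have := @runs_emit 4 s isT isT h5; rewrite h4 revK size_rev.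
Qed.

(** The first [true] announces a list element. In the tail, [true; true] doubles the last digit of
    the name, [false] closes the number and [b] is the sign. *)
Definition litz b := seqs [:: pushw 2 [:: true]; emit 3; emit 4; pushw 2 [:: true; true; false; b]].
Definition litx i b := seqs [:: pushw 2 [:: true]; emit i; pushw 2 [:: true; true; false; b]].

Notation C := (6 * (size eu + size ev) + 9).

Lemma emits_litz b : emits (litz b) C (true :: enc_lit (zname u v, b)).
Proof.
have -> : C = 1 + (6 * size eu + 2 + (6 * size ev + 2 + (4 + 0))) by lia.
have -> : true :: enc_lit (zname u v, b) =
  [:: true] ++ (dbl eu ++ (dbl ev ++ ([:: true; true; false; b] ++ [::]))).
  by rewrite /enc_lit enc_natE bin_zname !dbl_cat /= -!catA.
apply: emits_cons (emits_pushw _) _.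
apply: emits_cons emits_emit3 _.
apply: emits_cons emits_emit4 _.
by apply: emits_cons (emits_pushw _) emits_nil.
Qed.

Lemma emits_le c t t' w : emits c t w -> t <= t' -> emits c t' w.
Proof. by move=> h le s hs; apply: runs_le (h s hs) le. Qed.

Lemma emits_litx i n b : i \in [:: 3; 4] -> n = (if i == 3 then u else v) ->
  emits (litx i b) C (true :: enc_lit (xname n, b)).
Proof.
move=> hi ->.
have -> : forall m, true :: enc_lit (xname m, b) =
  [:: true] ++ (dbl (enc_nat m) ++ ([:: true; true; false; b] ++ [::])).
  by move=> m; rewrite /enc_lit enc_natE bin_xname !dbl_cat /= -!catA.
move: hi; rewrite !inE => /orP [] /eqP -> /=.
  apply: (@emits_le _ (1 + (6 * size eu + 2 + (4 + 0)))); last by lia.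
  apply: emits_cons (emits_pushw [:: true]) _.
  apply: emits_cons emits_emit3 _.
  exact: (emits_cons (emits_pushw _) emits_nil).
apply: (@emits_le _ (1 + (6 * size ev + 2 + (4 + 0)))); last by lia.
apply: emits_cons (emits_pushw [:: true]) _.
apply: emits_cons emits_emit4 _.
exact: (emits_cons (emits_pushw _) emits_nil).
Qed.

Definition act := seqs
  [:: pushw 2 [:: true]; litz false; litx 3 true; pushw 2 [:: false];
      pushw 2 [:: true]; litz false; litx 4 true; pushw 2 [:: false];
      pushw 2 [:: true]; litz true; litx 3 false; litx 4 false; pushw 2 [:: false]].

(** The three clauses have seven literals of cost at most [C] each and need six single pushes of
    list markers. *)
Lemma emits_act : emits act (42 * (size eu + size ev) + 69) (body (zdefs u v)).
Proof.
have -> : 42 * (size eu + size ev) + 69 =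
  1 + (C + (C + (1 + (1 + (C + (C + (1 + (1 + (C + (C + (C + (1 + 0)))))))))))) by lia.
have -> : body (zdefs u v) = [:: true] ++ ((true :: enc_lit (zname u v, false)) ++
  ((true :: enc_lit (xname u, true)) ++ ([:: false] ++ ([:: true] ++
  ((true :: enc_lit (zname u v, false)) ++ ((true :: enc_lit (xname v, true)) ++ ([:: false] ++
  ([:: true] ++ ((true :: enc_lit (zname u v, true)) ++ ((true :: enc_lit (xname u, false)) ++
  ((true :: enc_lit (xname v, false)) ++ ([:: false] ++ [::])))))))))))).
  have enc_clause_cons l (cl : clause) : enc_clause (l :: cl) = true :: enc_lit l ++ enc_clause cl.
    by rewrite /enc_clause /enc_list /= -catA.
  rewrite /zdefs !body_cons !enc_clause_cons -[enc_clause [::]]/[:: false] -[body [::]]/[::].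
  move: (enc_lit (_, false)) (enc_lit (_, true)) (enc_lit (_, true)) (enc_lit (_, true)).
  move: (enc_lit (_, false)) (enc_lit (_, false)) => *.
  by rewrite /=; do ?rewrite -catA /=.
by rewrite /act; do 13?[apply: emits_cons;
  [solve [exact: emits_pushw | exact: emits_litz | exact: emits_litx] |]]; exact: emits_nil.
Qed.

End Emit.

Lemma runs_push_st i b l :
  runs (Push i b) (st l) 1 (st (set_nth [::] l i (b :: nth [::] l i))).
Proof. by rewrite -st_upd; exact: runs_push. Qed.

Lemma runs_move_st i j l : i != j -> runs (move i j) (st l) (2 * size (nth [::] l i) + 1)
  (st (set_nth [::] (set_nth [::] l j (rev (nth [::] l i) ++ nth [::] l j)) i [::])).
Proof. by move=> h; rewrite -!st_upd; exact: runs_move. Qed.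

Lemma runs_clear_st i l :
  runs (clear i) (st l) (size (nth [::] l i)).+1 (st (set_nth [::] l i [::])).
Proof. by rewrite -st_upd; exact: runs_clear. Qed.

Lemma runs_pushw_st i w l :
  runs (pushw i w) (st l) (size w) (st (set_nth [::] l i (rev w ++ nth [::] l i))).
Proof. by rewrite -st_upd; exact: runs_pushw. Qed.

Lemma runs_case_st i cE c0 c1 l t s' b w : nth [::] l i = b :: w ->
  runs (if b then c1 else c0) (st (set_nth [::] l i w)) t s' ->
  runs (Case i cE c0 c1) (st l) t.+1 s'.
Proof. by move=> h; rewrite -st_upd; exact: runs_case. Qed.

Lemma runs_loop_st i c0 c1 l b w t1 s1 t2 s2 : nth [::] l i = b :: w ->
  runs (if b then c1 else c0) (st (set_nth [::] l i w)) t1 s1 ->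
  runs (Loop i c0 c1) s1 t2 s2 -> runs (Loop i c0 c1) (st l) (t1 + t2).+1 s2.
Proof. by move=> h; rewrite -st_upd; exact: runs_loop. Qed.

(** On stack 6, [true] announces a digit of [v], and [false] completes its code on stack 4 and
    triggers [act]. Stack 7 collects a reversed copy, from which [outer] restores the list for the
    next [u]. *)
Definition inner := Loop 6
  (seqs [:: Push 7 false; Push 4 false; act; clear 4])
  (seqs [:: Push 7 true; Push 4 true;
     Case 6 Skip (seqs [:: Push 7 false; Push 4 false]) (seqs [:: Push 7 true; Push 4 true])]).

Definition outer := Loop 10
  (seqs [:: Push 3 false; inner; move 7 6; clear 3])
  (seqs [:: Push 3 true; Case 10 Skip (Push 3 false) (Push 3 true)]).

Section Loops.
Variables (x l z y : word).

Lemma inner_bits w o u v l2 l3 m t s' :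
  runs inner (st [:: x; l; o; u; rev (dbl w) ++ v; [::]; l2; rev (dbl w) ++ l3; z; y; m]) t s' ->
  runs inner (st [:: x; l; o; u; v; [::]; dbl w ++ l2; l3; z; y; m]) (6 * size w + t) s'.
Proof.
elim: w v l3 => [|b w IH] v l3 //= h.
have h1 := IH (b :: true :: v) (b :: true :: l3).
have {}h : runs inner (st [:: x; l; o; u; rev (dbl w) ++ [:: b, true & v]; [::]; l2;
      rev (dbl w) ++ [:: b, true & l3]; z; y; m]) t s'.
  by move: h; rewrite -/(dbl w) !rev_cons !cat_rcons.
apply: (@runs_le _ _ (5 + (6 * size w + t)).+1); last by lia.
apply: runs_loop_st (h1 h); first by reflexivity.
rewrite /=.
apply: (@runs_le _ _ (1 + (1 + (3 + 0)))); last by [].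
apply: runs_cons (runs_push_st _ _ _) _.
apply: runs_cons (runs_push_st _ _ _) _; rewrite /=.
apply: runs_cons (runs_nil _ 0).
apply: (@runs_case_st _ _ _ _ _ _ _ b (dbl w ++ l2)); first by [].

by rewrite /=; case: (b); do 2!apply: runs_cons (runs_push_st _ _ _) _; apply: (runs_nil _ 0).
Qed.

Lemma runs_inner u (vs : seq nat) N o l3 m :
  size (enc_nat u) <= N -> (forall v, v \in vs -> size (enc_nat v) <= N) ->
  runs inner (st [:: x; l; o; rev (enc_nat u); [::]; [::]; codes vs; l3; z; y; m])
    (size vs * (91 * N + 80) + 1)
    (st [:: x; l; rev (body (flatten (map (zdefs u) vs))) ++ o; rev (enc_nat u); [::]; [::]; [::];
         rev (codes vs) ++ l3; z; y; m]).
Proof.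
move=> hu; elim: vs o l3 => [|v vs IH] o l3 hv; first exact: runs_loopE.
have hN : size (enc_nat v) <= N by apply: hv; rewrite mem_head.
have hb : size (enc_nat v) = (2 * size (bin v)).+1.
  rewrite enc_natE size_cat addn1; congr _.+1.
  by elim: (bin v) => //= b w ->; lia.
have {}IH := IH _ _ (fun w h => hv w (mem_behead (s := v :: vs) h)).
have e := codes_cons v vs.
rewrite {1}e.
apply: (@runs_le _ _ (6 * size (bin v) +
    (1 + (1 + (42 * (size (enc_nat u) + size (enc_nat v)) + 69 + (N.+1 + 0))) +
     (size vs * (91 * N + 80) + 1)).+1)); last by rewrite /=; lia.
apply: inner_bits; rewrite !cats0.
have -> : rev (codes (v :: vs)) ++ l3 = rev (codes vs) ++ false :: rev (dbl (bin v)) ++ l3.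
  by rewrite e rev_cat rev_cons -catA cat_rcons.
have -> : rev (body (flatten (map (zdefs u) (v :: vs)))) ++ o =
  rev (body (flatten (map (zdefs u) vs))) ++ rev (body (zdefs u v)) ++ o.
  have -> : flatten (map (zdefs u) (v :: vs)) = zdefs u v ++ flatten (map (zdefs u) vs) by [].
  by rewrite body_cat rev_cat -catA.
apply: runs_loop_st (IH _ _); first by reflexivity.
apply: runs_cons (runs_push_st _ _ _) _.
apply: runs_cons (runs_push_st _ _ _) _; rewrite /=.
apply: runs_cons.
  apply: (@emits_act u v); split; rewrite /st /=; [by []| |by []].
  by rewrite enc_natE rev_cat.
rewrite st_upd /=.
apply: runs_cons (runs_nil _ 0).
apply: runs_le (runs_clear_st 4 _) _.
by rewrite /= size_rev; move: hN; rewrite enc_natE size_cat /=; lia.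
Qed.

Lemma outer_bits w o u l2 m t s' :
  runs outer (st [:: x; l; o; rev (dbl w) ++ u; [::]; [::]; l2; [::]; z; y; m]) t s' ->
  runs outer (st [:: x; l; o; u; [::]; [::]; l2; [::]; z; y; dbl w ++ m]) (6 * size w + t) s'.
Proof.
elim: w u => [|b w IH] u //= h.
have h1 := IH (b :: true :: u).
have {}h : runs outer (st [:: x; l; o; rev (dbl w) ++ [:: b, true & u]; [::]; [::]; l2;
      [::]; z; y; m]) t s'.
  by move: h; rewrite -/(dbl w) !rev_cons !cat_rcons.
apply: (@runs_le _ _ (5 + (6 * size w + t)).+1); last by lia.
apply: runs_loop_st (h1 h); first by reflexivity.
rewrite /=.
apply: (@runs_le _ _ (1 + (2 + 0))); last by [].
apply: runs_cons (runs_push_st _ _ _) _; rewrite /=.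
apply: runs_cons (runs_nil _ 0).
apply: (@runs_case_st _ _ _ _ _ _ _ b (dbl w ++ m)); first by [].

by case: (b); apply: runs_push_st.
Qed.

Lemma runs_outer (us vs : seq nat) N o : size vs <= N -> size (codes vs) <= N ->
  (forall v, v \in us ++ vs -> size (enc_nat v) <= N) ->
  runs outer (st [:: x; l; o; [::]; [::]; [::]; codes vs; [::]; z; y; codes us])
    (size us * (N * (91 * N + 80) + 6 * N + 10) + 1)
    (st [:: x; l; rev (body (pairdefs us vs)) ++ o; [::]; [::]; [::]; codes vs; [::]; z; y; [::]]).
Proof.
move=> hN1 hN2; elim: us o => [|u us IH] o hv; first exact: runs_loopE.
have hN : size (enc_nat u) <= N by apply: hv; rewrite mem_head.
have hb : size (enc_nat u) = (2 * size (bin u)).+1.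
  rewrite enc_natE size_cat addn1; congr _.+1.
  by elim: (bin u) => //= b w ->; lia.
have {}IH := IH _ (fun w h => hv w (mem_behead (s := u :: us ++ vs) h)).
have e := codes_cons u us.
rewrite {1}e.
apply: (@runs_le _ _ (6 * size (bin u) +
   (1 + (size vs * (91 * N + 80) + 1 + (2 * N + 1 + (N.+1 + 0))) +
     (size us * (N * (91 * N + 80) + 6 * N + 10) + 1)).+1)).
  apply: outer_bits; rewrite !cats0.
  have -> : rev (body (pairdefs (u :: us) vs)) ++ o =
    rev (body (pairdefs us vs)) ++ rev (body (flatten (map (zdefs u) vs))) ++ o.
    by rewrite /pairdefs /= body_cat rev_cat -catA.
  apply: runs_loop_st (IH _); first by reflexivity.
  apply: runs_cons (runs_push_st _ _ _) _; rewrite /=.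
  have -> : false :: rev (dbl (bin u)) = rev (enc_nat u) by rewrite enc_natE rev_cat.
  apply: runs_cons.
    by apply: (runs_inner (N := N)) => // v hvs; apply: hv; rewrite mem_cat hvs orbT.
  apply: runs_cons.
    apply: runs_le (runs_move_st (i := 7) (j := 6) _ _) _ => //.
    by rewrite /= cats0 size_rev; lia.
  rewrite /= !cats0 revK; apply: runs_cons (runs_nil _ 0).
  by apply: runs_le (runs_clear_st 3 _) _; rewrite /= size_rev.
by rewrite /=; nia.
Qed.

End Loops.

Definition dup := Loop 1 (seqs [:: Push 6 false; Push 10 false]) (seqs [:: Push 6 true; Push 10 true]).

Lemma runs_dup x l o z y l2 m :
  runs dup (st [:: x; l; o; [::]; [::]; [::]; l2; [::]; z; y; m]) (3 * size l + 1)
           (st [:: x; [::]; o; [::]; [::]; [::]; rev l ++ l2; [::]; z; y; rev l ++ m]).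
Proof.
elim: l l2 m => [|b l IH] l2 m; first exact: runs_loopE.
have h := IH (b :: l2) (b :: m).
rewrite !rev_cons !cat_rcons.
apply: (@runs_le _ _ (1 + (1 + 0) + (3 * size l + 1)).+1); last by rewrite /=; lia.
apply: runs_loop_st h; first by reflexivity.
rewrite /=; case: (b); apply: runs_cons (runs_push_st _ _ _) _;
  apply: runs_cons (runs_push_st _ _ _) (runs_nil _ 0).
Qed.

(** The final [true] on stack 8 reports that the input was the code of a formula; in all other cases
    [progT] leaves that stack empty. *)
Definition mainT := seqs [:: dup; outer; Push 2 false; move 2 0; clear 6; Push 8 true].

Definition outer_cost N := N * (N * (91 * N + 80) + 6 * N + 10) + 1.

Lemma runs_mainT us o y N : size us <= N -> size (codes us) <= N ->
  (forall v, v \in us -> size (enc_nat v) <= N) -> size o <= 7 * N ->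
  runs mainT (st [:: [::]; rev (codes us); rev o; [::]; [::]; [::]; [::]; [::]; [::]; y; [::]])
    (3 * outer_cost N + 19 * N + 10)
    (st [:: o ++ body (pairdefs us us) ++ [:: false]; [::]; [::]; [::]; [::]; [::]; [::]; [::];
            [:: true]; y; [::]]).
Proof.
move=> h1 h2 h3 h4.
have ho := runs_outer [::] [::] [::] y (us := us) (rev o) h1 h2 (N := N).
have {}ho : runs outer (st [:: [::]; [::]; rev o; [::]; [::]; [::]; codes us; [::]; [::]; y; codes us])
    (outer_cost N) (st [:: [::]; [::]; rev (body (pairdefs us us)) ++ rev o; [::]; [::]; [::];
                           codes us; [::]; [::]; y; [::]]).
  apply: (runs_le (ho _)); last by rewrite /outer_cost; nia.
  by move=> v; rewrite mem_cat orbb; exact: h3.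
have hs := runs_size 2 ho; rewrite /st /= size_cat !size_rev in hs.
apply: (@runs_le _ _ (3 * size (rev (codes us)) + 1 + (outer_cost N + (1 +
  (2 * (size (body (pairdefs us us)) + size o).+1 + 1 + ((size (codes us)).+1 + (1 + 0)))))));
  last by rewrite size_rev; lia.
apply: runs_cons (runs_dup _ _ _ _ _ _ _) _; rewrite revK !cats0.
apply: runs_cons ho _.
apply: runs_cons (runs_push_st _ _ _) _; rewrite /=.
apply: runs_cons.
  by apply: runs_le (@runs_move_st 2 0 _ _) _; rewrite //= size_cat !size_rev.
rewrite /= cats0.
apply: runs_cons (runs_clear_st _ _) _; rewrite /=.
rewrite rev_cons rev_cat !revK -cats1 -catA.
exact: runs_cons (runs_push_st _ _ _) (runs_nil _ 0).
Qed.

Definition progT := seqs [:: transduce 8 pdelta 0 8 1 2; switch 8 (nseq 6 Skip ++ [:: mainT; Skip])].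

Definition stxy x z y := st [:: x; [::]; [::]; [::]; [::]; [::]; [::]; [::]; z; y; [::]].

(** The transducer has 8 states and emits at most 6 bits per step, so it costs [24 = 6 + 2 * 8 + 2]
    per bit. Its outputs have at most [6 * n] bits, the value of [N] in [runs_mainT]. *)
Definition costT n := 24 * n.+1 + (3 * outer_cost (6 * n) + 19 * (6 * n) + 10 + 8).

Lemma runs_parse x y : let: (q, a, o) := ptr 0 x in
  runs (transduce 8 pdelta 0 8 1 2) (stxy x [::] y) (24 * (size x).+1)
   (st [:: [::]; rev a; rev o; [::]; [::]; [::]; [::]; [::]; nseq q true; y; [::]]).
Proof.
have := @runs_transduce 8 pdelta 0 8 1 2 isT pdelta_lt 6 pdelta_small 0 (stxy x [::] y) isT erefl.
have -> : stxy x [::] y 0 = x by [].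
by case: (ptr 0 x) => [[q a] o]; rewrite !st_upd /= !cats0.
Qed.

Lemma size_codes us : (size us <= size (codes us)) /\
  (forall v, v \in us -> size (enc_nat v) <= size (codes us)).
Proof.
elim: us => // u us [IH1 IH2]; rewrite /codes /= -/(codes us) size_cat; split.
  by rewrite enc_natE size_cat /=; lia.
by move=> v; rewrite inE => /orP [/eqP ->|/IH2]; lia.
Qed.

Lemma runs_progT_valid tau y : runs progT (stxy (enc_cnf tau) [::] y)
  (costT (size (enc_cnf tau))) (stxy (enc_cnf (tau2 tau)) [:: true] y).
Proof.
have := runs_parse (enc_cnf tau) y; have := tr_size pdelta_lt pdelta_small (enc_cnf tau) (isT : 0 < 8).
rewrite ptr_cnf /= => hs h; rewrite /costT; set n := size (enc_cnf tau) in hs h *.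
apply: runs_cons h _.
apply: (@runs_le _ _ (3 * outer_cost (6 * n) + 19 * (6 * n) + 10 + 7 + 0)); last by lia.
apply: runs_cons (runs_nil _ 0).
apply: (runs_switch (q := 6)) => //; rewrite st_upd /=.
have [h1 h2] := size_codes (tvars tau).
have hc : size (codes (tvars tau)) <= 6 * n by lia.
rewrite enc_cnfE body_cat -catA.
apply: runs_mainT => //; try by lia.
by move=> v /h2; lia.
Qed.

Lemma runs_progT_invalid x y : ~ (exists tau, x = enc_cnf tau) ->
  exists2 s, runs progT (stxy x [::] y) (costT (size x)) s & s 8 = [::].
Proof.
move=> hx; have := runs_parse x y; have := tr_lt pdelta_lt x (isT : 0 < 8).
have : (ptr 0 x).1.1 <> 6 by move/ptr_valid.
case: (ptr 0 x) => [[q a] o] /= hq hq8 h; eexists.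
  apply: (@runs_le _ _ (24 * (size x).+1 + (0 + q.+1 + 0))); last by rewrite /costT; lia.
  apply: runs_cons h _; apply: runs_cons (runs_nil _ 0).
  apply: (runs_switch (q := q)); [by []|by []|].
  rewrite (_ : nth _ _ q = Skip); first exact: runs_skip.
  by move: hq hq8; do 8?[case: q => [|q]].
by rewrite upd_eq.
Qed.

(** * Running a Turing machine on the stacks *)

Definition esym (x : sym) : word := if x is Some b then [:: true; b] else [:: false].
Definition encs (r : seq sym) : word := flatten (map esym r).
Definition pushsym i (x : sym) := pushw i (rev (esym x)).
(** An empty stack is read as a blank, as [head None] does beyond the written part of the tape. *)
Definition popsym i (f : sym -> cmd) :=
  Case i (f None) (f None) (Case i Skip (f (Some false)) (f (Some true))).

Lemma runs_pushsym_st i x l :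
  runs (pushsym i x) (st l) 2 (st (set_nth [::] l i (esym x ++ nth [::] l i))).
Proof.
rewrite -{1}(revK (esym x)); apply: runs_le (runs_pushw_st _ _ _) _.
by rewrite size_rev; case: x.
Qed.

Lemma runs_popsym_st i f l t s' r : nth [::] l i = encs r ->
  runs (f (head None r)) (st (set_nth [::] l i (encs (behead r)))) t s' ->
  runs (popsym i f) (st l) t.+2 s'.
Proof.
case: r => [|[b|] r] h hf.
- apply: runs_le (leqnSn _); apply: runs_caseE => //.
  have <- : st (set_nth [::] l i [::]) = st l.
    by rewrite -st_upd -[RHS](upd_id _ i); congr upd; rewrite /st h.
  exact: hf.
- apply: (@runs_case_st _ _ _ _ _ _ _ true (b :: encs r)) => //.
  apply: (@runs_case_st _ _ _ _ _ _ _ b (encs r)).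
    by rewrite nth_set_nth /= eqxx.
  by rewrite set_set_nth eqxx; case: (b) hf.
- apply: runs_le (leqnSn _).
  by apply: (@runs_case_st _ _ _ _ _ _ _ false (encs r)).
Qed.

Section Simulation.
Variables (M : TM) (clocked : bool).

(** With a clock, stack 10 holds the remaining strokes: each step uses one, and halting discards the
    rest. Without it, stack 10 holds a single flag, popped by the loop and pushed again unless the
    machine halts. *)
Definition cont := if clocked then Skip else Push 10 true.
Definition halt := if clocked then clear 10 else Skip.

(* A configuration [(q, tp l r)] is stored with [l] on stack 1, [r] on stack 2 and
   [q] in unary on stack 8; the simulation runs while stack 10 is nonempty. *)
Definition stepc (p : 'I_(tm_q M).+1) := popsym 2 (fun h =>
  match tm_delta M (p, h) with
  | None => seqs [:: pushsym 2 h; halt]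
  | Some (q', w, d) =>
      seqs [:: (if d then pushsym 1 w else seqs [:: pushsym 2 w; popsym 1 (pushsym 2)]);
               pushw 8 (nseq (nat_of_ord q') true); cont]
  end).
Definition bodyc := switch 8 (map stepc (enum 'I_(tm_q M).+1)).
Definition simc := Loop 10 bodyc bodyc.

Definition cst l r z y g :=
  st [:: [::]; encs l; encs r; [::]; [::]; [::]; [::]; [::]; z; y; g].

Let C := 2 * tm_q M + 20.

Lemma nth_stepc (q : 'I_(tm_q M).+1) : nth Skip (map stepc (enum 'I_(tm_q M).+1)) q = stepc q.
Proof. by rewrite (nth_map q) ?size_enum_ord // nth_ord_enum. Qed.

Lemma runs_bodyc q l r y g t s' :
  runs (stepc q) (cst l r [::] y g) t s' ->
  runs bodyc (cst l r (nseq (nat_of_ord q) true) y g) (t + (tm_q M).+1) s'.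
Proof.
move=> h; apply: (@runs_le _ _ (t + q.+1)); last by rewrite leq_add2l ltn_ord.
apply: (runs_switch (q := q)); first by [].
  by rewrite size_map size_enum_ord ltn_ord.
by rewrite nth_stepc /cst st_upd.
Qed.

Lemma runs_step_halt q l r y g : @tm_step M (q, tp l r) = None ->
  runs bodyc (cst l r (nseq (nat_of_ord q) true) y g)
    (C + (if clocked then (size g).+1 else 0))
    (cst l (head None r :: behead r) [::] y (if clocked then [::] else g)).
Proof.
rewrite /tm_step /tp; case E: (tm_delta M _) => [[[q' w] d]|] // _.
apply: (@runs_le _ _ ((2 + ((if clocked then (size g).+1 else 0) + 0)).+2 + (tm_q M).+1));
  last by rewrite /C; lia.
apply: runs_bodyc; apply: (runs_popsym_st (r := r)); first by [].
rewrite E /=; apply: runs_cons (runs_pushsym_st _ _ _) _; rewrite /=.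
apply: runs_cons (runs_nil _ 0); rewrite /halt; case: clocked; last exact: runs_skip.
exact: runs_clear_st.
Qed.

Lemma runs_step_go q l r y g c : @tm_step M (q, tp l r) = Some c ->
  exists q' l' r', c = (q', tp l' r') /\
  runs bodyc (cst l r (nseq (nat_of_ord q) true) y g) C
    (cst l' r' (nseq (nat_of_ord q') true) y (if clocked then g else true :: g)).
Proof.
rewrite /tm_step /tp; case E: (tm_delta M _) => [[[q' w] d]|] // [<-].
have hq : q' <= tm_q M by rewrite -ltnS ltn_ord.
exists q', (if d then w :: l else behead l), (if d then behead r else head None l :: w :: behead r).
split; first by case: d {E}.
apply: (@runs_le _ _ ((6 + (q' + (1 + 0))).+2 + (tm_q M).+1)); last by rewrite /C; lia.
apply: runs_bodyc; apply: (runs_popsym_st (r := r)); first by [].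
rewrite E /=.
set l' := if d then w :: l else _; set r' := if d then behead r else _.
apply: (@runs_cons _ _ _ 6 (cst l' r' [::] y g) (q' + (1 + 0))).
  rewrite /l' /r'; case: d {E l' r'}.
    by apply: runs_le (runs_pushsym_st _ _ _) _.
  apply: (@runs_le _ _ (2 + (2.+2 + 0))); last by [].
  apply: runs_cons (runs_pushsym_st _ _ _) _; rewrite /=.
  apply: runs_cons (runs_nil _ 0).
  apply: (runs_popsym_st (r := l)); first by [].
  exact: runs_pushsym_st.
apply: (@runs_le _ _ (size (nseq q' true) + (1 + 0))); last by rewrite size_nseq.
apply: runs_cons (runs_pushw_st _ _ _) _; rewrite /= cats0 rev_nseq.
apply: runs_cons (runs_nil _ 0); rewrite /cont; case: clocked; first exact: runs_skip.
exact: runs_push_st.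
Qed.

End Simulation.

(** The clock ends the loop whether or not [M] halts, and the result is specified only if [M] halts
    in time. The inequality [t < n] is strict since noticing the halt takes one more iteration.
    Discarding the remaining strokes is charged to the iterations saved. *)
Lemma runs_simc M q l r y n :
  exists l' r' z, runs (simc M true) (cst l r (nseq (nat_of_ord q) true) y (nseq n true))
    (n * (2 * tm_q M + 22) + 1) (cst l' r' z y [::]) /\
  (forall t tp', t < n -> @tm_run M t (q, tp l r) = Some tp' -> tp' = tp l' r').
Proof.
elim: n q l r => [|n IH] q l r.
  by exists l, r, (nseq (nat_of_ord q) true); split=> //; exact: runs_loopE.
case E: (@tm_step M (q, tp l r)) => [c|].
  have [q' [l1 [r1 [ec h]]]] := runs_step_go true y (nseq n true) E.
  have [l' [r' [z [h1 h2]]]] := IH q' l1 r1.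
  exists l', r', z; split.
    apply: (@runs_le _ _ (2 * tm_q M + 20 + (n * (2 * tm_q M + 22) + 1)).+1);
      last by rewrite mulSn; lia.
    by apply: (@runs_loop_st _ _ _ _ true (nseq n true)) h1.
  by case=> [|t] tp' ht; rewrite tm_runE E // ec; apply: h2.
exists l, (head None r :: behead r), [::]; split.
  apply: (@runs_le _ _ (2 * tm_q M + 20 + (size (nseq n true)).+1 + 1).+1);
    last by rewrite size_nseq mulSn; lia.
  by apply: (@runs_loop_st _ _ _ _ true (nseq n true)) (runs_loopE _ _ _);
    [|exact: (runs_step_halt true y (nseq n true) E)|].
by move=> t tp' _; rewrite tm_runE E => -[<-].
Qed.

Lemma runs_simu M q l r y t tp' : @tm_run M t (q, tp l r) = Some tp' ->
  exists l' r', tp' = tp l' r' /\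
  runs (simc M false) (cst l r (nseq (nat_of_ord q) true) y [:: true])
    (t.+1 * (2 * tm_q M + 22) + 1) (cst l' r' [::] y [::]).
Proof.
elim: t q l r => [|t IH] q l r; rewrite tm_runE.
all: case E: (@tm_step M (q, tp l r)) => [c|] //.
- move=> [<-]; exists l, (head None r :: behead r); split=> //.
  apply: (@runs_le _ _ (2 * tm_q M + 20 + 0 + 1).+1); last by lia.
  by apply: (@runs_loop_st _ _ _ _ true [::]) (runs_loopE _ _ _);
    [|exact: (runs_step_halt false y [::] E)|].
- have [q' [l1 [r1 [ec h]]]] := runs_step_go false y [::] E.
  rewrite ec => /IH [l' [r' [-> h']]]; exists l', r'; split=> //.
  apply: (@runs_le _ _ (2 * tm_q M + 20 + (t.+1 * (2 * tm_q M + 22) + 1)).+1);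
    last by rewrite (mulSn t.+1); lia.
  by apply: (@runs_loop_st _ _ _ _ true [::]) h'.
- move=> [<-]; exists l, (head None r :: behead r); split=> //.
  apply: (@runs_le _ _ (2 * tm_q M + 20 + 0 + 1).+1); last by lia.
  by apply: (@runs_loop_st _ _ _ _ true [::]) (runs_loopE _ _ _);
    [|exact: (runs_step_halt false y [::] E)|].
Qed.

(** A blank is coded by [false]; on it stack 2 is cleared, which ends the loop just where [somes]
    stops. *)
Definition outp := seqs [:: Loop 2 (clear 2) (Case 2 Skip (Push 5 false) (Push 5 true)); move 5 0].

Lemma runs_outp l r z y g :
  exists2 s, runs outp (cst l r z y g) (6 * size (encs r) + 10) s & s 0 = somes r.
Proof.
have h w : exists w', runs (Loop 2 (clear 2) (Case 2 Skip (Push 5 false) (Push 5 true)))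
   (st [:: [::]; encs l; encs r; [::]; [::]; w; [::]; [::]; z; y; g]) (2 * size (encs r) + 3)
   (st [:: [::]; encs l; [::]; [::]; [::]; rev (somes r) ++ w; [::]; [::]; z; y; w']).
  exists g; elim: r w => [|[b|] r IH] w.
  - by apply: runs_le (runs_loopE _ _ _) _.
  - have -> : encs (Some b :: r) = true :: b :: encs r by [].
    have -> : somes (Some b :: r) = b :: somes r by [].
    rewrite rev_cons cat_rcons.
    apply: (@runs_le _ _ (2 + (2 * size (encs r) + 3)).+1); last by rewrite /=; lia.
    apply: (@runs_loop_st _ _ _ _ true (b :: encs r)) (IH (b :: w)); first by [].
    apply: (@runs_case_st _ _ _ _ _ _ _ b (encs r)) => //.
    by case: (b); exact: runs_push_st.
  - have -> : encs (None :: r) = false :: encs r by [].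
    apply: (@runs_le _ _ ((size (encs r)).+1 + 1).+1); last by rewrite /=; lia.
    apply: (@runs_loop_st _ _ _ _ false (encs r)) (runs_loopE _ _ _); first by [].
      exact: (runs_clear_st 2).
    by [].
have [w' {}h] := h [::].
have hs := runs_size 5 h; rewrite /st /= cats0 size_rev in hs.
eexists.
  apply: (@runs_le _ _ (2 * size (encs r) + 3 + (2 * size (somes r) + 1 + 0))).
    apply: runs_cons h _; rewrite cats0.
    apply: runs_cons (runs_nil _ 0).
    by apply: runs_le (@runs_move_st 5 0 _ _) _; rewrite //= size_rev.
  by lia.
by rewrite /st /= cats0 revK.
Qed.

Definition load := Loop 5 (pushsym 2 (Some false)) (pushsym 2 (Some true)).
Definition loadd := Loop 5 (seqs [:: pushsym 2 (Some false); pushsym 2 (Some true)])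
                           (seqs [:: pushsym 2 (Some true); pushsym 2 (Some true)]).

Lemma runs_load x a r c d w e f z y g :
  runs load (st [:: x; a; encs r; c; d; w; e; f; z; y; g]) (3 * size w + 1)
    (st [:: x; a; encs (map Some (rev w) ++ r); c; d; [::]; e; f; z; y; g]).
Proof.
elim: w r => [|b w IH] r; first exact: runs_loopE.
have := IH (Some b :: r); rewrite rev_cons map_rcons cat_rcons => h.
apply: (@runs_le _ _ (2 + (3 * size w + 1)).+1); last by rewrite /=; lia.
by apply: runs_loop_st h; first reflexivity; case: (b); exact: runs_pushsym_st.
Qed.

Lemma runs_loadd x a r c d w e f z y g :
  runs loadd (st [:: x; a; encs r; c; d; w; e; f; z; y; g]) (5 * size w + 1)
    (st [:: x; a; encs (map Some (dbl (rev w)) ++ r); c; d; [::]; e; f; z; y; g]).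
Proof.
elim: w r => [|b w IH] r; first exact: runs_loopE.
have := IH (Some true :: Some b :: r).
have -> : map Some (dbl (rev (b :: w))) ++ r = map Some (dbl (rev w)) ++ Some true :: Some b :: r.
  by rewrite rev_cons -cats1 dbl_cat map_cat -catA.
move=> h; apply: (@runs_le _ _ (2 + (2 + 0) + (5 * size w + 1)).+1); last by rewrite /=; lia.
apply: runs_loop_st h; first by reflexivity.
by case: (b); apply: runs_cons (runs_pushsym_st _ _ _) _;
  apply: runs_cons (runs_pushsym_st _ _ _) (runs_nil _ 0).
Qed.

Definition loadX := seqs [:: clear 8; move 0 5; load].
(** The simulated tape is written from its right end: second component, the separator of two
    [false], then the first component with each bit preceded by [true]. *)
Definition packXY := seqs [:: clear 8; move 9 5; load; pushsym 2 (Some false);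
  pushsym 2 (Some false); move 0 5; loadd].

Lemma runs_loadX X z y g :
  runs loadX (st [:: X; [::]; [::]; [::]; [::]; [::]; [::]; [::]; z; y; g])
    (size z + 5 * size X + 3) (cst [::] (map Some X) [::] y g).
Proof.
apply: (@runs_le _ _ ((size z).+1 + (2 * size X + 1 + (3 * size (rev X) + 1 + 0)))).
  apply: runs_cons (runs_clear_st _ _) _; rewrite /=.
  apply: runs_cons; first by apply: runs_le (@runs_move_st 0 5 _ _) _.
  rewrite /= cats0; apply: runs_cons (runs_nil _ 0).
  by have := @runs_load [::] [::] [::] [::] [::] (rev X) [::] [::] [::] y g; rewrite revK cats0.
by rewrite size_rev; lia.
Qed.

Lemma runs_packXY X Y z :
  runs packXY (stxy X z Y) (size z + 7 * size X + 5 * size Y + 9)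
    (cst [::] (map Some (pairw X Y)) [::] [::] [::]).
Proof.
apply: (@runs_le _ _ ((size z).+1 + (2 * size Y + 1 + (3 * size (rev Y) + 1 +
  (2 + (2 + (2 * size X + 1 + (5 * size (rev X) + 1 + 0)))))))).
  apply: runs_cons (runs_clear_st _ _) _; rewrite /=.
  apply: runs_cons; first by apply: runs_le (@runs_move_st 9 5 _ _) _.
  rewrite /= cats0; apply: runs_cons (@runs_load _ _ [::] _ _ _ _ _ _ _ _) _.
  rewrite revK cats0.
  apply: runs_cons (runs_pushsym_st _ _ _) _; rewrite /=.
  apply: runs_cons (runs_pushsym_st _ _ _) _; rewrite /=.
  apply: runs_cons; first by apply: runs_le (@runs_move_st 0 5 _ _) _.
  rewrite /= cats0; apply: runs_cons (runs_nil _ 0).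
  have := @runs_loadd [::] [::] (Some false :: Some false :: map Some Y) [::] [::] (rev X) [::] [::] [::] [::] [::].
  by rewrite revK /cst /pairw map_cat.
by rewrite !size_rev; lia.
Qed.

(** * Polynomial bounds and clocks *)

Definition polyb (f : nat -> nat) := exists c k, forall n, f n <= c * n.+1 ^ k.

Lemma polyb_le f g : (forall n, f n <= g n) -> polyb g -> polyb f.
Proof. by move=> h [c [k hg]]; exists c, k => n; apply: leq_trans (h n) (hg n). Qed.

Lemma polyb_const a : polyb (fun _ => a).
Proof. by exists a, 0 => n; rewrite muln1. Qed.

Lemma polyb_id : polyb id.
Proof. by exists 1, 1 => n; rewrite mul1n expn1. Qed.

Lemma polyb_add f g : polyb f -> polyb g -> polyb (fun n => f n + g n).
Proof.
move=> [c [k hf]] [d [l hg]]; exists (c + d), (k + l) => n.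
rewrite mulnDl; apply: leq_add; [apply: leq_trans (hf n) _ | apply: leq_trans (hg n) _].
  by rewrite leq_mul2l leq_pexp2l ?leq_addr ?orbT.
by rewrite leq_mul2l leq_pexp2l ?leq_addl ?orbT.
Qed.

Lemma polyb_mul f g : polyb f -> polyb g -> polyb (fun n => f n * g n).
Proof.
move=> [c [k hf]] [d [l hg]]; exists (c * d), (k + l) => n.
by rewrite expnD mulnACA leq_mul.
Qed.

Lemma polyb_succ f : polyb f -> polyb (fun n => (f n).+1).
Proof. by move=> h; apply: polyb_le (polyb_add (polyb_const 1) h). Qed.

Lemma polyb_exp f k : polyb f -> polyb (fun n => f n ^ k).
Proof.
move=> h; elim: k => [|k IH]; first exact: polyb_const.
by apply: polyb_le (polyb_mul h IH) => n; rewrite expnS.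
Qed.

Lemma polyb_comp f g : polyb f -> polyb g -> polyb (fun n => f (g n)).
Proof.
move=> [c [k hf]] hg; apply: polyb_le (fun n => hf (g n)) _.
exact/polyb_mul/polyb_exp/polyb_succ/hg/polyb_const.
Qed.

Ltac polyb := repeat lazymatch goal with
  | |- polyb (fun _ => ?a) => exact: polyb_const
  | |- polyb (fun n => n) => exact: polyb_id
  | |- polyb (fun n => S (@?f n)) => apply: (@polyb_succ f)
  | |- polyb (fun n => addn (@?f n) (@?g n)) => apply: (@polyb_add f g)
  | |- polyb (fun n => muln (@?f n) (@?g n)) => apply: (@polyb_mul f g)
  | |- polyb (fun n => expn (@?f n) ?k) => apply: (@polyb_exp f k)
  | |- polyb (fun n => costT (@?f n)) => apply: (@polyb_comp costT f)
  | |- polyb (muln ?a) => apply: (@polyb_mul (fun=> a) id)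
  | |- polyb (addn ?a) => apply: (@polyb_add (fun=> a) id)
  | |- polyb id => exact: polyb_id
  | |- polyb _ => assumption
  end.

Lemma polyb_outer_cost f : polyb f -> polyb (fun n => outer_cost (f n)).
Proof. by move=> h; rewrite /outer_cost; polyb. Qed.

Lemma polyb_costT : polyb costT.
Proof.
rewrite /costT; polyb; apply: polyb_outer_cost; polyb.
Qed.

(** * A polynomial clock in unary *)

Definition dstep := seqs [:: Push 7 true; Push 5 true].
Definition mstep1 := seqs [:: Loop 6 dstep dstep; move 7 6].
(** Multiplies stack 10 by stack 6: for each stroke of stack 10, the number on stack 6 is added to
    stack 5, and stack 7 saves it for the next round. *)
Definition mulpass := seqs [:: Loop 10 mstep1 mstep1; move 5 10].
(** Puts one more than the total length of both components on stack 6 and the initial factor 1 on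
    stack 10. The second component matters only by its length and is dropped; the first is rebuilt,
    being the input of the machine to be simulated. *)
Definition count1 := seqs [:: clear 8; move 0 5;
  Loop 5 (seqs [:: Push 0 false; Push 6 true]) (seqs [:: Push 0 true; Push 6 true]);
  move 9 5; Loop 5 (Push 6 true) (Push 6 true); Push 6 true; Push 10 true].
Definition clock c k := seqs (count1 :: nseq k mulpass ++
  [:: Loop 10 (pushw 5 (nseq c true)) (pushw 5 (nseq c true)); move 5 10; clear 6]).

Section Clock.
Variable X : word.
Definition stc a n n' m := st [:: X; [::]; [::]; [::]; [::]; nseq a true; nseq n true; nseq n' true;
                                [::]; [::]; nseq m true].

Lemma runs_dstep a n n' m :
  runs (Loop 6 dstep dstep) (stc a n n' m) (3 * n + 1) (stc (n + a) 0 (n + n') m).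
Proof.
elim: n a n' => [|n IH] a n'; first exact: runs_loopE.
apply: (@runs_le _ _ (1 + (1 + 0) + (3 * n + 1)).+1); last by lia.
have := IH a.+1 n'.+1; rewrite -[n + a.+1]addSnnS -[n + n'.+1]addSnnS => {}IH.
apply: (@runs_loop_st _ _ _ _ true (nseq n true)) IH; first by [].
exact: runs_cons (runs_push_st _ _ _) (runs_cons (runs_push_st _ _ _) (runs_nil _ 0)).
Qed.

Lemma runs_mstep1 a n m : runs mstep1 (stc a n 0 m) (5 * n + 2) (stc (n + a) n 0 m).
Proof.
apply: (@runs_le _ _ (3 * n + 1 + (2 * n + 1 + 0))); last by lia.
apply: runs_cons (runs_dstep _ _ _ _) _; apply: runs_cons (runs_nil _ 0).
have := @runs_move_st 7 6 [:: X; [::]; [::]; [::]; [::]; nseq (n + a) true; [::];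
   nseq (n + 0) true; [::]; [::]; nseq m true] isT.
by rewrite /= addn0 size_nseq rev_nseq cats0.
Qed.

Lemma runs_mulpass n m : runs mulpass (stc 0 n 0 m) (m * (7 * n + 3) + 2) (stc 0 n 0 (m * n)).
Proof.
have h a : runs (Loop 10 mstep1 mstep1) (stc a n 0 m) (m * (5 * n + 3) + 1) (stc (m * n + a) n 0 0).
  elim: m a => [|m IH] a; first exact: runs_loopE.
  apply: (@runs_le _ _ (5 * n + 2 + (m * (5 * n + 3) + 1)).+1); last by rewrite (mulSn m); lia.
  have := IH (n + a); rewrite addnA [m * n + n]addnC -mulSn => {}IH.
  by apply: (@runs_loop_st _ _ _ _ true (nseq m true)) IH; [|exact: runs_mstep1].
apply: (@runs_le _ _ (m * (5 * n + 3) + 1 + (2 * (m * n) + 1 + 0))); last by lia.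
apply: runs_cons (h 0) _; apply: runs_cons (runs_nil _ 0); rewrite addn0.
have := @runs_move_st 5 10 [:: X; [::]; [::]; [::]; [::]; nseq (m * n) true; nseq n true;
   [::]; [::]; [::]; [::]] isT.
by rewrite /= size_nseq rev_nseq cats0.
Qed.

Lemma runs_count1 z Y :
  runs count1 (stxy X z Y) (size z + 5 * size X + 4 * size Y + 7)
    (stc 0 (size X + size Y).+1 0 1).
Proof.
have h1 w x n : runs (Loop 5 (seqs [:: Push 0 false; Push 6 true]) (seqs [:: Push 0 true; Push 6 true]))
    (st [:: x; [::]; [::]; [::]; [::]; w; nseq n true; [::]; [::]; Y; [::]]) (3 * size w + 1)
    (st [:: rev w ++ x; [::]; [::]; [::]; [::]; [::]; nseq (size w + n) true; [::]; [::]; Y; [::]]).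
  elim: w x n => [|b w IH] x n; first exact: runs_loopE.
  apply: (@runs_le _ _ (1 + (1 + 0) + (3 * size w + 1)).+1); last by rewrite /=; lia.
  have := IH (b :: x) n.+1; rewrite [size w + n.+1]addnS => {}IH; rewrite rev_cons cat_rcons.
  apply: (@runs_loop_st _ _ _ _ b w) IH => //.
  by case: (b); exact: runs_cons (runs_push_st _ _ _) (runs_cons (runs_push_st _ _ _) (runs_nil _ 0)).
have h2 w n : runs (Loop 5 (Push 6 true) (Push 6 true))
    (st [:: X; [::]; [::]; [::]; [::]; w; nseq n true; [::]; [::]; [::]; [::]]) (2 * size w + 1)
    (st [:: X; [::]; [::]; [::]; [::]; [::]; nseq (size w + n) true; [::]; [::]; [::]; [::]]).
  elim: w n => [|b w IH] n; first exact: runs_loopE.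
  apply: (@runs_le _ _ (1 + (2 * size w + 1)).+1); last by rewrite /=; lia.
  have := IH n.+1; rewrite [size w + n.+1]addnS => {}IH.
  apply: (@runs_loop_st _ _ _ _ b w) IH => //.
  by case: (b); exact: runs_push_st.
apply: (@runs_le _ _ ((size z).+1 + (2 * size X + 1 + (3 * size (rev X) + 1 + (2 * size Y + 1 +
  (2 * size (rev Y) + 1 + (1 + (1 + 0)))))))); last by rewrite !size_rev; lia.
apply: runs_cons (runs_clear_st _ _) _; rewrite /=.
apply: runs_cons; first by apply: runs_le (@runs_move_st 0 5 _ _) _.
rewrite /= cats0.
apply: runs_cons (h1 _ _ 0) _; rewrite revK cats0 addn0 size_rev.
apply: runs_cons; first by apply: runs_le (@runs_move_st 9 5 _ _) _.
rewrite /= cats0.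
apply: runs_cons (h2 _ _) _; rewrite size_rev addnC.
apply: runs_cons (runs_push_st _ _ _) _; rewrite /=.
exact: runs_cons (runs_push_st _ _ _) (runs_nil _ 0).
Qed.

Definition clock_cost c k n :=
  6 * n + 8 + (k * (n.+1 ^ k * (7 * n.+1 + 3) + 2) + (n.+1 ^ k * (3 * c + 1) + n + 4)).

Lemma runs_clock c k z Y (n := size X + size Y) : size z <= 1 ->
  runs (clock c k) (stxy X z Y) (clock_cost c k n)
    (st [:: X; [::]; [::]; [::]; [::]; [::]; [::]; [::]; [::]; [::]; nseq (c * n.+1 ^ k) true]).
Proof.
move=> hz.
have hend m : runs (seqs [:: Loop 10 (pushw 5 (nseq c true)) (pushw 5 (nseq c true)); move 5 10; clear 6])
   (stc 0 n.+1 0 m) (m * (c + 1) + 1 + (2 * (m * c) + 1 + (n.+2 + 0)))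
    (st [:: X; [::]; [::]; [::]; [::]; [::]; [::]; [::]; [::]; [::]; nseq (m * c) true]).
  have h a : runs (Loop 10 (pushw 5 (nseq c true)) (pushw 5 (nseq c true))) (stc a n.+1 0 m)
      (m * (c + 1) + 1) (stc (m * c + a) n.+1 0 0).
    elim: m a => [|m IH] a; first exact: runs_loopE.
    apply: (@runs_le _ _ (size (nseq c true) + (m * (c + 1) + 1)).+1);
      last by rewrite size_nseq (mulSn m); lia.
    have := IH (c + a); rewrite addnA [m * c + c]addnC -mulSn => {}IH.
    apply: (@runs_loop_st _ _ _ _ true (nseq m true)) IH => //.
    have := runs_pushw_st 5 (nseq c true) [:: X; [::]; [::]; [::]; [::]; nseq a true; nseq n.+1 true;
      [::]; [::]; [::]; nseq m true].
    by rewrite /= rev_nseq -nseqD.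
  apply: runs_cons (h 0) _; rewrite addn0.
  apply: runs_cons.
    by apply: runs_le (@runs_move_st 5 10 _ _) _; rewrite //= size_nseq.
  rewrite /= cats0 rev_nseq; apply: runs_cons (runs_nil _ 0).
  by apply: runs_le (runs_clear_st 6 _) _; rewrite /= size_nseq.
(* All intermediate products are at most the final [n.+1 ^ k], so one bound serves every pass. *)
have hmul j cs t s' m : runs (seqs cs) (stc 0 n.+1 0 (m * n.+1 ^ j)) t s' -> m * n.+1 ^ j <= n.+1 ^ k ->
    runs (seqs (nseq j mulpass ++ cs)) (stc 0 n.+1 0 m) (j * (n.+1 ^ k * (7 * n.+1 + 3) + 2) + t) s'.
  elim: j m => [|j IH] m h hm; first by rewrite muln1 in h.
  rewrite mulSn -addnA.
  have hm1 : m <= n.+1 ^ k by apply: leq_trans hm; rewrite leq_pmulr // expn_gt0.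
  apply: runs_cons.
    apply: runs_le (runs_mulpass n.+1 m) _.
    by rewrite leq_add2r leq_mul2r hm1 orbT.
  by apply: IH; rewrite -mulnA -expnS.
rewrite /clock_cost; apply: runs_cons.
  by apply: runs_le (runs_count1 z Y) _; rewrite -/n; lia.
apply: hmul; last by rewrite mul1n.
rewrite mul1n [c * _]mulnC; apply: runs_le (hend _) _.
by rewrite -/n; nia.
Qed.

End Clock.

Lemma init_st x : init x = stxy x [::] [::].
Proof.
apply: functional_extensionality => j; rewrite /init /stxy /st.
by do 11?[case: j => [|j] //=]; rewrite nth_nil.
Qed.

Definition progU rest := seqs [:: transduce 5 udelta 0 8 1 5;
  switch 8 (nseq 3 Skip ++ [:: seqs [:: move 1 0; move 5 9; rest]; Skip])].

Lemma runs_unpair w : let: (q, a, o) := utr 0 w in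
  runs (transduce 5 udelta 0 8 1 5) (init w) (13 * (size w).+1)
   (st [:: [::]; rev a; [::]; [::]; [::]; rev o; [::]; [::]; nseq q true; [::]; [::]]).
Proof.
have := @runs_transduce 5 udelta 0 8 1 5 isT udelta_lt 1 udelta_small 0 (init w) isT erefl.
rewrite init_st; have -> : stxy w [::] [::] 0 = w by [].
by case: (utr 0 w) => [[q a] o]; rewrite !st_upd /= !cats0.
Qed.

Lemma runs_progU_valid x y rest t s' (n := size (pairw x y)) : runs rest (stxy x [::] y) t s' ->
  runs (progU rest) (init (pairw x y)) (17 * n + 23 + t) s'.
Proof.
move=> h; have hp := runs_unpair (pairw x y); rewrite utr_pairw -/n in hp.
have hn : size x + size y <= n.
  by have := tr_size udelta_lt udelta_small (pairw x y) (isT : 0 < 5); rewrite utr_pairw mul1n.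
apply: (@runs_le _ _ (13 * n.+1 + (2 * size (rev x) + 1 + (2 * size (rev y) + 1 + (t + 0)) + 4 + 0)));
  last by rewrite !size_rev; lia.
apply: runs_cons hp _; apply: runs_cons (runs_nil _ 0).
apply: (runs_switch (q := 3)) => //; rewrite st_upd /=.
apply: runs_cons; first by apply: runs_le (@runs_move_st 1 0 _ _) _.
apply: runs_cons; first by apply: runs_le (@runs_move_st 5 9 _ _) _.
by rewrite /= !revK !cats0; apply: runs_cons h (runs_nil _ 0).
Qed.

Lemma runs_progU_invalid w rest : ~ (exists x y, w = pairw x y) ->
  exists2 s, runs (progU rest) (init w) (17 * size w + 23) s & s 0 = [::].
Proof.
move=> hw; have := runs_unpair w; have := tr_lt udelta_lt w (isT : 0 < 5).
have : (utr 0 w).1.1 <> 3.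
  by case E: (utr 0 w) => [[q a] o] /= hq; apply: hw; exists a, o; apply: utr_valid; rewrite E hq.
case: (utr 0 w) => [[q a] o] /= hq hq5 h; eexists.
  apply: (@runs_le _ _ (13 * (size w).+1 + (0 + q.+1 + 0))); last by lia.
  apply: runs_cons h _; apply: runs_cons (runs_nil _ 0).
  apply: (runs_switch (q := q)); [by []|by []|].
  rewrite (_ : nth _ _ q = Skip); first exact: runs_skip.
  by move: hq hq5; do 5?[case: q => [|q]].
by rewrite upd_neq.
Qed.

Definition runM M := seqs [:: Push 10 true; simc M false; outp].
(** The three programs around a given machine [M]: automatizing algorithm, refutation checker, and
    simulation with a clock. *)
Definition progA M := seqs [:: progT; loadX; runM M].
Definition progC M := progU (seqs [:: progT; Case 8 (clear 0) Skip (seqs [:: packXY; runM M])]).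
Definition progS M c k := progU (seqs [:: progT; Case 8 (clear 0) Skip
  (seqs [:: clock c k; loadX; simc M true; outp])]).

Lemma runs_runM M w t out a : tm_computes_within M w t out ->
  size (encs (map Some w)) <= a ->
  exists2 s, runs (runM M) (cst [::] (map Some w) [::] [::] [::])
     (6 * a + 7 * (t.+1 * (2 * tm_q M + 22)) + 24) s & s 0 = out.
Proof.
rewrite /tm_computes_within -[tm_init M w]/(ord0, tp [::] (map Some w)).
case E: (tm_run _ _) => [tp'|] //= -[<-] ha.
have [l' [r' [-> h]]] := runs_simu [::] E.
have hs := runs_size 2 h.
have {}hs : size (encs r') <= size (encs (map Some w)) + (t.+1 * (2 * tm_q M + 22) + 1) by exact: hs.
have [s h2 hs2] := runs_outp l' r' [::] [::] [::].
exists s.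
  apply: (@runs_le _ _ (1 + (t.+1 * (2 * tm_q M + 22) + 1 + (6 * size (encs r') + 10 + 0)))); last by lia.
  apply: runs_cons (runs_push_st _ _ _) _; rewrite /=.
  by apply: runs_cons h _; apply: runs_cons h2 (runs_nil _ 0).
by rewrite hs2; case: (r').
Qed.

(** * Complete programs *)

Lemma leq_expn k : {homo expn^~ k : m n / m <= n}.
Proof. by case: k => // k m n h; rewrite leq_exp2r. Qed.

Lemma size_encs_some w : size (encs (map Some w)) = 2 * size w.
Proof. by elim: w => //= b w; rewrite -/(encs _) => ->; lia. Qed.

Lemma size_pairw x y : size (pairw x y) = 2 * size x + 2 + size y.
Proof.
by rewrite /pairw !size_cat addnA; congr (_ + _ + _); elim: x => //= b x ->; lia.
Qed.

Ltac mono := repeat lazymatch goal with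
  | |- is_true (leq ?a ?a) => exact: leqnn
  | |- is_true (leq (addn _ _) (addn _ _)) => apply: leq_add
  | |- is_true (leq (muln _ _) (muln _ _)) => apply: leq_mul
  | |- is_true (leq (S _) (S _)) => rewrite ltnS
  | |- _ => assumption
  end.

Lemma costT_mono : {homo costT : m n / m <= n}.
Proof. by move=> m n h; rewrite /costT /outer_cost; mono. Qed.

Lemma size_tau2 tau n : size (enc_cnf tau) <= n -> size (enc_cnf (tau2 tau)) <= n + costT n.
Proof.
move=> h; have := runs_size 0 (runs_progT_valid tau [::]).
rewrite /stxy /st /= => /leq_trans; apply.
exact: leq_add (costT_mono h).
Qed.

Definition costA M n t := costT n + 17 * (n + costT n) + 7 * (t.+1 * (2 * tm_q M + 22)) + 29.

Lemma runs_progA M tau t out : tm_computes_within M (enc_cnf (tau2 tau)) t out ->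
  exists2 s, runs (progA M) (init (enc_cnf tau)) (costA M (size (enc_cnf tau)) t) s & s 0 = out.
Proof.
move=> h; set X := enc_cnf _ in h *; set n := size _.
have hX : size X <= n + costT n by exact: size_tau2.
have [s h2 hs] := runs_runM h (leqnn _); exists s => //.
rewrite size_encs_some in h2.
apply: (@runs_le _ _ (costT n + (size [:: true] + 5 * size X + 3 +
  (6 * (2 * size X) + 7 * (t.+1 * (2 * tm_q M + 22)) + 24 + 0)))); last by rewrite /costA /=; lia.
rewrite init_st; apply: runs_cons (runs_progT_valid _ _) _.
apply: runs_cons (runs_loadX _ _ _ _) _.
exact: runs_cons h2 (runs_nil _ 0).
Qed.

Definition cnf_pair w := exists tau y, w = pairw (enc_cnf tau) y.

(** [polytime_fun] bounds the time on every word, so words that do not pair the code of a formula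
    with something must also be handled quickly. The empty output differs from [[:: true]], hence
    rejects. *)
Lemma runs_reject w rest : ~ cnf_pair w ->
  exists2 s, runs (progU (seqs [:: progT; Case 8 (clear 0) Skip rest])) (init w)
     (2 * costT (size w) + 19 * size w + 30) s & s 0 = [::].
Proof.
move=> hw; case: (classic (exists x y, w = pairw x y)) => [[x [y ew]]|h]; last first.
  have [s h1 h2] := runs_progU_invalid (seqs [:: progT; Case 8 (clear 0) Skip rest]) h.
  by exists s => //; apply: runs_le h1 _; lia.
have hx : ~ (exists tau, x = enc_cnf tau).
  by case=> tau e; apply: hw; exists tau, y; rewrite ew e.
have [s h1 h2] := runs_progT_invalid y hx.
have hs := runs_size 0 h1; rewrite (_ : stxy x [::] y 0 = x) // in hs.
exists (upd s 0 [::]); last by rewrite upd_eq.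
have hn : size x <= size w by rewrite ew size_pairw; lia.
have hc := costT_mono hn.
apply: (@runs_le _ _ (17 * size w + 23 + (costT (size x) + ((size (s 0)).+2 + 0)))); last by lia.
rewrite {1}ew {1}ew; apply: runs_progU_valid.
apply: runs_cons h1 _; apply: runs_cons (runs_nil _ 0).
exact: runs_caseE h2 (runs_clear _ _).
Qed.

Lemma runs_progC M w t out tau y : w = pairw (enc_cnf tau) y ->
  tm_computes_within M (pairw (enc_cnf (tau2 tau)) y) t out ->
  exists2 s, runs (progC M) (init w)
    (100 * costT (size w) + 100 * size w + 100 + 7 * (t.+1 * (2 * tm_q M + 22))) s & s 0 = out.
Proof.
move=> ew h; set X := enc_cnf (tau2 tau) in h; set n := size w.
have hx : size (enc_cnf tau) <= n by rewrite /n ew size_pairw; lia.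
have hy : size y <= n by rewrite /n ew size_pairw; lia.
have hX := size_tau2 hx; have hc := costT_mono hx.
have [s h2 hs] := runs_runM h (leqnn _); exists s => //.
rewrite size_encs_some size_pairw in h2.
apply: (@runs_le _ _ (17 * n + 23 + (costT (size (enc_cnf tau)) + ((size ([::] : word) + 7 * size X + 5 * size y + 9 +
  (6 * (2 * (2 * size X + 2 + size y)) + 7 * (t.+1 * (2 * tm_q M + 22)) + 24 + 0)).+1 + 0))));
  last by rewrite -/X in hX; rewrite /=; lia.
rewrite /n ew; apply: runs_progU_valid.
apply: runs_cons (runs_progT_valid _ _) _; apply: runs_cons (runs_nil _ 0).
apply: (@runs_case_st _ _ _ _ _ _ _ true [::]); first by [].
apply: runs_cons (@runs_packXY X y [::]) _.
exact: runs_cons h2 (runs_nil _ 0).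
Qed.

Definition costS q c k n := let N := n + costT n + n in
  100 * costT n + 100 * n + 100 + 6 * clock_cost c k N + 7 * (c * N.+1 ^ k * (2 * q + 22)).

Lemma runs_progS M c k w tau y : w = pairw (enc_cnf tau) y ->
  let X := enc_cnf (tau2 tau) in
  exists2 s, runs (progS M c k) (init w) (costS (tm_q M) c k (size w)) s &
    forall t out, t < c * (size X + size y).+1 ^ k -> tm_computes_within M X t out -> s 0 = out.
Proof.
move=> ew X; set n := size w.
have hx : size (enc_cnf tau) <= n by rewrite /n ew size_pairw; lia.
have hy : size y <= n by rewrite /n ew size_pairw; lia.
have hX := size_tau2 hx; have hc := costT_mono hx; rewrite -/X in hX.
set m := c * (size X + size y).+1 ^ k.
have [l' [r' [z [h1 h2]]]] := @runs_simc M ord0 [::] (map Some X) [::] m.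
have [s h3 hs] := runs_outp l' r' z [::] [::].
have hr : size (encs r') <= 2 * size X + (m * (2 * tm_q M + 22) + 1).
  by rewrite -size_encs_some; exact: (runs_size 2 h1).
exists s; last first.
  move=> t out ht; rewrite /tm_computes_within -[tm_init M X]/(ord0, tp [::] (map Some X)).
  case E: (tm_run _ _) => [tp'|] //= -[<-].
  by rewrite (h2 _ _ ht E) hs; case: (r').
have hN : size X + size y <= n + costT n + n by lia.
have hm : m <= c * (n + costT n + n).+1 ^ k.
  by rewrite /m leq_mul2l leq_expn ?orbT.
apply: (@runs_le _ _ (17 * n + 23 + (costT (size (enc_cnf tau)) + ((clock_cost c k (size X + size y) +
  (size ([::] : word) + 5 * size X + 3 + (m * (2 * tm_q M + 22) + 1 + (6 * size (encs r') + 10 + 0)))).+1 + 0)))).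
  rewrite /n ew; apply: runs_progU_valid.
  apply: runs_cons (runs_progT_valid _ _) _; apply: runs_cons (runs_nil _ 0).
  apply: (@runs_case_st _ _ _ _ _ _ _ true [::]); first by [].
  apply: runs_cons (@runs_clock X c k [::] y isT) _.
  apply: runs_cons (runs_loadX _ _ _ _) _.
  apply: runs_cons h1 _.
  exact: runs_cons h3 (runs_nil _ 0).
have hcl : clock_cost c k (size X + size y) <= clock_cost c k (n + costT n + n).
  rewrite /clock_cost; set a := size X + size y in hN *; set b := n + costT n + n in hN *.
  have he : a.+1 ^ k <= b.+1 ^ k by exact: leq_expn.
  apply: leq_add; first by lia.
  apply: leq_add; last by apply: leq_add => //; apply: leq_add => //; rewrite leq_mul2r he orbT.
  rewrite leq_mul2l leq_add2r; apply/orP; right.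
  by apply: leq_mul => //; lia.
rewrite /costS /=; move: (n + costT n + n) hN hm hcl => N hN hm hcl.
have : m * (2 * tm_q M + 22) <= c * N.+1 ^ k * (2 * tm_q M + 22) by rewrite leq_mul2r hm orbT.
move: (m * _) (c * _ * _) hr => u v; lia.
Qed.

Lemma tm_run_mono M t t' (c : config M) tp' : tm_run t c = Some tp' -> t <= t' -> tm_run t' c = Some tp'.
Proof.
elim: t t' c => [|t IH] [|t'] c; rewrite !tm_runE; case: (tm_step c) => [c'|] //.
exact: IH.
Qed.

Lemma computes_mono M x t t' y : tm_computes_within M x t y -> t <= t' -> tm_computes_within M x t' y.
Proof.
rewrite /tm_computes_within; case E: (tm_run t _) => [tp'|] // h le.
by rewrite (tm_run_mono E le).
Qed.

Definition compiled c := stm (pcode c).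
Definition ctime c n t := t.+1 * (3 * (n + nstk (pcode c) + t) + 3).

Lemma compiled_computes c x t s : runs c (init x) t s ->
  tm_computes_within (compiled c) x (ctime c (size x) t) (s 0).
Proof.
move=> [u hu /exec_tm h]; apply: computes_mono h _.
by apply: leq_mul => //; lia.
Qed.

Lemma polyb_ctime c f g : polyb f -> polyb g -> polyb (fun n => ctime c (f n) (g n)).
Proof. by move=> hf hg; rewrite /ctime; polyb. Qed.

(** The function is read off from the compiled machine, run for its own time bound. Thus a
    relational specification of the program suffices, and [R] may describe different kinds of inputs
    by undecided case distinctions. *)
Lemma polytime_of_cmd c (R : word -> word -> Prop) P : polyb P ->
  (forall x, exists2 s, runs c (init x) (P (size x)) s & R x (s 0)) ->
  exists2 f, polytime_fun f & forall x, R x (f x).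
Proof.
move=> hP h; pose B n := ctime c n (P n).
pose f x := odflt [::] (omap tm_out (tm_run (B (size x)) (tm_init (compiled c) x))).
have hf x s : runs c (init x) (P (size x)) s -> f x = s 0 /\
    tm_computes_within (compiled c) x (B (size x)) (f x).
  by move=> /compiled_computes hc; rewrite /f hc.
exists f; last by move=> x; have [s /hf [-> _]] := h x.
have [a [k hB]] : polyb B by apply: polyb_ctime; polyb.
exists (compiled c), a, k => x; exists (B (size x)); split; first exact: hB.
by have [s /hf []] := h x.
Qed.

(** * Derivations *)

Local Open Scope ring_scope.

Fixpoint ders n (ax prev Ds : seq (line n)) : Prop :=
  if Ds is D :: Ds' then valid_line ax prev D /\ ders ax (rcons prev D) Ds' else True.

Lemma dersP n (ax prev Ds : seq (line n)) : ders ax prev Ds <->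
  forall k, (k < size Ds)%N -> valid_line ax (prev ++ take k Ds) (nth [::] Ds k).
Proof.
elim: Ds prev => [|D Ds IH] prev //=; split.
  by move=> [h1 /IH h2] [|k] hk; [rewrite cats0 | rewrite -cat_rcons; apply: h2].
move=> h; split; first by have := h 0%N isT; rewrite /= cats0.
by apply/IH => k hk; rewrite cat_rcons; exact: (h k.+1).
Qed.

Lemma ders_cat n (ax prev D1 D2 : seq (line n)) :
  ders ax prev (D1 ++ D2) <-> ders ax prev D1 /\ ders ax (prev ++ D1) D2.
Proof.
elim: D1 prev => [|D D1 IH] prev /=; first by rewrite cats0; tauto.
by rewrite IH cat_rcons; tauto.
Qed.

Lemma valid_ax n (ax prev : seq (line n)) C D : C \in ax -> D =i C -> valid_line ax prev D.
Proof. by move=> h1 h2; left; exists C. Qed.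

Definition sub_eqn n (e1 e2 : eqn n) : eqn n := (e1.1 - e2.1, e1.2 - e2.2).

Lemma valid_res n (ax prev : seq (line n)) e1 e2 A B C1 C2 D :
  C1 \in prev -> C2 \in prev -> C1 =i e1 :: A -> C2 =i e2 :: B ->
  D =i sub_eqn e1 e2 :: A ++ B -> valid_line ax prev D.
Proof. by move=> *; right; left; exists C1, C2; split=> //; split=> //; exists e1, e2, A, B. Qed.

Ltac seteq := let e := fresh in move=> e; cbn [cat]; rewrite !in_cons ?in_nil;
  repeat match goal with |- context [@eq_op ?T ?x ?y] => generalize (@eq_op T x y) end;
  repeat (let b := fresh in intro b; destruct b); reflexivity.
Lemma rcons_last (T : eqType) (s : seq T) x : x \in rcons s x.
Proof. by rewrite mem_rcons mem_head. Qed.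

Lemma rcons_mem (T : eqType) (s : seq T) x y : x \in s -> x \in rcons s y.
Proof. by rewrite mem_rcons in_cons orbC => ->. Qed.

Ltac memr := lazymatch goal with
  | |- is_true (_ \in rcons _ _) => first [exact: rcons_last | apply: rcons_mem; memr]
  | _ => idtac
  end.

Section Derive.
Variables (n : nat) (ax : seq (line n)).
Implicit Types (prev : seq (line n)) (A D : line n) (a b c e o t u z : eqn n).

(* The equations are kept abstract in the next two lemmas: [x0], [x1] and [xm]
   stand for [x = 0], [x = 1] and [x = -1], with [c = a - z], [t = z - a] and
   [u = b - t = a + b - z]. *)
Definition diff_lines (a0 a1 z0 z1 c0 c1 : eqn n) : seq (line n) :=
  [:: [:: a0; a1]; [:: z0; z1]; [:: z0; a1]; [:: c0; a1]; [:: c1; c0; z1]].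

(** A case distinction on the values of [a] and [z]: the clause excludes [a = 0, z = 1], and
    subtraction gives 0 or 1 in the three remaining cases. *)
Lemma ders_diff a0 a1 z0 z1 c0 c1 prev D A1 :
  c0 = sub_eqn a0 z0 -> c0 = sub_eqn a1 z1 -> c1 = sub_eqn a1 z0 ->
  [:: a0; a1] \in ax -> [:: z0; z1] \in ax -> A1 \in ax -> A1 =i [:: z0; a1] ->
  D =i [:: c0; c1] -> ders ax prev (rcons (diff_lines a0 a1 z0 z1 c0 c1) D).
Proof.
move=> h1 h2 h3 ha hz hA eA eD /=; split; first exact: valid_ax ha _.
split; first exact: valid_ax hz _.
split; first by apply: valid_ax hA _ => e; rewrite eA.
split.
  by apply: (@valid_res _ _ _ a0 z0 [:: a1] [:: a1] [:: a0; a1] [:: z0; a1]); memr;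
    rewrite -?h1; seteq.
split.
  by apply: (@valid_res _ _ _ a1 z0 [:: c0] [:: z1] [:: c0; a1] [:: z0; z1]); memr;
    rewrite -?h3; seteq.
split=> //.
by apply: (@valid_res _ _ _ a1 z1 [:: c0] [:: c1; c0] [:: c0; a1] [:: c1; c0; z1]); memr;
  rewrite -?h2; try move=> e; rewrite ?eD; move: e; seteq.
Qed.

Definition sum_lines (a0 a1 b0 b1 z0 z1 t0 tm u0 u1 : eqn n) : seq (line n) :=
  [:: [:: a0; a1]; [:: z0; z1]; [:: b0; b1]; [:: z0; a1]; [:: z1; a0; b0];
      [:: t0; a1]; [:: tm; z1; t0]; [:: t0; tm]; [:: t0; a0; b0]; [:: t0; z1; b0];
      [:: t0; b0]; [:: u0; t0; tm]; [:: u1; t0; u0]; [:: u0; b1; u1]].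

(** As Resolution cannot add, [a + b - z] is reached as [b - t] with [t = z - a]. The clause for
    [z <= a] gives [t] in {0, -1}. The clause for [z >= a + b - 1] gives [t = 0] or [b = 0], which
    excludes the only case, [b = 1] and [t = -1], where [b - t] would be 2. *)
Lemma ders_sum a0 a1 b0 b1 z0 z1 t0 (tm : eqn n) u0 u1 prev D A1 A2 :
  t0 = sub_eqn z0 a0 -> t0 = sub_eqn z1 a1 -> tm = sub_eqn z0 a1 ->
  u0 = sub_eqn b0 t0 -> u1 = sub_eqn b0 tm -> u1 = sub_eqn b1 t0 ->
  [:: a0; a1] \in ax -> [:: z0; z1] \in ax -> [:: b0; b1] \in ax ->
  A1 \in ax -> A1 =i [:: z0; a1] -> A2 \in ax -> A2 =i [:: z1; a0; b0] ->
  D =i [:: u0; u1] -> ders ax prev (rcons (sum_lines a0 a1 b0 b1 z0 z1 t0 tm u0 u1) D).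
Proof.
move=> h1 h2 h3 h4 h5 h6 ha hz hb hA1 e1 hA2 e2 eD /=.
split; first exact: valid_ax ha _.
split; first exact: valid_ax hz _.
split; first exact: valid_ax hb _.
split; first by apply: valid_ax hA1 _ => e; rewrite e1.
split; first by apply: valid_ax hA2 _ => e; rewrite e2.
split.
  by apply: (@valid_res _ _ _ z0 a0 [:: a1] [:: a1] [:: z0; a1] [:: a0; a1]); memr;
    rewrite -?h1; seteq.
split.
  by apply: (@valid_res _ _ _ z0 a1 [:: z1] [:: t0] [:: z0; z1] [:: t0; a1]); memr;
    rewrite -?h3; seteq.
split.
  by apply: (@valid_res _ _ _ z1 a1 [:: tm; t0] [:: t0] [:: tm; z1; t0] [:: t0; a1]); memr;
    rewrite -?h2; seteq.
split.
  by apply: (@valid_res _ _ _ z1 a1 [:: a0; b0] [:: t0] [:: z1; a0; b0] [:: t0; a1]); memr;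
    rewrite -?h2; seteq.
split.
  by apply: (@valid_res _ _ _ z0 a0 [:: z1] [:: t0; b0] [:: z0; z1] [:: t0; a0; b0]); memr;
    rewrite -?h1; seteq.
split.
  by apply: (@valid_res _ _ _ z1 a1 [:: t0; b0] [:: t0] [:: t0; z1; b0] [:: t0; a1]); memr;
    rewrite -?h2; seteq.
split.
  by apply: (@valid_res _ _ _ b0 t0 [:: t0] [:: tm] [:: t0; b0] [:: t0; tm]); memr;
    rewrite -?h4; seteq.
split.
  by apply: (@valid_res _ _ _ b0 tm [:: t0] [:: u0; t0] [:: t0; b0] [:: u0; t0; tm]); memr;
    rewrite -?h5; seteq.
split.
  by apply: (@valid_res _ _ _ b0 t0 [:: b1] [:: u1; u0] [:: b0; b1] [:: u1; t0; u0]); memr;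
    rewrite -?h4; seteq.
split=> //.
by apply: (@valid_res _ _ _ b1 t0 [:: u0; u1] [:: u1; u0] [:: u0; b1; u1] [:: u1; t0; u0]); memr;
  rewrite -?h6; try move=> e; rewrite ?eD; move: e; seteq.
Qed.

Definition zero_lines (a0 a1 o0 : eqn n) : seq (line n) :=
  [:: [:: a0; a1]; [:: o0; a1]; [:: o0]].

(** No rule yields [0 = 0] outright; it comes from subtracting a Boolean axiom from itself, case by
    case, and [0 = 1] is then added by Weakening. *)
Lemma ders_zero a0 a1 o0 o1 prev D : o0 = sub_eqn a0 a0 -> o0 = sub_eqn a1 a1 ->
  [:: a0; a1] \in ax -> D =i [:: o0; o1] -> ders ax prev (rcons (zero_lines a0 a1 o0) D).
Proof.
move=> h1 h2 ha eD /=.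
split; first exact: valid_ax ha _.
split.
  by apply: (@valid_res _ _ _ a0 a0 [:: a1] [:: a1] [:: a0; a1] [:: a0; a1]); memr;
    rewrite -?h1; seteq.
split.
  by apply: (@valid_res _ _ _ a1 a1 [:: o0] [:: o0] [:: o0; a1] [:: o0; a1]); memr;
    rewrite -?h2; seteq.
split=> //; right; right; left; exists [:: o0]; split; first by memr.
by exists o1 => e; rewrite eD; move: e; seteq.
Qed.

End Derive.

(** * Norms of polynomials and sizes of lines *)

Section Norm.
Variable n : nat.
Implicit Types (p q : {mpoly int[n]}).

(** The unary size of the coefficients, for degree at most two. Summing over a fixed set of
    monomials instead of the support makes subadditivity immediate. *)
Definition nrm p : nat := (\sum_(m : 'X_{1..n < 3}) `|p@_m|)%N.

Lemma nrmD p q : (nrm (p + q) <= nrm p + nrm q)%N.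
Proof.
rewrite /nrm -big_split; apply: leq_sum => m _; rewrite mcoeffD /=; move: (p@_m) (q@_m) => a b; lia.
Qed.

Lemma nrmN p : nrm (- p) = nrm p.
Proof. by apply: eq_bigr => m _; rewrite mcoeffN abszN. Qed.

Lemma nrmB p q : (nrm (p - q) <= nrm p + nrm q)%N.
Proof. by rewrite -(nrmN q); exact: nrmD. Qed.

Lemma nrmZ c p : nrm (c *: p) = (`|c| * nrm p)%N.
Proof. by rewrite /nrm big_distrr; apply: eq_bigr => m _; rewrite mcoeffZ abszM. Qed.

Lemma nrm0 : nrm 0 = 0%N.
Proof. by rewrite /nrm big1 // => m _; rewrite mcoeff0. Qed.

Lemma nrm_sum (I : Type) (r : seq I) (P : pred I) (F : I -> {mpoly int[n]}) :
  (nrm (\sum_(i <- r | P i) F i) <= \sum_(i <- r | P i) nrm (F i))%N.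
Proof.
elim/big_rec2: _ => [|i a p _ h]; first by rewrite nrm0.
by apply: leq_trans (nrmD _ _) _; rewrite leq_add2l.
Qed.

Lemma nrmX m : (nrm 'X_[m] <= 1)%N.
Proof.
rewrite /nrm; case: (boolP [exists k : 'X_{1..n < 3}, m == k]) => [/existsP [k /eqP ->]|].
  rewrite (bigD1 k) //= mcoeffX eqxx big1 ?addn0 // => j hj.
  by rewrite mcoeffX (_ : (k == j :> 'X_{1..n}) = false) // eq_sym; apply: negbTE hj.
move/existsPn => h; rewrite big1 // => j _.
by rewrite mcoeffX (negbTE (h j)).
Qed.

Lemma nrm_msupp p : (msize p <= 3)%N -> (\sum_(m <- msupp p) `|p@_m|)%N = nrm p.
Proof.
move=> hp; rewrite (big_mksub 'X_{1..n < 3}) //=; first last.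
- by move=> x /msize_mdeg_lt /leq_trans; apply.
- exact: msupp_uniq.
by rewrite big_rmcond //= => m; rewrite mcoeff_msupp negbK => /eqP ->.
Qed.

Lemma size_enc_int (z : int) : size (enc_int z) = (`|z| + 2)%N.
Proof. by rewrite /enc_int size_cat /= size_cat size_nseq addn1 addn2. Qed.

Lemma size_enc_list (T : Type) (e : T -> word) s :
  size (enc_list e s) = (\sum_(x <- s) (size (e x)).+1).+1.
Proof.
by rewrite /enc_list size_cat addn1 size_flatten /shape -!map_comp sumnE big_map.
Qed.

Lemma size_enc_poly_ge p : (msize p <= 3)%N -> (nrm p < size (enc_poly p))%N.
Proof.
move=> hp; rewrite /enc_poly size_enc_list ltnS -nrm_msupp //; apply: leq_sum => m _.
by rewrite size_cat size_enc_int; move: (size (enc_monom m)) `|p@_m|%N => a b; lia.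
Qed.

Lemma size_enc_poly_le p K : (msize p <= 3)%N ->
  (forall m, m \in msupp p -> size (enc_monom m) <= K)%N ->
  (size (enc_poly p) <= (nrm p * (K + 4)).+1)%N.
Proof.
move=> hp hK; rewrite /enc_poly size_enc_list ltnS -nrm_msupp // big_distrl.
rewrite !big_seq; apply: leq_sum => m hm /=.
rewrite size_cat size_enc_int; have := hK m hm.
(* Coefficients on the support are nonzero integers, so the norm also bounds the number of
   monomials. *)
have : (0 < `|p@_m|)%N by rewrite absz_gt0 -mcoeff_msupp.
move: (size (enc_monom m)) `|p@_m|%N => a b; nia.
Qed.

Lemma size_enc_monom0 : size (@enc_monom n 0%MM) = 1%N.
Proof.
rewrite /enc_monom size_enc_list big_filter big_pred0 // => i.
by rewrite mnm0E.
Qed.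

Lemma size_enc_monom1 (i : 'I_n) : size (enc_monom U_(i)%MM) = (size (enc_nat i) + 5)%N.
Proof.
rewrite /enc_monom size_enc_list big_filter (eq_bigl (pred1 i)); last first.
  by move=> j; rewrite /= mnm1E [i == j]eq_sym; case: (j == i).
rewrite big_enum_cond /= big_pred1_eq mnm1E eqxx size_cat.
by rewrite -[size (enc_nat (nat_of_bool true))]/3%N; lia.
Qed.

End Norm.

Section Good.
Variables (n K : nat).
Implicit Types (p q : {mpoly int[n]}).

(** Independent of the size of the coefficients, hence stable under linear combinations; [nrm]
    controls the coefficients separately. *)
Definition good p := (msize p <= 2)%N /\
  forall m, m \in msupp p -> (size (enc_monom m) <= K)%N.

Lemma goodD p q : good p -> good q -> good (p + q).
Proof.
move=> [h1 h2] [h3 h4]; split.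
  by apply: leq_trans (msizeD_le _ _) _; rewrite geq_max h1.
by move=> m /msuppD_le; rewrite mem_cat => /orP [/h2|/h4].
Qed.

Lemma goodN p : good p -> good (- p).
Proof. by move=> [h1 h2]; split; rewrite ?msizeN // => m; rewrite (perm_mem (msuppN p)); exact: h2. Qed.

Lemma goodB p q : good p -> good q -> good (p - q).
Proof. by move=> h1 h2; apply: goodD => //; exact: goodN. Qed.

Lemma goodZ c p : good p -> good (c *: p).
Proof.
move=> [h1 h2]; split; first by apply: leq_trans (msizeZ_le _ _) h1.
by move=> m /msuppZ_le; exact: h2.
Qed.

Lemma good0 : good 0.
Proof. by split; rewrite ?msize0 // => m; rewrite msupp0. Qed.

Lemma good1 : (0 < K)%N -> good 1.
Proof.
move=> hK; split; first by rewrite msize1.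
by move=> m; rewrite msupp1 inE => /eqP ->; rewrite size_enc_monom0.
Qed.

Lemma goodX (i : 'I_n) : (size (enc_nat i) + 5 <= K)%N -> good 'X_i.
Proof.
move=> hK; split; first by rewrite msizeX mdeg1.
by move=> m; rewrite msuppX inE => /eqP ->; rewrite size_enc_monom1.
Qed.

Lemma good_sum (I : Type) (r : seq I) (P : pred I) (F : I -> {mpoly int[n]}) :
  (forall i, P i -> good (F i)) -> good (\sum_(i <- r | P i) F i).
Proof. by move=> h; elim/big_ind: _ => //; [exact: good0 | exact: goodD]. Qed.

(** Fits the auxiliary lines in the derivations of Boolean axioms; norm three is needed for
    [a + b - z]. *)
Definition small (C : line n) := (size C <= 4)%N /\
  forall e, e \in C -> [/\ good e.1, (nrm e.1 <= 3)%N & (`|e.2| <= 1)%N].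

Lemma small_size C : small C -> (size (enc_list (@enc_eqn n) C) <= 12 * K + 80)%N.
Proof.
move=> [h1 h2]; rewrite size_enc_list.
have : (\sum_(x <- C) (size (enc_eqn x)).+1 <= \sum_(x <- C) (3 * K + 19))%N.
  rewrite !big_seq; apply: leq_sum => e /h2 [[g1 g2] g3 g4].
  rewrite /enc_eqn size_cat size_enc_int.
  have := size_enc_poly_le (leq_trans g1 (isT : 2 <= 3)%N) g2.
  have : (nrm e.1 * (K + 4) <= 3 * (K + 4))%N by rewrite leq_mul2r g3 orbT.
  move: g4; move: (nrm _ * _)%N `|e.2|%N (size (enc_poly e.1)) => a b c; clear; lia.
rewrite big_const_seq count_predT iter_addn_0 => h; nia.
Qed.
End Good.

(** * From quadratic to linear refutations *)

Lemma lt_nvars (sigma : cnf) (l : literal) : l \in flatten sigma -> (l.1 < nvars sigma)%N.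
Proof.
rewrite /nvars; elim: (flatten sigma) => //= a s IH; rewrite inE leq_max.
by case/orP => [/eqP ->|/IH ->]; rewrite ?leqnn ?orbT.
Qed.

Lemma nvars_gt0 (sigma : cnf) : (0 < nvars sigma)%N -> exists l, l \in flatten sigma.
Proof. by rewrite /nvars; case: (flatten sigma) => // l s _; exists l; rewrite mem_head. Qed.

Lemma varE n i (hi : (i < n)%N) : var n i = 'X_(Ordinal hi).
Proof. by rewrite /var insubT. Qed.

Section Translation.
Variable tau : cnf.
Notation n := (nvars tau).
Notation n' := (nvars (tau2 tau)).
Notation vs := (tvars tau).

Lemma mem_ren u : u \in vs -> exists2 l, l \in flatten (tau2 tau) & l.1 = xname u.
Proof.
case/mapP=> l /flattenP [cl hcl hl] ->; exists (xname l.1, l.2) => //.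
apply/flattenP; exists [seq (xname l.1, l.2) | l <- cl]; last by apply/mapP; exists l.
by rewrite mem_cat; apply/orP; left; apply/mapP; exists cl.
Qed.

Lemma mem_zdefs u v cl : u \in vs -> v \in vs -> cl \in zdefs u v -> cl \in tau2 tau.
Proof.
move=> hu hv hcl; rewrite mem_cat; apply/orP; right.
apply/flattenP; exists (flatten (map (zdefs u) vs)); first by apply: map_f hu.
by apply/flattenP; exists (zdefs u v) => //; apply: map_f hv.
Qed.

Lemma xname_lt u : u \in vs -> (xname u < n')%N.
Proof. by case/mem_ren=> l /lt_nvars h <-. Qed.

Lemma zname_lt u v : u \in vs -> v \in vs -> (zname u v < n')%N.
Proof.
move=> hu hv; apply: (@lt_nvars _ (zname u v, false)); apply/flattenP.
exists [:: (zname u v, false); (xname u, true)]; last by rewrite mem_head.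
by apply: mem_zdefs hu hv _; rewrite mem_head.
Qed.

Definition occ (i : 'I_n) := nat_of_ord i \in vs.
Definition xpoly (i : 'I_n) : {mpoly int[n']} := if occ i then var n' (xname i) else 0.
Definition zpoly (i j : 'I_n) : {mpoly int[n']} :=
  if occ i && occ j then var n' (zname i j) else 0.

(** A monomial does not determine the order of its two factors, whereas [zname u v] and [zname v u]
    differ; [pick] settles on one order, and later arguments allow for both. *)
Definition phi (m : 'X_{1..n}) : {mpoly int[n']} :=
  if m == 0%MM then 1 else
  if [pick i | m == U_(i)%MM] is Some i then xpoly i else
  if [pick p : 'I_n * 'I_n | m == (U_(p.1) + U_(p.2))%MM] is Some p then zpoly p.1 p.2
  else 0.

(** The sum ranges over all monomials of degree below three, not over the support of [p], so
    additivity is immediate and holds for every polynomial. *)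
Definition Phi (p : {mpoly int[n]}) : {mpoly int[n']} :=
  \sum_(m : 'X_{1..n < 3}) p@_m *: phi m.

Lemma PhiD p q : Phi (p + q) = Phi p + Phi q.
Proof. by rewrite /Phi -big_split; apply: eq_bigr => m _; rewrite mcoeffD scalerDl. Qed.

Lemma PhiN p : Phi (- p) = - Phi p.
Proof. by rewrite /Phi -sumrN; apply: eq_bigr => m _; rewrite mcoeffN scaleNr. Qed.

Lemma PhiB p q : Phi (p - q) = Phi p - Phi q.
Proof. by rewrite PhiD PhiN. Qed.

Lemma Phi0 : Phi 0 = 0.
Proof. by rewrite -[X in Phi X](subrr 0) PhiB subrr. Qed.

Lemma PhiXm m : (mdeg m < 3)%N -> Phi 'X_[m] = phi m.
Proof.
move=> hm; rewrite /Phi (bigD1 (BMultinom hm)) //= mcoeffX eqxx scale1r big1 ?addr0 // => k hk.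
rewrite mcoeffX (_ : (m == k) = false) ?scale0r //.
by apply/negbTE; apply: contra hk => /eqP e; apply/eqP/val_inj.
Qed.

Lemma PhiX i : Phi 'X_i = xpoly i.
Proof.
rewrite PhiXm ?mdeg1 // /phi mnm1_eq0.
case: pickP => [j|/(_ i)]; last by rewrite eqxx.
by rewrite eq_mnm1 => /eqP ->.
Qed.

Lemma mnm1D_inj (i j k l : 'I_n) : (U_(i) + U_(j) == U_(k) + U_(l))%MM ->
  (i = k /\ j = l) \/ (i = l /\ j = k).
Proof.
move/eqP => e; have h o : ((i == o) + (j == o) = (k == o) + (l == o))%N.
  by have := congr1 (fun m : 'X_{1..n} => m o) e; rewrite !mnmDE !mnm1E.
case: (eqVneq i k) => [eik|nik].
  left; split=> //; subst k; move: (h j); rewrite eqxx => /addnI.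
  by case: (eqVneq l j).
right; have := h i; rewrite eqxx [k == i]eq_sym (negbTE nik) add0n.
case: (eqVneq l i) => [eli|//]; subst l; split=> //.
by move: (h k); rewrite eqxx addnC => /addIn; case: (eqVneq j k).
Qed.

Lemma PhiXX i j : Phi ('X_i * 'X_j) = zpoly i j \/ Phi ('X_i * 'X_j) = zpoly j i.
Proof.
rewrite -mpolyXD PhiXm ?mdegD ?mdeg1 // /phi mnmD_eq0 !mnm1_eq0 /=.
case: pickP => [k /eqP e|_].
  by have := congr1 mdeg e; rewrite mdegD !mdeg1.
case: pickP => [[k l] /= /mnm1D_inj [] [-> ->]|/(_ (i, j))]; [by left|by right|].
by rewrite /= eqxx.
Qed.

Notation T := (size (enc_cnf tau)).
(** Codes of variables of [tau] have at most [6 * T] bits, so the code of a product name has at most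
    [2 * (6 * T + 6 * T) + 3]; as a monomial it takes 5 more. *)
Notation K := (24 * T + 8)%N.

Lemma size_enc_var u : u \in vs -> (size (enc_nat u) <= 6 * T)%N.
Proof.
move=> hu; have [_ /(_ u hu) h] := size_codes vs.
have := tr_size pdelta_lt pdelta_small (enc_cnf tau) (isT : 0 < 8)%N.
by rewrite ptr_cnf /=; lia.
Qed.

Lemma size_dbl w : size (dbl w) = (2 * size w)%N.
Proof. by elim: w => //= b w; rewrite -/(dbl w) => ->; lia. Qed.

Lemma size_enc_xname u : size (enc_nat (xname u)) = (2 * size (enc_nat u) + 3)%N.
Proof.
rewrite enc_natE bin_xname; move: (enc_nat u) => a.
by rewrite size_cat size_dbl size_cat /=; lia.
Qed.

Lemma size_enc_zname u v :
  size (enc_nat (zname u v)) = (2 * (size (enc_nat u) + size (enc_nat v)) + 3)%N.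
Proof.
rewrite enc_natE bin_zname; move: (enc_nat u) (enc_nat v) => a b.
by rewrite size_cat size_dbl !size_cat /=; lia.
Qed.

Lemma good_xpoly i : good K (xpoly i) /\ (nrm (xpoly i) <= 1)%N.
Proof.
rewrite /xpoly; case: ifP => hi; last by rewrite nrm0; split=> //; exact: good0.
rewrite (varE (xname_lt hi)); split; last exact: nrmX.
apply: goodX; rewrite /= size_enc_xname.
by have := size_enc_var hi; lia.
Qed.

Lemma good_zpoly i j : good K (zpoly i j) /\ (nrm (zpoly i j) <= 1)%N.
Proof.
rewrite /zpoly; case: ifP => hij; last by rewrite nrm0; split=> //; exact: good0.
have /andP [hi hj] := hij.
rewrite (varE (zname_lt hi hj)); split; last exact: nrmX.
apply: goodX; rewrite /= size_enc_zname.
by have := size_enc_var hi; have := size_enc_var hj; lia.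
Qed.

Lemma good_phi m : good K (phi m) /\ (nrm (phi m) <= 1)%N.
Proof.
rewrite /phi; case: ifP => _.
  by split; [apply: good1; lia | rewrite -mpolyX0; exact: nrmX].
case: pickP => [i _|_]; first exact: good_xpoly.
case: pickP => [p _|_]; first exact: good_zpoly.
by rewrite nrm0; split=> //; exact: good0.
Qed.

Lemma good_Phi p : good K (Phi p).
Proof. by apply: good_sum => m _; apply: goodZ; have [] := good_phi m. Qed.

Lemma nrm_Phi p : (nrm (Phi p) <= nrm p)%N.
Proof.
apply: leq_trans (nrm_sum _ _ _) _; apply: leq_sum => m _; rewrite nrmZ.
by have [_] := good_phi m; case: (nrm _) => [|[|k]] // _; rewrite ?muln0 ?muln1.
Qed.

Definition Phi_eqn (e : eqn n) : eqn n' := (Phi e.1, e.2).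
Definition Phi_line (C : line n) : line n' := map Phi_eqn C.

(** [Phi] does not increase the norm, and the norm of [p] is below the length of the code of [p];
    only the longer names of variables remain to be paid for. *)
Lemma size_Phi_line (C : line n) : (forall e, e \in C -> (msize e.1 <= 3)%N) ->
  (size (enc_list (@enc_eqn n') (Phi_line C)) <= (K + 4) * size (enc_list (@enc_eqn n) C))%N.
Proof.
move=> hC; set k := K; rewrite !size_enc_list big_map mulnS big_distrr /=.
rewrite -add1n; apply: leq_add; first by lia.
rewrite !big_seq; apply: leq_sum => e /hC he.
rewrite /enc_eqn 2!(size_cat (enc_poly _)) !size_enc_int /=.
have [g1 g2] : good k (Phi e.1) := good_Phi _.
have h1 := size_enc_poly_le (leq_trans g1 (isT : 2 <= 3)%N) g2.
have h2 := size_enc_poly_ge he; have h3 := nrm_Phi e.1.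
move: h1 h2 h3; clearbody k; clear g1 g2.
move: (size (enc_poly (Phi e.1))) (nrm (Phi e.1)) (nrm e.1) (size (enc_poly e.1)) `|e.2|%N k.
clear => a b c d x k h1 h2 h3.
have : (b * (k + 4) <= d * (k + 4))%N by rewrite leq_mul2r (leq_trans h3 (ltnW h2)) orbT.
by nia.
Qed.

Notation ax := (quad_bool_axioms n ++ clause_lines tau).
Notation ax' := (lin_bool_axioms n' ++ clause_lines (tau2 tau)).

Lemma in01_ax u (hu : (u < n')%N) : in01 (var n' u) \in ax'.
Proof.
rewrite (varE hu) mem_cat; apply/orP; left.
by apply: (map_f (fun i => in01 'X_i)); rewrite mem_enum.
Qed.

Lemma clause_ax cl : cl \in tau2 tau -> clause_line n' cl \in ax'.
Proof. by move=> h; rewrite mem_cat; apply/orP; right; exact: map_f. Qed.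

Lemma Phi_in01 p : Phi_line (in01 p) = in01 (Phi p).
Proof. by []. Qed.

Definition smallp (p : {mpoly int[n']}) j := good K p /\ (nrm p <= j)%N.

Lemma smallp_xpoly i : smallp (xpoly i) 1. Proof. exact: good_xpoly. Qed.
Lemma smallp_zpoly i j : smallp (zpoly i j) 1. Proof. exact: good_zpoly. Qed.
Lemma smallp0 : smallp 0 0. Proof. by split; rewrite ?nrm0 //; exact: good0. Qed.

Lemma smallpB p q i j : smallp p i -> smallp q j -> smallp (p - q) (i + j).
Proof.
move=> [g1 h1] [g2 h2]; split; first exact: goodB.
by apply: leq_trans (nrmB _ _) _; exact: leq_add.
Qed.

Definition small_eqn (e : eqn n') := [/\ good K e.1, (nrm e.1 <= 3)%N & (`|e.2| <= 1)%N].

Lemma smallp_eqn p j a : smallp p j -> (j <= 3)%N -> (`|a| <= 1)%N -> small_eqn (p, a).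
Proof. by move=> [g h] hj ha; split=> //; exact: leq_trans hj. Qed.

Lemma small_nil : small K ([::] : line n').
Proof. by split. Qed.

Lemma small_cons (e : eqn n') C : small_eqn e -> (size C < 4)%N -> small K C -> small K (e :: C).
Proof. by move=> he hC [_ h]; split=> // x; rewrite inE => /orP [/eqP ->|/h]. Qed.

Definition smalls (Ds : seq (line n')) := forall E, E \in Ds -> small K E.

Lemma smalls_nil : smalls [::]. Proof. by []. Qed.

Lemma smalls_cons D Ds : small K D -> smalls Ds -> smalls (D :: Ds).
Proof. by move=> hD h E; rewrite inE => /orP [/eqP ->|/h]. Qed.

Ltac smalls := repeat lazymatch goal with
  | |- smalls [::] => exact: smalls_nil
  | |- smalls _ => apply: smalls_cons
  | |- small _ [::] => exact: small_nil
  | |- small _ _ => apply: small_cons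
  | _ => first [assumption | by []]
  end.

(** Uniform in [prev], so that the derivation can be inserted at any point. The longest one,
    [sum_lines], has fourteen auxiliary lines. The size of [D] is left open because [size_Phi_line]
    bounds it. *)
Definition derivable (D : line n') := forall prev, exists2 Ds,
  ders ax' prev (rcons Ds D) & (size Ds <= 20)%N /\ smalls Ds.

Lemma derivable_ax C D : C \in ax' -> D =i C -> derivable D.
Proof.
move=> hC hD prev; exists [::]; split=> //=.
exact: valid_ax hC hD.
Qed.

(** The variable [i] itself may be absent from [tau], but its existence makes [n] positive, so some
    literal occurs in [tau] and supplies the axiom to be subtracted from itself. *)
Lemma derivable_zero (i : 'I_n) D : D =i in01 0 -> derivable D.
Proof.
move=> hD prev.
have [l hl] : exists l, l \in flatten tau by apply: nvars_gt0; apply: leq_ltn_trans (ltn_ord i).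
have hv : l.1 \in vs by exact: map_f hl.
pose j := Ordinal (lt_nvars hl); have hj : occ j by [].
have ha := in01_ax (xname_lt hv).
have ea : var n' (xname l.1) = xpoly j by rewrite /xpoly hj.
rewrite ea in ha.
exists (zero_lines (xpoly j, 0) (xpoly j, 1) (0, 0)).
  by apply: ders_zero hD => //; rewrite /sub_eqn /= subrr.
have s1 := smallp_eqn (smallp_xpoly j).
split=> //; rewrite /zero_lines.
have e1 : small_eqn (xpoly j, 0) by apply: s1.
have e2 : small_eqn (xpoly j, 1) by apply: s1.
have e3 : small_eqn (0, 0) by apply: smallp_eqn smallp0 _ _.
by smalls.
Qed.

Section Occ.
Variables (i j : 'I_n) (z : {mpoly int[n']}).
Hypotheses (hi : occ i) (hj : occ j) (hz : z = zpoly i j \/ z = zpoly j i).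

Lemma small_z : smallp z 1.
Proof. by case: hz => ->; exact: smallp_zpoly. Qed.

Lemma xpoly_occ k : occ k -> xpoly k = var n' (xname k).
Proof. by rewrite /xpoly => ->. Qed.

Lemma zpoly_occ k l : occ k -> occ l -> zpoly k l = var n' (zname k l).
Proof. by rewrite /zpoly => -> ->. Qed.

Lemma ax_x k : occ k -> [:: (xpoly k, 0); (xpoly k, 1)] \in ax'.
Proof. by move=> hk; rewrite (xpoly_occ hk); exact: in01_ax (xname_lt hk). Qed.

Lemma ax_z : [:: (z, 0); (z, 1)] \in ax'.
Proof.
by case: hz => ->; rewrite zpoly_occ //; exact: in01_ax (zname_lt _ _).
Qed.

(** Both orders of the product are defined in [tau2 tau]; depending on the order, the implication is
    the first or the second clause of [zdefs]. *)
Lemma ax_imp : exists2 A, A \in ax' & A =i [:: (z, 0); (xpoly i, 1)].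
Proof.
exists (clause_line n' [:: (if z == zpoly i j then zname i j else zname j i, false); (xname i, true)]).
  apply: clause_ax; case: ifP => _.
    by apply: (mem_zdefs hi hj); rewrite !inE eqxx.
  by apply: (mem_zdefs hj hi); rewrite !inE eqxx ?orbT.
rewrite /clause_line /= (xpoly_occ hi).
case: eqP => [->|ne]; first by rewrite zpoly_occ.
by case: hz => // ->; rewrite zpoly_occ.
Qed.

Lemma ax_or : exists2 A, A \in ax' & A =i [:: (z, 1); (xpoly i, 0); (xpoly j, 0)].
Proof.
case: hz => ->; rewrite zpoly_occ // !xpoly_occ //.
  exists (clause_line n' [:: (zname i j, true); (xname i, false); (xname j, false)]) => //.
  by apply/clause_ax/(mem_zdefs hi hj); rewrite !inE eqxx ?orbT.
exists (clause_line n' [:: (zname j i, true); (xname j, false); (xname i, false)]).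
  by apply/clause_ax/(mem_zdefs hj hi); rewrite !inE eqxx ?orbT.
by move=> e; rewrite /clause_line /= !inE; congr (_ || _); rewrite orbC.
Qed.

Lemma derivable_diff D : D =i in01 (xpoly i - z) -> derivable D.
Proof.
move=> hD prev; have [A hA eA] := ax_imp.
exists (diff_lines (xpoly i, 0) (xpoly i, 1) (z, 0) (z, 1) (xpoly i - z, 0) (xpoly i - z, 1)).
  by apply: (ders_diff _ _ _ _ (ax_x hi) ax_z hA eA hD).
have sx a := @smallp_eqn _ _ a (smallp_xpoly i) isT.
have sz a := @smallp_eqn _ _ a small_z isT.
have sd a := @smallp_eqn _ _ a (smallpB (smallp_xpoly i) small_z) isT.
split=> //; have := (sx 0 isT, sx 1 isT, sz 0 isT, sz 1 isT, sd 0 isT, sd 1 isT).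
by move=> [[[[[? ?] ?] ?] ?] ?]; rewrite /diff_lines; smalls.
Qed.

Lemma derivable_sum D : D =i in01 (xpoly i + xpoly j - z) -> derivable D.
Proof.
move=> hD prev; have [A hA eA] := ax_imp; have [B hB eB] := ax_or.
set a := xpoly i in hD eA eB *; set b := xpoly j in hD eB *.
pose t := z - a; pose u := b - t.
have hu : u = a + b - z by rewrite /u /t opprB addrA [b + a]addrC.
rewrite -hu in hD.
exists (sum_lines (a, 0) (a, 1) (b, 0) (b, 1) (z, 0) (z, 1) (t, 0) (t, -1) (u, 0) (u, 1)).
  by apply: (ders_sum _ _ _ _ _ _ _ (ax_x hi) ax_z (ax_x hj) hA eA hB eB hD).
have sa := @smallp_eqn _ _ _ (smallp_xpoly i) isT.
have sb := @smallp_eqn _ _ _ (smallp_xpoly j) isT.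
have sz := @smallp_eqn _ _ _ small_z isT.
have ht := smallpB small_z (smallp_xpoly i).
have st := @smallp_eqn _ _ _ ht isT.
have su := @smallp_eqn _ _ _ (smallpB (smallp_xpoly j) ht) isT.
split=> //; rewrite -/a -/b -/t -/u in sa sb st su.
have := (sa 0 isT, sa 1 isT, sb 0 isT, sb 1 isT, sz 0 isT, sz 1 isT).
have := (st 0 isT, st (-1) isT, su 0 isT, su 1 isT).
by move=> [[[? ?] ?] ?] [[[[[? ?] ?] ?] ?] ?]; rewrite /sum_lines; smalls.
Qed.

End Occ.

Lemma Phi_clause cl : cl \in tau ->
  Phi_line (clause_line n cl) = clause_line n' [seq (xname l.1, l.2) | l <- cl].
Proof.
move=> hcl; rewrite /Phi_line /clause_line -!map_comp; apply/eq_in_map => l hl /=.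
have hfl : l \in flatten tau by apply/flattenP; exists cl.
have hv : l.1 \in vs by exact: map_f hfl.
by rewrite /Phi_eqn /= (varE (lt_nvars hfl)) PhiX /xpoly /occ hv.
Qed.

Lemma derivable_xpoly i D : D =i in01 (xpoly i) -> derivable D.
Proof.
case: (boolP (occ i)) => hi hD; first exact: derivable_ax (ax_x hi) hD.
by apply: (derivable_zero i); rewrite /xpoly (negbTE hi) in hD.
Qed.

Lemma zpoly_nocc i j : ~~ (occ i && occ j) -> zpoly i j = 0 /\ zpoly j i = 0.
Proof. by rewrite /zpoly [occ j && _]andbC => /negbTE ->. Qed.

(** If one of the two variables is absent from [tau], their product goes to 0 and the quadratic
    axiom degenerates to the Boolean axiom of a single variable, or of 0. *)
Lemma derivable_axiom C D : C \in ax -> D =i Phi_line C -> derivable D.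
Proof.
rewrite mem_cat => /orP [|/mapP [cl hcl ->]]; last first.
  rewrite Phi_clause //; apply: derivable_ax; apply: clause_ax.
  by rewrite mem_cat; apply/orP; left; apply/mapP; exists cl.
rewrite /quad_bool_axioms !mem_cat => /or3P [/mapP [i _ ->]||].
- by rewrite Phi_in01 PhiX; exact: derivable_xpoly.
- case/allpairsP => -[i j] [_ _ ->]; rewrite Phi_in01 PhiB PhiD !PhiX /= => hD.
  case: (boolP (occ i && occ j)) => [/andP [hi hj]|h].
    exact: derivable_sum hi hj (PhiXX i j) D hD.
  have ez : Phi ('X_i * 'X_j) = 0 by have [z1 z2] := zpoly_nocc h; case: (PhiXX i j) => ->.
  rewrite ez subr0 in hD; move: h; rewrite negb_and => /orP [] h.
    by apply: (derivable_xpoly (i := j)); rewrite /xpoly (negbTE h) add0r in hD.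
  by apply: (derivable_xpoly (i := i)); rewrite [xpoly j]/xpoly (negbTE h) addr0 in hD.
- case/allpairsP => -[i j] [_ _ ->]; rewrite Phi_in01 PhiB !PhiX /= => hD.
  case: (boolP (occ i && occ j)) => [/andP [hi hj]|h].
    exact: derivable_diff hi hj (PhiXX i j) D hD.
  have ez : Phi ('X_i * 'X_j) = 0 by have [z1 z2] := zpoly_nocc h; case: (PhiXX i j) => ->.
  by apply: (derivable_xpoly (i := i)); rewrite ez subr0 in hD.
Qed.

Lemma Phi_line_mem C D : C =i D -> Phi_line C =i Phi_line D.
Proof. exact: eq_mem_map. Qed.

(** Inferences are copied one for one: Resolution by [PhiB], Simplification by [Phi0], Weakening
    because [Phi] acts on each equation. Only axioms need extra lines. *)
Lemma derivable_step (pi : seq (line n)) (pi' : seq (line n')) D :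
  valid_line ax pi D -> (forall C, C \in pi -> Phi_line C \in pi') ->
  exists2 Ds, ders ax' pi' (rcons Ds (Phi_line D)) & (size Ds <= 20)%N /\ smalls Ds.
Proof.
move=> hv hpi.
have direct : valid_line ax' pi' (Phi_line D) -> exists2 Ds,
    ders ax' pi' (rcons Ds (Phi_line D)) & (size Ds <= 20)%N /\ smalls Ds.
  by move=> h; exists [::].
case: hv => [[C [hC hD]]|[[C1 [C2 [h1 [h2 [e1 [e2 [A [B [eC1 [eC2 eD]]]]]]]]]]|[[C [hC [e eD]]]|[C [hC [k [A [hk [eC eD]]]]]]]]].
- by apply: (derivable_axiom hC); exact: Phi_line_mem.
- apply: direct; right; left; exists (Phi_line C1), (Phi_line C2).
  split; [exact: hpi | split; [exact: hpi|]].
  exists (Phi_eqn e1), (Phi_eqn e2), (Phi_line A), (Phi_line B).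
  split; [exact: Phi_line_mem eC1 | split; [exact: Phi_line_mem eC2|]].
  by move=> x; rewrite (Phi_line_mem eD) /Phi_line /= map_cat {1}/Phi_eqn /= PhiB.
- apply: direct; right; right; left; exists (Phi_line C); split; first exact: hpi.
  by exists (Phi_eqn e); exact: Phi_line_mem eD.
- apply: direct; right; right; right; exists (Phi_line C); split; first exact: hpi.
  exists k, (Phi_line A); split=> //; split; last exact: Phi_line_mem eD.
  by move=> x; rewrite (Phi_line_mem eC) /= /Phi_eqn /= Phi0.
Qed.

Definition psize m (pi : seq (line m)) := (\sum_(C <- pi) (size (enc_list (@enc_eqn m) C)).+1)%N.

(** A line yields at most 20 auxiliary lines of at most [12 * K + 81] bits, and its image is at most
    [K + 4] times as long as itself. Since [psize] counts each line at least once, the factor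
    [300 * K + 2000] absorbs both. *)
Lemma translate (pi : seq (line n)) :
  (forall C, C \in pi -> forall e, e \in C -> (msize e.1 <= 3)%N) -> ders ax [::] pi ->
  exists pi', [/\ ders ax' [::] pi', forall C, C \in pi -> Phi_line C \in pi',
    forall C, C \in pi' -> forall e, e \in C -> (msize e.1 <= 2)%N,
    (psize pi' <= psize pi * (300 * K + 2000))%N
    & last [::] pi' = Phi_line (last [::] pi)].
Proof.
elim/last_ind: pi => [|pi D IH] hdeg; first by exists [::]; split=> //; rewrite /psize big_nil.
rewrite -cats1 ders_cat => -[/IH {}IH [hD _]].
have {IH} [|pi' [h1 h2 h3 h4 h5]] := IH; first by move=> C hC; apply: hdeg; rewrite mem_rcons inE hC orbT.
have [Ds hDs [hs1 hs2]] := derivable_step hD h2.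
exists (pi' ++ rcons Ds (Phi_line D)); split.
- by rewrite ders_cat.
- move=> C; rewrite cats1 mem_rcons inE mem_cat => /orP [/eqP ->|/h2 ->] //.
  by rewrite mem_rcons mem_head orbT.
- move=> C; rewrite mem_cat mem_rcons inE => /orP [/h3 //|/orP [/eqP ->|/hs2 [_ hC] e /hC [[]]]] //.
  by move=> e /mapP [e' _ ->]; have [] := good_Phi e'.1.
- have hsm : (psize Ds <= 20 * (12 * K + 81))%N.
    have : (psize Ds <= \sum_(E <- Ds) (12 * K + 81))%N.
      rewrite /psize !big_seq; apply: leq_sum => E /hs2 /small_size.
      by rewrite (addnS _ 80) ltnS.
    rewrite big_const_seq count_predT iter_addn_0 => h.
    by apply: leq_trans h _; rewrite mulnC leq_mul2r hs1 orbT.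
  have hDin : D \in rcons pi D by rewrite mem_rcons mem_head.
  have hl := size_Phi_line (hdeg D hDin).
  have psc m (s1 s2 : seq (line m)) : psize (s1 ++ s2) = (psize s1 + psize s2)%N.
    by rewrite /psize big_cat.
  have ps1 m (E : line m) : psize [:: E] = (size (enc_list (@enc_eqn m) E)).+1.
    by rewrite /psize big_seq1.
  rewrite -[rcons Ds _]cats1 !psc !ps1 mulnDl; move: hsm hl h4.
  move: (psize pi') (psize pi) (psize Ds) (size _) (size (enc_list _ D)) K => a b c d e k.
  by clear => h1 h2 h3; nia.
- by rewrite cats1 last_rcons last_cat last_rcons.
Qed.

End Translation.

(** * The main theorem *)

Local Close Scope ring_scope.

Lemma tau2_sat tau : cnf_sat tau -> cnf_sat (tau2 tau).
Proof.
case=> a /allP ha; set vs := tvars tau.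
(* The names are plain numbers, so [b] searches for a variable or a pair with name [k]; by
   injectivity and disjointness of the names the answer is unambiguous. *)
pose b k := has (fun u => (xname u == k) && a u) vs ||
  has (fun p : nat * nat => (zname p.1 p.2 == k) && (a p.1 && a p.2)) [seq (u, v) | u <- vs, v <- vs].
have bx u : u \in vs -> b (xname u) = a u.
  move=> hu; apply/orP/idP => [[/hasP [v _ /andP [/eqP /xname_inj -> //]]|]|h].
    by case/hasP=> -[v w] _ /andP [/eqP e]; case: (@xname_zname u v w).
  by left; apply/hasP; exists u => //; rewrite eqxx.
have bz u v : u \in vs -> v \in vs -> b (zname u v) = a u && a v.
  move=> hu hv; apply/orP/idP => [[/hasP [w _ /andP [/eqP e]]|]|h].
  - by case: (@xname_zname w u v).
  - by case/hasP=> -[u' v'] _ /= /andP [/eqP /zname_inj [-> ->]].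
  - right; apply/hasP; exists (u, v); last by rewrite /= eqxx.
    by apply/allpairsP; exists (u, v).
exists b; apply/allP => cl; rewrite mem_cat => /orP [/mapP [c hc ->]|].
  have /hasP [l hl /eqP e] := ha c hc; apply/hasP; exists (xname l.1, l.2).
    by apply/mapP; exists l.
  by rewrite /= bx ?e //; apply: map_f; apply/flattenP; exists c.
case/flattenP=> ? /mapP [u hu ->] /flattenP [? /mapP [v hv ->]].
by rewrite !inE => /or3P [] /eqP -> /=; rewrite ?bz ?bx //; case: (a u); case: (a v).
Qed.

Lemma tau2_sat_inv tau : cnf_sat (tau2 tau) -> cnf_sat tau.
Proof.
case=> b /allP hb; exists (fun u => b (xname u)); apply/allP => cl hcl.
have hr : [seq (xname l.1, l.2) | l : literal <- cl] \in tau2 tau.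
  by rewrite mem_cat; apply/orP; left; apply/mapP; exists cl.
have /hasP [l' hl' h] := hb _ hr; case/mapP: hl' h => l hl -> h.
by apply/hasP; exists l.
Qed.

(** In the simulation the clock is set after [tau] has been replaced by [tau2 tau], so bounds in the
    size of [tau] are restated in that of [tau2 tau]. *)
Lemma size_tau2_ge tau : size (enc_cnf tau) <= size (enc_cnf (tau2 tau)).
Proof.
rewrite [enc_cnf]/(enc_list enc_clause) !size_enc_list ltnS big_cat big_map /=.
apply: leq_trans (leq_addr _ _); apply: leq_sum => cl _.
rewrite ltnS !size_enc_list ltnS big_map; apply: leq_sum => l _.
rewrite ltnS /enc_lit !(size_cat (enc_nat _)) leq_add2r /= size_enc_xname; lia.
Qed.

Lemma R0quad_translate tau y : R0quad (enc_cnf tau) y -> exists y', R0lin (enc_cnf (tau2 tau)) y' /\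
  size y' <= size y * (300 * (24 * size (enc_cnf tau) + 8) + 2000).
Proof.
case=> tau' [pi [/enc_cnf_inj e [-> [hdeg [[pi0 epi] hval]]]]]; subst tau'.
have hd : ders (quad_bool_axioms (nvars tau) ++ clause_lines tau) [::] pi by apply/dersP.
have [pi' [h1 h2 h3 h4 h5]] := translate hdeg hd.
exists (enc_refutation pi'); split.
  exists (tau2 tau), pi'; split=> //; split=> //; split; first exact: h3.
  split; last by move/dersP: h1.
  (* The translated refutation is nonempty, so its last line is a real one and not the default of
     [last]. *)
  have : Phi_line [::] \in pi' by apply: h2; rewrite epi mem_rcons mem_head.
  case/lastP: pi' h5 {h1 h2 h3 h4} => // pi1 D; rewrite epi !last_rcons => -> _.
  by exists pi1.
have er m (p : seq (line m)) : size (enc_refutation p) = (psize p).+1.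
  by rewrite /enc_refutation size_enc_list.
rewrite !er; move: h4; clear.
move: (psize _) (psize _) (300 * _) => a b c; nia.
Qed.

Lemma tm_run_size M t q l h r tp' : @tm_run M t (q, (l, h, r)) = Some tp' ->
  size tp'.2 <= size r + t.
Proof.
elim: t q l h r => [|t IH] q l h r; rewrite tm_runE /=.
all: case: (tm_delta M (q, h)) => [[[q' w] d]|] //; last by case=> <-; exact: leq_addr.
by case: d => /IH; rewrite /= ?size_behead; lia.
Qed.

Lemma size_somes r : size (somes r) <= size r.
Proof. by elim: r => // -[b|] r. Qed.

(** Bounds the length of the refutation produced by the given simulation of R^0(lin) through its
    running time. *)
Lemma computes_size M x t y : tm_computes_within M x t y -> size y <= size x + t.+1.
Proof.
rewrite /tm_computes_within /tm_init; case E: (tm_run _ _) => [[[l h] r]|] //= [<-].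
have := tm_run_size E; rewrite size_behead size_map /= => hr.
by apply: leq_trans (size_somes (h :: r)) _; rewrite /=; lia.
Qed.

Lemma min_ref_exists (R : word -> word -> Prop) x y : R x y ->
  exists2 s, min_ref_size R x s & s <= size y.
Proof.
elim/ltn_ind: {y}(size y) {-2}y (erefl (size y)) => k IH y ek hy.
case: (classic (exists2 y', R x y' & size y' < k)) => [[y' hy' hlt]|h].
  by have [s hs le] := IH _ hlt y' erefl hy'; exists s => //; rewrite ek; lia.
exists (size y) => //; split; first by exists y.
by move=> y' hy'; rewrite leqNgt; apply/negP => hlt; apply: h; exists y' => //; rewrite -ek.
Qed.

Lemma pairw_inj x y x' y' : pairw x y = pairw x' y' -> x = x' /\ y = y'.
Proof. by move=> e; have := utr_pairw x y; rewrite e utr_pairw => -[-> ->]. Qed.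

Lemma polyb_clock_cost c k f : polyb f -> polyb (fun n => clock_cost c k (f n)).
Proof. by move=> h; rewrite /clock_cost; polyb. Qed.

Section Main.
Variable Q : refsys.

Definition ref2 (x y : word) := exists tau, x = enc_cnf tau /\ rs_ref Q (enc_cnf (tau2 tau)) y.

Lemma ref2E tau y : ref2 (enc_cnf tau) y <-> rs_ref Q (enc_cnf (tau2 tau)) y.
Proof. by split=> [[tau' [/enc_cnf_inj <-]]|h] //; exists tau. Qed.

(** The checker of [Q] is run on the pair with [tau] replaced by [tau2 tau]; [R] also fixes the
    output on malformed words, which are rejected. *)
Lemma ref2_check : polytime_pred (fun w => exists x y, w = pairw x y /\ ref2 x y).
Proof.
have [fQ [[M [c [k hM]]] hfQ]] := rs_check Q.
pose R w out := (forall tau y, w = pairw (enc_cnf tau) y ->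
  out = fQ (pairw (enc_cnf (tau2 tau)) y)) /\ (~ cnf_pair w -> out = [::]).
(* The argument passed to the checker of [Q] has length [2 * size X + 2 + size y], where the code
   [X] of [tau2 tau] has at most [n + costT n] bits. *)
pose tt n := c * (2 * (n + costT n) + 2 + n).+1 ^ k.
pose P n := 2 * costT n + 19 * n + 30 +
   (100 * costT n + 100 * n + 100 + 7 * ((tt n).+1 * (2 * tm_q M + 22))).
have hcT := polyb_costT.
have hP : polyb P by rewrite /P /tt; polyb.
have [w|f hf hR] := @polytime_of_cmd (progC M) R P hP.
  case: (classic (cnf_pair w)) => [[tau [y ew]]|h].
    have [t [ht hc]] := hM (pairw (enc_cnf (tau2 tau)) y).
    have [s h1 h2] := runs_progC ew hc; exists s.
      apply: runs_le h1 _; rewrite /P; apply: leq_trans (leq_addl _ _).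
      rewrite leq_add2l leq_mul2l leq_mul2r ltnS (leq_trans ht) ?orbT // /tt.
      rewrite leq_mul2l leq_expn ?orbT // ltnS size_pairw.
      have hx : size (enc_cnf tau) <= size w by rewrite ew size_pairw; lia.
      by have := size_tau2 hx; have : size y <= size w by [rewrite ew size_pairw; lia]; lia.
    split=> [tau' y'|h]; last by case: h; exists tau, y.
    by rewrite ew => /pairw_inj [/enc_cnf_inj <- <-].
  have [s h1 h2] := runs_reject (seqs [:: packXY; runM M]) h; exists s.
    by apply: runs_le h1 _; rewrite /P; lia.
  by split=> // tau y ew; case: h; exists tau, y.
exists f; split=> // w; have [hR1 hR2] := hR w; split.
  case=> x [y [ew [tau [ex h]]]]; rewrite ex in ew; rewrite (hR1 _ _ ew).
  by apply/hfQ; exists (enc_cnf (tau2 tau)), y.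
case: (classic (cnf_pair w)) => [[tau [y ew]]|/hR2 -> //].
rewrite (hR1 _ _ ew) => /hfQ [x0 [y0 [/pairw_inj [<- <-] h]]].
by exists (enc_cnf tau), y; split=> //; apply/ref2E.
Qed.

Lemma ref2_sound x y : ref2 x y -> exists tau, x = enc_cnf tau /\ cnf_unsat tau.
Proof.
case=> tau [-> /rs_sound [tau' [/enc_cnf_inj <- h]]]; exists tau; split=> //.
by move/tau2_sat.
Qed.

Lemma ref2_complete tau : cnf_unsat tau -> exists y, ref2 (enc_cnf tau) y.
Proof.
move=> h; have [|y hy] := @rs_complete Q (tau2 tau); first by move/tau2_sat_inv.
by exists y; apply/ref2E.
Qed.

Definition refsys2 := Build_refsys ref2_check ref2_sound ref2_complete.

Lemma ctime_mono c n n' t t' : n <= n' -> t <= t' -> ctime c n t <= ctime c n' t'.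
Proof. by move=> h1 h2; rewrite /ctime; mono. Qed.

Lemma costA_mono M n n' t t' : n <= n' -> t <= t' -> costA M n t <= costA M n' t'.
Proof.
move=> h1 h2; rewrite /costA leq_add2r; have := costT_mono h1.
by move=> h; mono.
Qed.

(** The refutations of [tau] in the new system are literally those of [tau2 tau] in [Q], so both
    formulas have the same minimal refutation size, and [tau2] enlarges the formula only
    polynomially. *)
Lemma automatizable2 : automatizable Q -> automatizable refsys2.
Proof.
case=> M [c [k hM]].
pose tt n := c * (n + costT n + n).+1 ^ k.
pose B n := ctime (progA M) n (costA M n (tt n)).
have hcT := polyb_costT.
have [c' [k' hB]] : polyb B by apply: polyb_ctime; rewrite /costA /tt; polyb.
exists (compiled (progA M)), c', k' => tau hun s [[y0 [hy0 es]] hmin].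
have hun2 : cnf_unsat (tau2 tau) by move/tau2_sat_inv.
have hmin2 : min_ref_size (rs_ref Q) (enc_cnf (tau2 tau)) s.
  split; first by exists y0; split=> //; apply/ref2E.
  by move=> y hy; apply: hmin; apply/ref2E.
have [t [y [ht [hc hr]]]] := hM _ hun2 _ hmin2.
have [st' h1 h2] := runs_progA hc.
have := compiled_computes h1; rewrite h2 => h3.
eexists; exists y; split; last by split; [exact: h3 | apply/ref2E].
set n := size (enc_cnf tau); apply: leq_trans (hB (n + s)).
have hn : n <= n + s by exact: leq_addr.
apply: ctime_mono => //; apply: costA_mono => //.
apply: leq_trans ht _; rewrite /tt leq_mul2l leq_expn ?orbT // ltnS.
by have := size_tau2 hn; lia.
Qed.

(** The given quadratic refutation enters the computation only through its length, which sets the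
    clock. Neither [Phi] nor [f] is ever computed; they only bound the minimal [Q]-refutation of
    [tau2 tau], and with it the search time of [M]. *)
Lemma psimulates2 : automatizable Q -> psimulates (rs_ref Q) R0lin ->
  psimulates (rs_ref refsys2) R0quad.
Proof.
case=> M [c [k hM]] [f [[Mf [cf [kf hf]]] hsim]].
(* Sizes of the linear refutation, of the argument of [f] and of its value, and
   the running time of [M], in terms of [size X + size y] below. *)
pose b1 n := n * (300 * (24 * n + 8) + 2000).
pose b2 n := 2 * n + 2 + b1 n.
pose b3 n := b2 n + (cf * (b2 n).+1 ^ kf).+1.
pose b4 n := c * (n + b3 n).+1 ^ k.
(* The successor makes the search time strictly smaller than the clock, as the clocked interpreter
   requires. *)
have [c' [k' hB]] : polyb (fun n => (b4 n).+1) by rewrite /b4 /b3 /b2 /b1; polyb.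
pose R w out := forall tau y, w = pairw (enc_cnf tau) y ->
  let X := enc_cnf (tau2 tau) in forall t o, t < c' * (size X + size y).+1 ^ k' ->
  tm_computes_within M X t o -> out = o.
pose P n := 2 * costT n + 19 * n + 30 + costS (tm_q M) c' k' n.
have hcT := polyb_costT.
have hP : polyb P.
  by rewrite /P /costS; polyb; apply: polyb_clock_cost; polyb.
have [w|g hg hR] := @polytime_of_cmd (progS M c' k') R P hP.
  case: (classic (cnf_pair w)) => [[tau [y ew]]|h].
    have [s h1 h2] := runs_progS M c' k' ew; exists s.
      by apply: runs_le h1 _; rewrite /P; lia.
    move=> tau' y'; rewrite ew => /pairw_inj [/enc_cnf_inj <- <-]; exact: h2.
  have [s h1 h2] := runs_reject (seqs [:: clock c' k'; loadX; simc M true; outp]) h; exists s.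
    by apply: runs_le h1 _; rewrite /P; lia.
  by move=> tau y ew; case: h; exists tau, y.
exists g; split=> // x y hxy; have [tau [_ [ex _]]] := hxy; subst x.
apply/ref2E; set X := enc_cnf (tau2 tau); set n := size X + size y.
have [y' [hy' hsy']] := R0quad_translate hxy.
have hsy : size y' <= b1 n.
  apply: leq_trans hsy' _; have := size_tau2_ge tau; rewrite -/X => h.
  by rewrite /b1; apply: leq_mul; rewrite /n; lia.
have hq := hsim _ _ hy'.
have [t0 [ht0 hc0]] := hf (pairw X y').
have hp : size (pairw X y') <= b2 n by rewrite size_pairw /b2; rewrite /n in hsy *; lia.
have hsf : size (f (pairw X y')) <= b3 n.
  apply: leq_trans (computes_size hc0) _; rewrite /b3; apply: leq_add => //.
  rewrite ltnS; apply: leq_trans ht0 _.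
  by rewrite leq_mul2l leq_expn ?orbT.
have [s hmin hs] := min_ref_exists hq.
have [tau' [/enc_cnf_inj etau hun]] := rs_sound hq; rewrite -{tau'}etau in hun.
have [t [o [ht [hc hr]]]] := hM _ hun _ hmin.
rewrite (hR (pairw (enc_cnf tau) y) tau y erefl t o) //.
apply: leq_trans (hB _); rewrite ltnS; apply: leq_trans ht _.
rewrite /b4 leq_mul2l leq_expn ?orbT // ltnS -/X -/n.
by apply: leq_add; [rewrite /n; lia | apply: leq_trans hsf].
Qed.

End Main.

(** The linear axioms are among the quadratic ones, the rules coincide and the degree bound is
    weaker, so the refutation serves verbatim, and any simulation of R^0(quad) also simulates
    R^0(lin). *)
Lemma R0lin_R0quad x y : R0lin x y -> R0quad x y.
Proof.
case=> tau [pi [-> [-> [hdeg [hlast hval]]]]]; exists tau, pi; split=> //; split=> //.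
split; first by move=> C hC e he; apply: leq_trans (hdeg C hC e he) _.
split=> // k hk; case: (hval k hk) => [[C [hC hD]]|h]; [left|by right].
exists C; split=> //; move: hC; rewrite /quad_bool_axioms !mem_cat.
by case/orP => ->; rewrite ?orbT.
Qed.

Theorem theorem4 : weakly_automatizable R0quad <-> weakly_automatizable R0lin.
Proof.
split=> [[Q [hQ [f [hf hs]]]]|[Q [hQ hs]]].
  by exists Q; split=> //; exists f; split=> // x y /R0lin_R0quad /hs.
exists (refsys2 Q); split; first exact: automatizable2.
exact: psimulates2.
Qed.
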